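(* Let $m\in(2-n,\infty)$, $0\le r_1<r_3\le\infty$, $u\in H^1(B_{r_3})$ (with $u\in H^1_{loc}(\mathbb{R}^n)$ if $r_3=\infty$), constants $\Lambda_\pm\ge0$, $\alpha,c_E,\epsilon\in(0,1]$, $\gamma\in[0,1)$, and an energy functional $\mathcal{E}:H^1(B_1)\to[-1,1]$ be such that: (1) $r\mapsto\mathcal{E}(u_r)$ is a $BV_{loc}$ function on $(r_1,r_3)$, and satisfies $$\frac{d}{dr}\mathcal{E}(u_r)\ge\frac{c_E}{r}\big(\mathcal{E}(z_r)-\mathcal{E}(u_r)\big)+\frac{c_E}{r}\int_{\partial B_1}r^2|\partial_ru_r|^2\,d\mathcal{H}^{n-1}-\Lambda_+r^{\alpha-1}-\Lambda_-r^{-\alpha-1}\quad\text{for a.e. }r\in(r_1,r_3);$$ (2) for a.e. $r\in(r_1,r_3)$, $$\mathcal{E}(u_r)\le\mathcal{E}(z_r)-\epsilon|\mathcal{E}(z_r)|^{1+\gamma}+\Lambda_+r^\alpha+\Lambda_-r^{-\alpha};$$ and $\max\{\Lambda_+r_3^\alpha,\Lambda_-r_1^{-\alpha}\}\le1$. Then there are $c,\delta>0$ depending only on $(c_E,\epsilon,\gamma,\alpha)$ such that: (a) If $r_1=0$ (and so, necessarily, $\Lambda_-=0$), then there is a limit $u_0\in L^2(\partial B_1)$ so that for all $r<r_3$, $$\|u_r-u_0\|_{L^2(\partial B_1)}\le\begin{cases}c\log(r_3/r)^{\frac{\gamma-1}{2\gamma}}&\gamma>0\\ c\,(r/r_3)^{\frac{\delta}{2}}&\gamma=0.\end{cases}$$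 (b) If $r_3=\infty$ (and so $\Lambda_+=0$), then there is a limit $u_\infty\in L^2(\partial B_1)$ so that for all $r>r_1$, $$\|u_r-u_\infty\|_{L^2(\partial B_1)}\le\begin{cases}c\log(r/r_1)^{\frac{\gamma-1}{2\gamma}}&\gamma>0\\ c\,(r_1/r)^{\frac{\delta}{2}}&\gamma=0.\end{cases}$$ (c) If both $r_1=0$ and $r_3=\infty$, then $\partial_ru_r\equiv0$.
   Context: $B_r$ is the ball of radius $r$ about $0$ in $\mathbb{R}^n$. For $r\le r_3$, $u_r(x)=r^{-m}u(rx)\in H^1(B_1)$ is the $m$-homogeneous rescaling; for a.e. $r\in(0,r_3)$, $z_r(x)=|x|^mu_r(x/|x|)\in H^1(B_1)$ is the $m$-homogeneous extension of $u_r|_{\partial B_1}$ to $B_1$. On $\partial B_1$, $\partial_ru_r(\theta)=\frac{d}{dr}\big(r^{-m}u(r\theta)\big)$. $\mathcal{H}^{n-1}$ is $(n-1)$-dimensional Hausdorff measure. Conventions: $\Lambda_-=0$ if $r_1=0$ and $\Lambda_+=0$ if $r_3=\infty$; $\infty$ to a negative power is $0$.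
   Formalization: In (1) the inequality for the derivative of the BV_loc function E(u_r) is read as one between measures: besides holding for a.e. r, the singular part of the derivative must be nonnegative; with downward jumps allowed the claim fails. *)

(* Defs.v *)
From HB Require Import structures.
From mathcomp Require Import all_boot all_order all_algebra.
From mathcomp Require Import all_classical all_reals all_analysis.
Import Order.TTheory GRing.Theory Num.Theory.
Import numFieldNormedType.Exports.

Set Implicit Arguments.
Unset Strict Implicit.
Unset Printing Implicit Defensive.

Local Open Scope classical_set_scope.
Local Open Scope ring_scope.

(* Outer measure of A generated by the sets [B j] with weights [g j],
   [j \in adm], through countable covers of A; [None] is an unused slot, so that
   finite covers are included. *)
Section cover_outer_measure.
Local Open Scope ereal_scope.
Context (R : realType) (T J : Type).
Variables (adm : set J) (B : J -> set T) (g : J -> \bar R).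

Definition covers (A : set T) : set (nat -> option J) :=
  [set C | (forall k j, C k = Some j -> adm j) /\
           A `<=` \bigcup_k oapp B set0 (C k)].

Definition cover_outer (A : set T) : \bar R :=
  ereal_inf [set \sum_(k <oo) oapp g 0 (C k) | C in covers A].

Hypothesis g_ge0 : forall j, 0 <= g j.

Let w (o : option J) : \bar R := oapp g 0 o.

Let w_ge0 o : 0 <= w o. Proof. by case: o => //=. Qed.

Lemma le_cover_outer : {homo cover_outer : A D / A `<=` D >-> A <= D}.
Proof.
move=> A D AD; apply/ereal_inf_le_tmp => x [C [admC DC] <-].
by exists C => //; split => //; apply: subset_trans AD DC.
Qed.

Lemma cover_outer_ge0 A : 0 <= cover_outer A.
Proof.
by apply: le_ereal_inf_tmp => x [C _ <-]; apply: nneseries_ge0 => k _ _; exact: w_ge0.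
Qed.

Lemma cover_outer0 : cover_outer set0 = 0.
Proof.
apply/eqP; rewrite eq_le; apply/andP; split; last exact/cover_outer_ge0.
apply: ereal_inf_lbound; exists (fun=> None); first by split.
by apply: eseries0.
Qed.

Lemma cover_outer_sigma_subadditive : sigma_subadditive cover_outer.
Proof.
move=> A; have [[i ioo]|] := pselect (exists i, cover_outer (A i) = +oo).
  rewrite (eseries_pinfty _ _ ioo) ?leey// => k _.
  by rewrite -ltNye (lt_le_trans _ (cover_outer_ge0 _)).
rewrite -forallNE => Aoo.
suff add2e (e : {posnum R}) :
    cover_outer (\bigcup_n A n) <= \sum_(i <oo) cover_outer (A i) + e%:num%:E.
  by apply/lee_addgt0Pr => _/posnumP[].
rewrite (le_trans _ (epsilon_trick _ _ _))//; last first.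
  by move=> k; exact: cover_outer_ge0.
pose P k (C : nat -> option J) := covers (A k) C /\
  \sum_(l <oo) w (C l) <= cover_outer (A k) + (e%:num / (2 ^ k.+1)%:R)%:E.
have [G PG] : {G : nat -> nat -> option J & forall k, P k (G k)}.
  apply: (@choice _ _ P) => k; rewrite /P /cover_outer.
  set S := (X in ereal_inf X); move infS : (ereal_inf S) => iS.
  case: iS infS => [r Sr|Soo|Soo].
  - have en1 : (0 < e%:num / (2 ^ k.+1)%:R)%R by [].
    have /(lb_ereal_inf_adherent en1) : ereal_inf S \is a fin_num by rewrite Sr.
    move=> [x [C covC xS] Cx].
    by exists C; split => //; rewrite -Sr -/w; apply/ltW; rewrite xS.
  - by have := Aoo k; rewrite /cover_outer Soo.
  - suff : lbound S 0 by move/le_ereal_inf_tmp; rewrite Soo.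
    by move=> /= _ [C _ <-]; apply: nneseries_ge0 => l _ _; exact: w_ge0.
have wG_ge0 x : 0 <= (w \o uncurry G) x by exact: w_ge0.
apply: (@le_trans _ _ (\esum_(i in setT) (w \o uncurry G) i)).
  apply: ereal_inf_lbound => /=.
  have /card_esym/ppcard_eqP[f] := card_nat2.
  exists (uncurry G \o f).
    split => [i j /= Gij|].
      by apply: ((PG (f i).1).1.1 (f i).2); rewrite -Gij; case: (f i).
    move=> t [i _ /((PG i).1.2)[j _ Bijt]].
    by exists (f^-1%FUN (i, j)) => //=; rewrite invK ?inE.
  rewrite -/w -(esum_pred_image (w \o uncurry G) _ xpredT) ?[fun=> _]set_true//.
  by rewrite image_eq.
rewrite (_ : esum _ _ = \sum_(i <oo) \sum_(j <oo) w (G i j)); last first.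
  pose K : nat -> set (nat * nat) := fun i => [set (i, j) | j in setT].
  rewrite (_ : setT = \bigcup_k K k); last first.
    by rewrite predeqE => -[a b]; split => // _; exists a => //; exists b.
  rewrite esum_bigcupT /=; last 2 first.
    - apply/trivIsetP => i j _ _ ij.
      rewrite predeqE => -[k l] /=; split => //= -[] [_] _ [<-{k} _].
      by move=> [l' _] [] /esym/eqP; rewrite (negbTE ij).
    - by move=> /= [k l]; exact: w_ge0.
  rewrite -(image_id [set: nat]) -fun_true esum_pred_image//; last first.
    by move=> k _; apply: esum_ge0 => *; exact: w_ge0.
  apply: eq_eseriesr => /= j _.
  rewrite -(esum_pred_image (w \o uncurry G) (pair j) predT)//=; last first.
    by move=> ? ? _ _; exact: (@can_inj _ _ _ snd).
  by congr esum; rewrite predeqE => -[a b]; split; move=> [i _ <-]; exists i.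
apply: lee_lim.
- apply: is_cvg_nneseries => k *.
  by apply: nneseries_ge0 => l *; exact: (wG_ge0 (k, l)).
- by apply: is_cvg_nneseries => k *; apply: adde_ge0 => //; exact: cover_outer_ge0.
- by near=> k; apply: lee_sum => i _; exact: (PG i).2.
Unshelve. all: by end_near. Qed.

End cover_outer_measure.

Definition caratheodory_measure (R : realType) (T : pointedType)
    (mu : {outer_measure set T -> \bar R}) :
  {measure set (caratheodory_type mu) -> \bar R} :=
  (mu : set (caratheodory_type mu) -> \bar R).

Section euclidean_measures.
Context (R : realType).

Section euclidean.
Context (n : nat).
Implicit Types (x : 'rV[R]_n) (r : R).

(* The library norm of ['rV[R]_n] is the sup norm. *)
Definition enorm x : R := Num.sqrt (\sum_i x 0 i ^+ 2).

Definition eball r : set 'rV[R]_n := [set x | enorm x < r].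

Definition usphere : set 'rV[R]_n := [set x | enorm x = 1].

Definition ediam (A : set 'rV[R]_n) : \bar R :=
  ereal_sup [set (enorm (x - y))%:E | x in A & y in A].

Definition box (ab : 'rV[R]_n * 'rV[R]_n) : set 'rV[R]_n :=
  [set x | forall i, ab.1 0 i <= x 0 i <= ab.2 0 i].

Definition box_volume (ab : 'rV[R]_n * 'rV[R]_n) : \bar R :=
  (\prod_i Num.max 0 (ab.2 0 i - ab.1 0 i))%:E.

Definition lebesgue_outer : set 'rV[R]_n -> \bar R :=
  cover_outer setT box box_volume.

Lemma box_volume_ge0 ab : (0 <= box_volume ab)%E.
Proof. by rewrite lee_fin prodr_ge0// => i _; rewrite le_max lexx. Qed.

HB.instance Definition _ := isOuterMeasure.Build R 'rV[R]_n lebesgue_outer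
  (cover_outer0 setT box box_volume_ge0)
  (cover_outer_ge0 setT box box_volume_ge0)
  (@le_cover_outer _ _ _ setT box box_volume)
  (cover_outer_sigma_subadditive setT box box_volume_ge0).

(* Measurable sets of [lebn] are the Lebesgue measurable sets. *)
Definition lebn : {measure set (caratheodory_type lebesgue_outer) -> \bar R} :=
  caratheodory_measure lebesgue_outer.

End euclidean.

Arguments lebn n : clear implicits.
Arguments eball n r : clear implicits.
Arguments usphere n : clear implicits.

(* The volume of the unit ball of R^k. *)
Definition ball_volume (k : nat) : R := fine (lebn k (eball k 1)).

Section hausdorff.
Context (n k : nat).

Definition hausdorff_weight (A : set 'rV[R]_n) : \bar R :=
  (ball_volume k * (fine (ediam A) / 2) ^+ k)%:E.

Lemma hausdorff_weight_ge0 A : (0 <= hausdorff_weight A)%E.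
Proof.
rewrite lee_fin mulr_ge0 ?fine_ge0 ?outer_measure_ge0// exprn_ge0// divr_ge0//.
have [->|/set0P[x Ax]] := eqVneq A set0.
  by rewrite /ediam image2E set0X image_set0 ereal_sup0.
rewrite fine_ge0//; apply: le_ereal_sup_tmp; exists (enorm (x - x))%:E.
  by exists x => //; exists x.
by rewrite lee_fin sqrtr_ge0.
Qed.

Definition hausdorff_pre (d : R) : set 'rV[R]_n -> \bar R :=
  cover_outer [set A | (ediam A <= d%:E)%E] id hausdorff_weight.

Definition hausdorff_outer (A : set 'rV[R]_n) : \bar R :=
  ereal_sup [set hausdorff_pre d A | d in [set d | 0 < d]].

Lemma hausdorff_pre_le_outer d A : 0 < d ->
  (hausdorff_pre d A <= hausdorff_outer A)%E.
Proof. by move=> d0; apply: ereal_sup_ubound; exists d. Qed.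

Lemma hausdorff_outer_ge0 A : (0 <= hausdorff_outer A)%E.
Proof.
apply: le_trans (hausdorff_pre_le_outer A ltr01).
exact/cover_outer_ge0/hausdorff_weight_ge0.
Qed.

Lemma hausdorff_outer0 : hausdorff_outer set0 = 0.
Proof.
apply/eqP; rewrite eq_le hausdorff_outer_ge0 andbT.
apply: ge_ereal_sup => _ [d _ <-].
by rewrite /hausdorff_pre cover_outer0//; exact: hausdorff_weight_ge0.
Qed.

Lemma le_hausdorff_outer :
  {homo hausdorff_outer : A B / A `<=` B >-> (A <= B)%E}.
Proof.
move=> A B AB; apply: ge_ereal_sup => _ [d d0 <-].
apply: le_trans (hausdorff_pre_le_outer B d0).
exact: le_cover_outer.
Qed.

Lemma hausdorff_outer_sigma_subadditive : sigma_subadditive hausdorff_outer.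
Proof.
move=> F; apply: ge_ereal_sup => _ [d d0 <-].
apply: le_trans (cover_outer_sigma_subadditive _ _ hausdorff_weight_ge0 F) _.
apply: lee_nneseries => i _.
  by move=> _; exact/cover_outer_ge0/hausdorff_weight_ge0.
exact: hausdorff_pre_le_outer.
Qed.

HB.instance Definition _ := isOuterMeasure.Build R 'rV[R]_n hausdorff_outer
  hausdorff_outer0 hausdorff_outer_ge0 le_hausdorff_outer
  hausdorff_outer_sigma_subadditive.

(* k-dimensional Hausdorff measure on R^n, defined on the
   Caratheodory-measurable sets, which include the Borel sets. *)
Definition hausdorff : {measure set (caratheodory_type hausdorff_outer) -> \bar R} :=
  caratheodory_measure hausdorff_outer.

End hausdorff.

End euclidean_measures.

Arguments lebn {R} n.
Arguments hausdorff {R} n k.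
Arguments eball {R} n r.
Arguments usphere {R} n.

Definition L2norm d (T : measurableType d) (R : realType)
    (mu : {measure set T -> \bar R}) (D : set T) (f : T -> R) : \bar R :=
  'N[mu]_2%:E[EFin \o (f \_ D)].

Definition L2 d (T : measurableType d) (R : realType)
    (mu : {measure set T -> \bar R}) (D : set T) (f : T -> R) : Prop :=
  measurable_fun D f /\ (L2norm mu D f < +oo)%E.

Section sobolev.
Context (R : realType) (n : nat).
Implicit Types (u v w phi : 'rV[R]_n -> R) (Omega : set 'rV[R]_n).

Definition partial (i : 'I_n) phi : 'rV[R]_n -> R :=
  fun x => 'D_(delta_mx 0 i) phi x.

Definition smooth phi : Prop :=
  forall (s : seq 'I_n) x, differentiable (foldr partial phi s) x.

Definition test_function Omega phi : Prop :=
  smooth phi /\ exists K, [/\ compact K, K `<=` Omega &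
    forall x, ~ K x -> phi x = 0].

Definition weak_partial Omega (i : 'I_n) u w : Prop :=
  forall phi, test_function Omega phi ->
    \int[lebn n]_(x in Omega) (u x * partial i phi x) =
    - \int[lebn n]_(x in Omega) (w x * phi x).

Definition H1 Omega u : Prop :=
  L2 (lebn n) Omega u /\
  forall i, exists2 w, L2 (lebn n) Omega w & weak_partial Omega i u w.

(* u is in H^1(B_r) if r is finite, and in H^1_loc(R^n) if r = +oo. *)
Definition H1_eball (r : \bar R) u : Prop :=
  match r with
  | s%:E => H1 (eball n s) u
  | +oo%E => forall s, 0 < s -> H1 (eball n s) u
  | -oo%E => False
  end.

(* Total functions stand for functionals on H^1(Omega); nothing is required
   off H^1(Omega). *)
Definition H1_functional Omega (E : ('rV[R]_n -> R) -> R) : Prop :=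
  (forall v, H1 Omega v -> -1 <= E v <= 1) /\
  (forall v w, H1 Omega v -> H1 Omega w ->
    {ae lebn n, forall x, Omega x -> v x = w x} -> E v = E w).

Definition rescale (m r : R) u : 'rV[R]_n -> R :=
  fun x => r `^ (- m) * u (r *: x).

Definition homogeneous_ext (m : R) (g : 'rV[R]_n -> R) : 'rV[R]_n -> R :=
  fun x => enorm x `^ m * g ((enorm x)^-1 *: x).

Definition radial_deriv (m : R) v (r : R) : 'rV[R]_n -> R :=
  fun theta => derive1 (fun s => rescale m s v theta) r.

(* An element u of H^1(B_rho) has a representative v which along almost every
   ray is locally absolutely continuous, that is, an indefinite integral of
   a locally integrable function. Any two such v agree H^{n-1}-a.e. on every
   sphere of radius r < rho, and theta |-> v (r theta) is the trace of u
   there; d/dr (r^-m u(r theta)) is the classical derivative along v. *)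
Definition ray_representative (rho : \bar R) u v : Prop :=
  [/\ {ae lebn n, forall x, ((enorm x)%:E < rho)%E -> v x = u x},
      forall r, 0 < r -> (r%:E < rho)%E ->
        L2 (hausdorff n n.-1) (usphere n) (fun theta => v (r *: theta)) &
      {ae hausdorff n n.-1, forall theta, usphere n theta ->
        exists w : R -> R, forall a b, 0 < a -> a <= b -> (b%:E < rho)%E ->
          lebesgue_measure.-integrable `[a, b] (EFin \o w) /\
          v (b *: theta) - v (a *: theta) =
            \int[lebesgue_measure]_(t in `[a, b]) w t}].

End sobolev.

(* f is a BV_loc function on I, through its representative g, and its
   distributional derivative is at least h: the density g' of the absolutely
   continuous part is at least h a.e., and the singular part is nonnegative.
   If the singular part were unconstrained, f could decrease at will by jumps
   and an a.e. lower bound on g' would carry no information. *)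
Definition BVloc_deriv_ge (R : realType) (I : set R) (f : R -> R)
    (h : R -> \bar R) : Prop :=
  exists g : R -> R,
  [/\ {ae lebesgue_measure, forall r, I r -> g r = f r},
      forall a b, a <= b -> `[a, b] `<=` I -> bounded_variation a b g,
      {ae lebesgue_measure, forall r, I r ->
        derivable g r 1 /\ (h r <= (derive1 g r)%:E)%E} &
      forall a b, a <= b -> `[a, b] `<=` I ->
        (\int[lebesgue_measure]_(r in `[a, b]) (derive1 g r)%:E
           <= (g b - g a)%:E)%E].

(* Rate in terms of the ratio q of radii, 1 < q <= +oo; +oo to a negative
   power is 0. *)
Definition decay_rate (R : realType) (gamma delta : R) (q : \bar R) : R :=
  match q with
  | t%:E => if 0 < gamma then ln t `^ ((gamma - 1) / (2 * gamma))
            else t `^ (- (delta / 2))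
  | _ => 0
  end.

(* Main.v *)
(* With t = -log r (case a) or t = log r (case b), the epiperimetric inequality (2)
   turns (1) into |G|^(1+gamma) <= C r dG/dr, plus the dissipation
   int r^2 |d_r u_r|^2, for the shifted energy
   G(r) = E(u_r) + A (Lp r^alpha - Lm r^(-alpha)), A = 5 / alpha. So G is bounded
   and nondecreasing, and an infinite logarithmic range forces its sign: G >= 0 if
   r1 = 0, G <= 0 if r3 = oo. Hence |G| decays like t^(-1/gamma), or exponentially
   if gamma = 0. By Cauchy-Schwarz along rays, the squared L2 distance of two traces
   is at most log(b/a) int_a^b r |d_r u_r|^2 <= log(b/a) (G(b) - G(a)) / c_E; summing
   over dyadic t (unit steps if gamma = 0) gives the rates. When both ends are
   infinite the base radius of the estimate is arbitrary, so all traces coincide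
   with the limit. *)
From HB Require Import structures.
Require Import Defs.
From mathcomp Require Import all_boot all_order all_algebra.
From mathcomp Require Import all_classical all_reals all_analysis.
From mathcomp Require Import measurable_realfun.
From mathcomp Require Import ring lra.
Import Order.TTheory GRing.Theory Num.Theory.
Import numFieldNormedType.Exports.

Set Implicit Arguments.
Unset Strict Implicit.
Unset Printing Implicit Defensive.

Local Open Scope classical_set_scope.
Local Open Scope ring_scope.

(** * Decay in logarithmic time *)

(** The energy has only bounded variation and may jump upwards, so the differential inequality is
    not solved as an ODE. It is integrated with its power replaced by a constant lower bound [k],
    which yields [c * (t' - t) * P t' ^ (1 + gamma) <= P t - P t']; the rates follow from this
    difference form by induction over steps. The bound on [E(u_r)] passes to the representative [g]
    only almost everywhere; monotonicity turns it into a bound at every radius. The dissipation is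
    not known to be measurable in [r], nor its integrand to be jointly measurable, so Tonelli is not
    applied to it directly. It is replaced by a measurable minorant [F], obtained from difference
    quotients, that still controls the distance of two traces. The constants are fixed before the
    dimension and the data: [log_rate_bound] receives [C = 1 / cE], [M = 1 + A] and
    [c = cE * eps / (16 * A ^+ 2)]. *)

Section decay.
Context {R : realType}.
Implicit Types (P rho S : R -> R) (N : R -> R -> R).

Definition log_rate (gamma delta t : R) : R :=
  if 0 < gamma then t `^ ((gamma - 1) / (2 * gamma))
  else expR (- (delta / 2) * t).

Lemma le_powR (p a b : R) : 0 <= p -> 0 <= a -> a <= b -> a `^ p <= b `^ p.
Proof.
move=> p0 a0 ab; apply: ge0_ler_powR; rewrite ?nnegrE//.
exact: le_trans ab.
Qed.

Lemma le_of_sqr (a b : R) : 0 <= b -> a ^+ 2 <= b ^+ 2 -> a <= b.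
Proof. by move=> b0; rewrite [leLHS]expr2 [leRHS]expr2; nra. Qed.

(* Splitting [t, t'] at t, S t, S (S t), ... bounds N by a geometric series. *)
Lemma chain_bound N rho S (A q : R) : 0 <= A -> 0 <= q < 1 ->
  (forall t : R, 0 < t -> t < S t) -> (forall t : R, 0 < t -> 0 <= rho t) ->
  (forall t : R, 0 < t -> rho (S t) <= q * rho t) ->
  (forall t t' : R, 0 < t -> t < t' -> t' <= S t -> N t t' <= A * rho t) ->
  (forall a b c : R, 0 < a -> a < b -> b < c -> N a c <= N a b + N b c) ->
  forall k t t', 0 < t -> t < t' -> t' <= iter k S t ->
  N t t' <= A / (1 - q) * rho t.
Proof.
move=> A0 /andP[q0 q1] tS rho0 rhoS NS Ntri; have q1' : 0 < 1 - q by lra.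
have Aq : A <= A / (1 - q) by rewrite ler_pdivlMr// ler_piMr//; lra.
elim=> [t t' _ tt' /= t't|k IH t t' t0 tt' t'S].
  by have := lt_le_trans tt' t't; rewrite ltxx.
have [t'St|Stt'] := leP t' (S t).
  by apply: le_trans (NS _ _ t0 tt' t'St) _; rewrite ler_wpM2r// rho0.
have St0 : 0 < S t by apply: lt_trans (tS _ t0).
apply: le_trans (Ntri t (S t) t' t0 (tS _ t0) Stt') _.
have h1 := NS _ _ t0 (tS _ t0) (lexx _).
have h2 : N (S t) t' <= A / (1 - q) * (q * rho t).
  apply: le_trans (IH _ _ St0 Stt' _) _; first by rewrite -iterSr.
  by rewrite ler_wpM2l ?rhoS// divr_ge0// ltW.
apply: le_trans (lerD h1 h2) _.
have -> : A * rho t = A / (1 - q) * ((1 - q) * rho t) by field; lra.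
by rewrite -mulrDr ler_wpM2l ?divr_ge0 ?(ltW q1')//; lra.
Qed.

(** One unit step gives [P (t + 1) <= P t / (1 + c)], whence the rate [ln (1 + c)]. The prefactor
    [1 + c] pays for [t <= 1], where only the bound [M] is available. *)
Lemma decay_exp P (c M : R) : 0 < c -> 0 <= M ->
  (forall t : R, 0 < t -> 0 <= P t <= M) ->
  (forall t t' : R, 0 < t -> t < t' -> c * (t' - t) * P t' <= P t - P t') ->
  forall t : R, 0 < t -> P t <= M * (1 + c) * expR (- ln (1 + c) * t).
Proof.
move=> c0 M0 PM Pdec.
have c1 : 1 < 1 + c by lra.
have P1 t : 0 < t -> P (t + 1) <= P t / (1 + c).
  move=> t0; rewrite ler_pdivlMr; last lra.
  have := Pdec t (t + 1) t0; rewrite addrAC subrr add0r mulr1; lra.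
have H k (t : R) : 0 < t <= k.+1%:R -> P t <= M * (1 + c) * expR (- ln (1 + c) * t).
  elim: k t => [|k IH] t /andP[t0 tk].
    apply: le_trans (andP (PM t t0)).2 _.
    rewrite -mulrA ler_peMr//.
    have {1}-> : 1 + c = expR (ln (1 + c)) by rewrite lnK// posrE; lra.
    rewrite -expRD -[leLHS]expR0 ler_expR.
    have := ln_gt0 c1; nra.
  have [t1|t1] := leP t k.+1%:R; first by apply: IH; rewrite t0.
  have t10 : 0 < t - 1 by rewrite subr_gt0 (le_lt_trans _ t1)// ler1n.
  have -> : t = t - 1 + 1 by lra.
  apply: le_trans (P1 _ t10) _; rewrite ler_pdivrMr; last lra.
  apply: le_trans (IH (t - 1) _) _.
    by rewrite t10 lerBlDr -natr1 in tk *.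
  rewrite -[X in _ * X * expR _ <= _]/(1 + c) [X in _ <= _ * (expR X) * _]mulrDr mulr1 expRD -!mulrA.
  rewrite expRN lnK ?posrE; last lra.
  by rewrite mulVf; lra.
move=> t t0; apply: (H (Num.truncn t)); rewrite t0/=.
by apply/ltW; rewrite truncnS_gt.
Qed.

(** Discrete form of [P' <= - c P^(1 + gamma)], by doubling. With [s = 1 / gamma], the middle term
    of the constant [K] ensures [K ^ gamma >= 2 * 2 ^ s / c], and the term [M] covers [t <= 1]. *)
Lemma decay_pow P (c M gamma : R) : 0 < c -> 0 <= M -> 0 < gamma < 1 ->
  (forall t : R, 0 < t -> 0 <= P t <= M) ->
  (forall t t' : R, 0 < t -> t < t' ->
    c * (t' - t) * P t' `^ (1 + gamma) <= P t - P t') ->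
  forall t : R, 0 < t ->
    P t <= (M + (2 * 2 `^ gamma^-1 / c) `^ gamma^-1 + 1) * 2 `^ gamma^-1 * t `^ (- gamma^-1).
Proof.
move=> c0 M0 /andP[g0 g1] PM Pdec.
have [s sE] : exists s, s = gamma^-1 by exists gamma^-1.
rewrite -sE.
have [K KE] : exists K, K = (M + (2 * 2 `^ s / c) `^ s + 1) * 2 `^ s by eexists.
rewrite -KE.
have s1 : 1 <= s by rewrite sE invf_ge1//; apply/ltW.
have s0 : 0 < s by lra.
have two1 : 1 <= 2 `^ s :> R.
  by rewrite -[leLHS](powRr0 2); apply: ler_powR; lra.
have B0 : 0 <= (2 * 2 `^ s / c) `^ s by apply: powR_ge0.
have K0 : 0 < K by rewrite KE mulr_gt0//; lra.
have KM : M * 2 `^ s <= K by rewrite KE ler_wpM2r//; lra.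
have Kg : 2 * 2 `^ s / c <= K `^ gamma.
  have -> : 2 * 2 `^ s / c = ((2 * 2 `^ s / c) `^ s) `^ gamma.
    rewrite -powRrM sE mulVf ?gt_eqF// powRr1//.
    by rewrite divr_ge0 ?ltW// mulr_ge0// powR_ge0.
  apply: ge0_ler_powR; rewrite ?nnegrE ?(ltW K0) ?(ltW g0)//.
  by rewrite KE; nra.
have H k (t : R) : 0 < t <= 2 ^+ k -> P t <= K * t `^ (- s).
  elim: k t => [|k IH] t /andP[t0 tk].
    apply: le_trans (andP (PM t t0)).2 _.
    have : 1 <= t `^ (- s).
      rewrite powRN invf_ge1 ?powR_gt0//.
      rewrite -[leRHS](congr1 (@^~ s) (powR1 R)) /=; apply: ge0_ler_powR; rewrite ?nnegrE; lra.
    nra.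
  have t20 : 0 < t / 2 by lra.
  have t2 : t / 2 <= 2 ^+ k by move: tk; rewrite exprS; lra.
  have {IH}IH := IH (t / 2).
  have {}IH : P (t / 2) <= K * (t / 2) `^ (- s) by apply: IH; rewrite t20.
  (* If the bound failed at [t], the decrement over [[t / 2, t]] would be at least [y * 2 ^ s],
     which already bounds [P (t / 2)]; no room is left for [P t > y > 0]. *)
  rewrite leNgt; apply/negP => Py.
  have [y yE] : exists y, y = K * t `^ (- s) by eexists.
  rewrite -yE in Py.
  have y0 : 0 < y by rewrite yE mulr_gt0// powR_gt0.
  have t2s : (t / 2) `^ (- s) = 2 `^ s * t `^ (- s).
    rewrite powRM; [|lra|lra].
    by rewrite mulrC powRN -[2^-1]powR_inv1; [|lra]; rewrite -powRrM mulN1r powRN invrK.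
  have := Pdec (t / 2) t t20; rewrite (_ : t - t / 2 = t / 2); last lra.
  have tt : t / 2 < t by lra.
  move=> /(_ tt).
  have yg : y `^ gamma = K `^ gamma / t.
    rewrite yE powRM ?powR_ge0 ?(ltW K0)// -powRrM mulNr sE mulVf ?gt_eqF//.
    by rewrite powR_inv1 ?(ltW t0).
  have P1 : y * (K `^ gamma / t) <= P t `^ (1 + gamma).
    have -> : y * (K `^ gamma / t) = y `^ (1 + gamma).
      rewrite -yg powRD ?powRr1 ?(ltW y0)//.
      by apply/implyP => _; rewrite (gt_eqF y0).
    by apply: le_powR; [exact: addr_ge0 (ltW g0)|exact: ltW|exact: ltW].
  have P2 : y * 2 `^ s <= c * (t / 2) * (P t `^ (1 + gamma)).
    apply: (@le_trans _ _ (c * (t / 2) * (y * (K `^ gamma / t)))); last first.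
      by apply: ler_wpM2l => //; apply: mulr_ge0; apply: ltW.
    have -> : c * (t / 2) * (y * (K `^ gamma / t)) = y * (c / 2 * K `^ gamma).
      by field; lra.
    rewrite ler_pM2l//.
    have -> : 2 `^ s = c / 2 * (2 * 2 `^ s / c) by field; lra.
    by rewrite ler_pM2l//; lra.
  have : P (t / 2) <= y * 2 `^ s by rewrite yE mulrAC -mulrA -t2s.
  by lra.
move=> t t0; apply: (H (Num.truncn t)); rewrite t0/=.
apply/ltW/(lt_le_trans (truncnS_gt t)).
by rewrite -natrX ler_nat ltn_expl.
Qed.

(** [K] and [delta] are chosen before [P] and [N], so they do not depend on the data. Since
    [P t - P t' <= P t], a doubling step costs at most the square root of [C * t * P t], of order
    [t ^ ((1 - s) / 2)] with [s = 1 / gamma]; for [gamma = 0] the square root halves the exponential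
    rate. [chain_bound] adds the steps. *)
Lemma log_rate_bound (C c M gamma : R) : 0 < C -> 0 < c -> 0 <= M ->
    0 <= gamma < 1 ->
  exists K delta : R, [/\ 0 < K, 0 < delta &
    forall P N,
    (forall t : R, 0 < t -> 0 <= P t <= M) ->
    (forall t t' : R, 0 < t -> t < t' ->
      c * (t' - t) * P t' `^ (1 + gamma) <= P t - P t') ->
    (forall t t' : R, 0 <= N t t') ->
    (forall a b c : R, 0 < a -> a < b -> b < c -> N a c <= N a b + N b c) ->
    (forall t t' : R, 0 < t -> t < t' ->
      N t t' ^+ 2 <= C * (t' - t) * (P t - P t')) ->
    forall t t' : R, 0 < t -> t < t' -> N t t' <= K * log_rate gamma delta t].
Proof.
move=> C0 c0 M0 /andP[g0 g1].
rewrite /log_rate; case: ltP => [{}g0|g0'].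
  have [s sE] : exists s, s = gamma^-1 by eexists.
  have [K1 K1E] : exists K, K = (M + (2 * 2 `^ s / c) `^ s + 1) * 2 `^ s.
    by eexists.
  have s1 : 1 < s by rewrite sE invf_gt1.
  have two0 : 0 < 2 `^ s :> R by apply: powR_gt0.
  have K10 : 0 < K1.
    by rewrite K1E mulr_gt0//; have := powR_ge0 (2 * 2 `^ s / c) s; lra.
  have -> : (gamma - 1) / (2 * gamma) = (1 - s) / 2.
    by rewrite sE; field; rewrite gt_eqF.
  have [e eE] : exists e : R, e = (1 - s) / 2 by eexists.
  rewrite -eE.
  have [q qE] : exists q : R, q = 2 `^ e by eexists.
  have q1 : q < 1.
    rewrite qE /powR gt_eqF// -[ltRHS]expR0 ltr_expR.
    rewrite pmulr_llt0 ?ln_gt0 ?ltr1n//; lra.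
  have q0 : 0 <= q by rewrite qE; exact: powR_ge0.
  have [A AE] : exists A : R, A = Num.sqrt (C * K1) by eexists.
  have A0 : 0 < A by rewrite AE sqrtr_gt0 mulr_gt0.
  exists (A / (1 - q)), 1; split; [by rewrite divr_gt0//; lra|lra|].
  move=> P N PM Pdec N0 Ntri NP t t' t0 tt'.
  have Pb := decay_pow c0 M0 (introT andP (conj g0 g1)) PM Pdec.
  rewrite -sE -K1E in Pb.
  apply: (@chain_bound N (fun t => t `^ e) (fun t => 2 * t) A q _ _ _ _ _ _ _
            (Num.truncn (t' / t))) => //.
  - exact: ltW.
  - by rewrite q0.
  - by move=> x; lra.
  - by move=> x _; exact: powR_ge0.
  - by move=> x x0; rewrite powRM ?qE//; lra.
  - move=> x x' x0 xx' x'2.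
    apply: le_of_sqr; first by rewrite mulr_ge0 ?powR_ge0 ?(ltW A0).
    apply: le_trans (NP _ _ x0 xx') _.
    rewrite exprMn AE sqr_sqrtr ?(ltW (mulr_gt0 C0 K10))// -(@powR_mulrn _ (x `^ e)) ?powR_ge0//.
    rewrite -powRrM eE divfK ?pnatr_eq0// powRD; last first.
      by rewrite (gt_eqF x0) implybT.
    rewrite powRr1 ?(ltW x0)//.
    have -> : C * K1 * (x * x `^ (- s)) = C * x * (K1 * x `^ (- s)) by ring.
    have x'0 : 0 < x' by exact: lt_trans xx'.
    have /andP[Px'0 _] := PM _ x'0.
    have /andP[Px0 _] := PM _ x0.
    have Pxx' := Pdec _ _ x0 xx'.
    have Px' : 0 <= P x - P x'.
      by apply: le_trans Pxx'; rewrite !mulr_ge0 ?powR_ge0//; lra.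
    apply: ler_pM => //.
    + by rewrite mulr_ge0 ?ltW//; lra.
    + by rewrite ler_pM2l//; lra.
    + apply: le_trans (Pb _ x0); lra.
  - have -> k : iter k (fun t => 2 * t) t = 2 ^+ k * t.
      by elim: k => [|k IH] /=; rewrite ?mul1r// IH exprS mulrA.
    rewrite -ler_pdivrMr//; apply/ltW/(lt_le_trans (truncnS_gt _)).
    by rewrite -natrX ler_nat ltn_expl.
have -> : gamma = 0 by lra.
have [delta dE] : exists d : R, d = ln (1 + c) by eexists.
have d0 : 0 < delta by rewrite dE; apply: ln_gt0; lra.
have [q qE] : exists q : R, q = expR (- (delta / 2)) by eexists.
have q1 : q < 1 by rewrite qE -[ltRHS]expR0 ltr_expR; lra.
have q0 : 0 <= q by rewrite qE; exact: expR_ge0.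
(* The summand 1 keeps [A] positive when [M = 0]. *)
have [A AE] : exists A : R, A = Num.sqrt (C * (M * (1 + c) + 1)) by eexists.
have K10 : 0 < M * (1 + c) + 1 by nra.
have A0 : 0 < A by rewrite AE sqrtr_gt0 mulr_gt0.
exists (A / (1 - q)), delta; split=> //; first by rewrite divr_gt0//; lra.
move=> P N PM Pdec N0 Ntri NP t t' t0 tt'.
have Pdec' (t1 t2 : R) : 0 < t1 -> t1 < t2 -> c * (t2 - t1) * P t2 <= P t1 - P t2.
  move=> t10 t12; have := Pdec t1 t2 t10 t12.
  rewrite addr0 powRr1//; by have /andP[] := PM _ (lt_trans t10 t12).
have Pb := decay_exp c0 M0 PM Pdec'; rewrite -dE in Pb.
apply: (@chain_bound N (fun t => expR (- (delta / 2) * t)) (fun t => t + 1) A q _ _ _ _ _ _ _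
            (Num.truncn (t' - t)).+1) => //.
- exact: ltW.
- by rewrite q0.
- by move=> x; lra.
- move=> x x0; rewrite qE -expRD ler_expR; lra.
- move=> x x' x0 xx' x'2.
  apply: le_of_sqr; first by rewrite mulr_ge0 ?expR_ge0 ?(ltW A0).
  apply: le_trans (NP _ _ x0 xx') _.
  rewrite exprMn AE sqr_sqrtr ?(ltW (mulr_gt0 C0 K10))// -expRM_natl.
  have -> : 2 * (- (delta / 2) * x) = - delta * x by field.
  have x'0 : 0 < x' by exact: lt_trans xx'.
  have /andP[Px'0 _] := PM _ x'0.
  have Pxx' := Pdec' _ _ x0 xx'.
  have Px' : 0 <= P x - P x'.
    by apply: le_trans Pxx'; rewrite !mulr_ge0//; lra.
  have := Pb _ x0; have := expR_gt0 (- delta * x).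
  set E := expR _ => E0 PE.
  rewrite -!mulrA ler_pM2l//.
  have : (x' - x) * (P x - P x') <= 1 * (P x - P x') by rewrite ler_wpM2r//; lra.
  nra.
- have -> k : iter k (fun t => t + 1) t = t + k%:R.
    by elim: k => [|k IH] /=; rewrite ?addr0// IH -natr1 addrA.
  by rewrite -lerBlDl; apply/ltW; rewrite truncnS_gt.
Qed.

Lemma log_rate_cvg0 (gamma delta : R) : 0 <= gamma < 1 -> 0 < delta ->
  forall e : R, 0 < e -> exists2 T : R, 0 < T & forall t : R, T <= t -> log_rate gamma delta t <= e.
Proof.
move=> /andP[g0 g1] d0 e e0; rewrite /log_rate; case: ltP => g0'.
  set s := _ / _.
  have s0 : s < 0.
    by rewrite /s pmulr_llt0 ?invr_gt0 ?mulr_gt0//; lra.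
  exists (e `^ s^-1); first exact: powR_gt0.
  move=> t et; have t0 : 0 < t by apply: lt_le_trans et; exact: powR_gt0.
  have -> : e = (e `^ s^-1) `^ s.
    by rewrite -powRrM mulVf ?lt_eqF// powRr1// (ltW e0).
  have inv a : a `^ s = (a `^ (- s))^-1 by rewrite powRN invrK.
  rewrite inv [leRHS]inv lef_pV2 ?posrE ?powR_gt0//.
  by apply: le_powR; rewrite ?powR_ge0//; lra.
exists (Num.max 1 (- (ln e) / (delta / 2))).
  by rewrite lt_max ltr01.
move=> t; rewrite ge_max => /andP[t1 ht].
have -> : e = expR (ln e) by rewrite lnK.
rewrite ler_expR.
move: ht; rewrite ler_pdivrMr; [|lra]; nra.
Qed.

Lemma decay_rateE (gamma delta q : R) : 0 < q ->
  decay_rate gamma delta q%:E = log_rate gamma delta (ln q).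
Proof.
move=> q0; rewrite /decay_rate /log_rate; case: ifP => // _.
by rewrite /powR gt_eqF.
Qed.

End decay.

#[global] Instance ae_lebesgue_filter (R : realType) :
  Filter (almost_everywhere (@lebesgue_measure R)) :=
  ae_filter_ringOfSetsType lebesgue_measure.

(** * Integrals of functions that need not be measurable *)

(* The library integral of an arbitrary integrand is a lower integral of its positive
   part minus one of its negative part. The differential inequality is integrated
   through it because [r |-> \int r^2 |radial_deriv|^2] is not known to be
   measurable. *)
Section lower_integral.
Local Open Scope ereal_scope.
Context d (T : measurableType d) (R : realType) (mu : {measure set T -> \bar R}).
Implicit Types (f g : T -> \bar R) (D : set T).
Import HBNNSimple.

Definition lower_integral f := ereal_sup [set sintegral mu h |
  h in [set h : {nnsfun T >-> R} | forall x, (h x)%:E <= f x]].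

Lemma integral_lower D f : \int[mu]_(x in D) f x =
  lower_integral ((f \_ D)^\+) - lower_integral ((f \_ D)^\-).
Proof. by []. Qed.

(** A simple function below [f] is cut off on a measurable null set containing the exceptional
    points. It is then below [g] everywhere, and its integral is unchanged because simple functions
    are measurable. *)
Lemma ae_le_lower_integral f g : (forall x, 0 <= g x) ->
  {ae mu, forall x, f x <= g x} -> lower_integral f <= lower_integral g.
Proof.
move=> g0 [N [mN N0 fgN]]; apply: ge_ereal_sup => _ [h /= hf <-].
have mNC : measurable (~` N) by exact: measurableC.
pose h' := proj_nnsfun h mNC.
have -> : sintegral mu h = sintegral mu h'.
  rewrite -2!integralT_nnsfun//; apply: ge0_ae_eq_integral => //.
  - exact/measurable_EFinP.
  - exact/measurable_EFinP.
  - by move=> x _; rewrite lee_fin.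
  - by move=> x _; rewrite lee_fin.
  - exists N; split=> // x /= /not_implyP[_]; apply: contra_notP => Nx.
    by rewrite mindicE mem_set// mulr1.
apply: ereal_sup_ubound; exists h' => //= x; rewrite mindicE.
have [|] := boolP (x \in ~` N); last by rewrite mulr0.
rewrite inE => Nx; rewrite mulr1; apply: le_trans (hf x) _.
by apply: contra_notT Nx => fg; apply: fgN => /=; exact/negP.
Qed.

Lemma ae_le_integral D f g :
  {ae mu, forall x, D x -> f x <= g x} ->
  \int[mu]_(x in D) f x <= \int[mu]_(x in D) g x.
Proof.
move=> fg; rewrite !integral_lower.
apply: leeB; apply: ae_le_lower_integral => //; apply: filterS fg => x fg;
  rewrite ?funeposE ?funenegE !patchE; case: ifPn => //; rewrite inE => /fg fgx.
- by rewrite ge_max !le_max lexx fgx orbT.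
- by rewrite ge_max !le_max lexx leeN2 fgx orbT.
Qed.

Lemma le_integral_nomeas D f g : (forall x, D x -> f x <= g x) ->
  \int[mu]_(x in D) f x <= \int[mu]_(x in D) g x.
Proof. by move=> fg; apply: ae_le_integral; exact: aeW. Qed.

End lower_integral.

(** * Scaling of integrals of arbitrary integrands *)

Section measure_scaling.
Local Open Scope ereal_scope.
Context d (T : measurableType d) (R : realType) (mu : {measure set T -> \bar R}).
Import HBNNSimple.

(** Composition with [s] carries simple functions below [f] to simple functions below [f \o s] and
    multiplies their integrals by [c]. Applied to the inverse map, the same inequality gives the
    opposite one. *)
Lemma lower_integral_comp_le (s t : T -> T) (c : R) (f : T -> \bar R) :
  cancel s t -> cancel t s -> measurable_fun setT s -> (0 < c)%R ->
  (forall A, measurable A -> mu (s @^-1` A) = c%:E * mu A) ->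
  (forall x, 0 <= f x) ->
  c%:E * lower_integral mu f <= lower_integral mu (f \o s).
Proof.
move=> st ts ms c0 mus f0.
rewrite -lee_pdivlMl//; apply: ge_ereal_sup => _ [h /= hf <-].
rewrite lee_pdivlMl//.
have mhs : measurable_fun setT (h \o s) by exact: measurableT_comp.
have fhs : finite_set (range (h \o s)).
  apply: sub_finite_set (fimfunP h) => _ [x _ <-] /=; by exists (s x).
pose hM := isMeasurableFun.Build _ _ _ _ _ mhs.
pose hF := FiniteImage.Build _ _ _ fhs.
have hs0 : forall x, (0 <= (h \o s) x)%R by move=> x /=.
pose hN := isNonNegFun.Build _ _ _ hs0.
pose hs : {nnsfun T >-> R} := HB.pack (h \o s) hM hF hN.
have -> : c%:E * sintegral mu h = sintegral mu hs.
  rewrite !sintegralET ge0_mule_fsumr; last exact: nnsfun_mulemu_ge0.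
  apply: eq_fsbigr => x _; rewrite muleCA; congr (_ * _).
  by rewrite -mus.
by apply: ereal_sup_ubound; exists hs => // x /=.
Qed.

(** Stated for arbitrary [f] and [D], since it serves for integrals over balls and for products with
    test functions whose measurability is not established. *)
Lemma integral_comp_scaling (s t : T -> T) (c : R) (D : set T) (f : T -> \bar R) :
  cancel s t -> cancel t s -> measurable_fun setT s -> measurable_fun setT t ->
  (0 < c)%R ->
  (forall A, measurable A -> mu (s @^-1` A) = c%:E * mu A) ->
  \int[mu]_(x in s @^-1` D) f (s x) = c%:E * \int[mu]_(x in D) f x.
Proof.
move=> st ts ms mt c0 mus; rewrite !integral_lower.
have mut A : measurable A -> mu (t @^-1` A) = c^-1%:E * mu A.
  move=> mA; have mtA : measurable (t @^-1` A) by rewrite -[X in measurable X]setTI; exact: mt.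
  have := mus _ mtA; have -> : s @^-1` (t @^-1` A) = A.
    by apply/seteqP; split=> x /=; rewrite st.
  by move=> ->; rewrite muleA -EFinM mulVf ?gt_eqF// mul1e.
have fE (g : T -> \bar R) : (forall x, 0 <= g x) ->
    lower_integral mu (g \o s) = c%:E * lower_integral mu g.
  move=> g0; apply/eqP; rewrite eq_le; apply/andP; split; last first.
    exact: (lower_integral_comp_le st ts).
  have ci0 : (0 < c^-1)%R by rewrite invr_gt0.
  have := @lower_integral_comp_le t s c^-1 (g \o s) ts st mt ci0 mut (fun x => g0 (s x)).
  have -> : (g \o s) \o t = g by apply/funext => x /=; rewrite ts.
  by rewrite lee_pdivrMl.
have memE x : (x \in s @^-1` D) = (s x \in D) by apply/idP/idP; rewrite !inE.
have -> : ((f \o s) \_ (s @^-1` D))^\+ = ((f \_ D)^\+) \o s.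
  by apply/funext => x; rewrite /= !funeposE /= !patchE memE.
have -> : ((f \o s) \_ (s @^-1` D))^\- = ((f \_ D)^\-) \o s.
  by apply/funext => x; rewrite /= !funenegE /= !patchE memE.
rewrite !fE//; move: (lower_integral _ _) (lower_integral _ _) => a b.
have c0e : 0 < c%:E by rewrite lte_fin.
have cy : c%:E * +oo = +oo by rewrite gt0_muley.
have cNy : c%:E * -oo = -oo by rewrite gt0_muleNy.
by case: a b => [a| |] [b| |] //=; rewrite ?cy ?cNy//= -?EFinM -?EFinB -?EFinM ?mulrBr// ?cNy.
Qed.

End measure_scaling.

Section integralZl_any.
Local Open Scope ereal_scope.
Context d (T : measurableType d) (R : realType) (mu : {measure set T -> \bar R}).
Import HBNNSimple.

Lemma lower_integralZl_le (c : R) (f : T -> \bar R) : (0 < c)%R ->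
  c%:E * lower_integral mu f <= lower_integral mu (fun x => c%:E * f x).
Proof.
move=> c0; rewrite -lee_pdivlMl//; apply: ge_ereal_sup => _ [h /= hf <-].
rewrite lee_pdivlMl// -sintegralrM.
rewrite (_ : (_ \* _)%R = scale_nnsfun h (ltW c0))//.
apply: ereal_sup_ubound; exists (scale_nnsfun h (ltW c0)) => //= x.
by rewrite EFinM lee_pmul2l// lte_fin.
Qed.

Lemma integralZl_pos (c : R) (D : set T) (f : T -> \bar R) : (0 < c)%R ->
  \int[mu]_(x in D) (c%:E * f x) = c%:E * \int[mu]_(x in D) f x.
Proof.
move=> c0; rewrite !integral_lower.
have E (g : T -> \bar R) : lower_integral mu (fun x => c%:E * g x) = c%:E * lower_integral mu g.
  apply/eqP; rewrite eq_le lower_integralZl_le// andbT.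
  have ci0 : (0 < c^-1)%R by rewrite invr_gt0.
  have := lower_integralZl_le (fun x => c%:E * g x) ci0.
  rewrite (_ : (fun x => (c^-1)%:E * _) = g); first by rewrite lee_pdivrMl.
  by apply/funext => x; rewrite muleA -EFinM mulVf ?gt_eqF// mul1e.
have c0e : 0 < c%:E by rewrite lte_fin.
have -> : ((fun x => c%:E * f x) \_ D)^\+ = (fun x => c%:E * (f \_ D)^\+ x).
  apply/funext => x; rewrite !funeposE !patchE; case: ifPn => _.
    by rewrite maxe_pMr ?mule0// ltW.
  by rewrite maxxx mule0.
have -> : ((fun x => c%:E * f x) \_ D)^\- = (fun x => c%:E * (f \_ D)^\- x).
  apply/funext => x; rewrite !funenegE !patchE; case: ifPn => _.
    by rewrite -muleN maxe_pMr ?mule0// ltW.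
  by rewrite oppe0 maxxx mule0.
rewrite !E; move: (lower_integral _ _) (lower_integral _ _) => a b.
have cy : c%:E * +oo = +oo by rewrite gt0_muley.
have cNy : c%:E * -oo = -oo by rewrite gt0_muleNy.
by case: a b => [a| |] [b| |] //=; rewrite ?cy ?cNy//= -?EFinM -?EFinB -?EFinM ?mulrBr// ?cNy.
Qed.

End integralZl_any.

(** * Completeness of L2 *)

Section geometric_limit.
Context {R : realType}.

Lemma geometric_limit (x : nat -> R) (C : R) : 0 <= C ->
  (forall k, `|x k.+1 - x k| <= C / 2 ^+ k) ->
  exists2 l, x @ \oo --> l & forall k, `|x k - l| <= 2 * C / 2 ^+ k.
Proof.
move=> C0 xC.
(* The factor [1 - 2 ^- j], the exact partial sum of the geometric series, lets the induction on [j]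
   close. *)
have xkj k j : `|x (k + j)%N - x k| <= 2 * C / 2 ^+ k * (1 - 2 ^- j).
  elim: j => [|j IH]; first by rewrite addn0 subrr normr0 expr0 invr1 subrr mulr0.
  rewrite addnS -(subrKA (x (k + j)%N)).
  apply: le_trans (ler_normD _ _) _; apply: le_trans (lerD (xC _) IH) _.
  rewrite exprD exprS invfM.
  have k0 : 2 ^+ k != 0 :> R by rewrite expf_neq0.
  have j0 : 2 ^+ j != 0 :> R by rewrite expf_neq0.
  by rewrite le_eqVlt; apply/orP; left; apply/eqP; field; rewrite k0 j0.
have xkj' k j : (k <= j)%N -> `|x j - x k| <= 2 * C / 2 ^+ k.
  move=> kj; rewrite -(subnKC kj); apply: le_trans (xkj _ _) _.
  by rewrite ler_piMr ?mulr_ge0 ?invr_ge0 ?exprn_ge0// lerBlDr lerDl invr_ge0 exprn_ge0.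
have h2 : (fun k => 2 * C / 2 ^+ k) @ \oo --> (0 : R).
  have -> : (fun k => 2 * C / 2 ^+ k) = geometric (2 * C) 2^-1.
    by apply/funext => k; rewrite /geometric /= exprVn.
  by apply: cvg_geometric; rewrite ger0_norm ?invr_ge0//; lra.
have /cauchy_cvgP/cvg_ex[l xl] : cauchy (x @ \oo).
  apply: cauchy_exP => e e0.
  have /cvgrPdist_lt/(_ _ e0)[k _ hk] := h2.
  exists (x k); exists k => // j /= kj; rewrite /ball /= distrC.
  apply: le_lt_trans (xkj' _ _ kj) _; have := hk k (leqnn k); rewrite /= sub0r normrN.
  exact/le_lt_trans/ler_norm.
exists l => // k; rewrite distrC.
have : (fun j => `|x j - x k|) @ \oo --> `|l - x k|.
  by apply: cvg_norm; apply: cvgB => //; exact: cvg_cst.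
move=> h; rewrite -(cvg_lim _ h)//; apply: limr_le; first by apply/cvg_ex; eexists; exact: h.
by exists k => // j /= kj; exact: xkj'.
Qed.

End geometric_limit.

Section L2_limit.
Local Open Scope ereal_scope.
Context d (T : measurableType d) (R : realType) (mu : {measure set T -> \bar R}).
Implicit Types (f g : T -> R) (D : set T).

Lemma integral_sqr_ge0 D f : 0 <= \int[mu]_(x in D) (f x ^+ 2)%:E.
Proof. by apply: integral_ge0 => x _; rewrite lee_fin sqr_ge0. Qed.

Lemma L2normE D f :
  L2norm mu D f = (\int[mu]_(x in D) (f x ^+ 2)%:E) `^ 2^-1.
Proof.
rewrite /L2norm unlock; congr (_ `^ _); rewrite [RHS]integral_mkcond.
apply: eq_integral => x _; transitivity ((`|(f \_ D) x| `^ 2)%:E)%R => //.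
rewrite !patchE.
case: ifPn => _; last by rewrite normr0 powR0.
by rewrite powR_mulrn// real_normK// num_real.
Qed.

Lemma L2norm_ge0 D f : 0 <= L2norm mu D f.
Proof. by rewrite L2normE poweR_ge0. Qed.

Lemma L2norm_le D f (c : R) : (0 <= c)%R ->
  (L2norm mu D f <= c%:E) = (\int[mu]_(x in D) (f x ^+ 2)%:E <= (c ^+ 2)%:E).
Proof.
move=> c0; rewrite L2normE; have := integral_sqr_ge0 D f.
move: (\int[mu]_(x in D) _) => -[r| |]//=; last first.
  by rewrite invr_eq0 pnatr_eq0/= !leye_eq.
rewrite !lee_fin => r0; rewrite powR12_sqrt//.
by rewrite -[c in LHS]ger0_norm// -sqrtr_sqr ler_psqrt// nnegrE sqr_ge0.
Qed.

Lemma L2norm_lty D f :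
  (L2norm mu D f < +oo) = (\int[mu]_(x in D) (f x ^+ 2)%:E < +oo).
Proof.
rewrite L2normE; have := integral_sqr_ge0 D f.
move: (\int[mu]_(x in D) _) => -[r| |]//= _; first by rewrite !ltry.
by rewrite invr_eq0 pnatr_eq0.
Qed.

Lemma L2normB_sym D f g : L2norm mu D (f \- g)%R = L2norm mu D (g \- f)%R.
Proof.
rewrite !L2normE; congr (_ `^ _); apply: eq_integral => x _ /=.
by rewrite -sqrrN opprB.
Qed.

Lemma L2norm_triangle D f g : measurable D ->
  measurable_fun D f -> measurable_fun D g ->
  L2norm mu D (f \+ g)%R <= L2norm mu D f + L2norm mu D g.
Proof.
move=> mD mf mg; rewrite /L2norm.
have -> : ((f \+ g) \_ D = (f \_ D) \+ (g \_ D))%R.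
  by apply/funext => x /=; rewrite !patchE; case: ifPn; rewrite ?addr0.
by apply: minkowski_EFin => //; [apply/(measurable_restrictT _ _).1..|exact: ler1n].
Qed.

Lemma L2norm_triangleB D f g h : measurable D ->
  measurable_fun D f -> measurable_fun D g -> measurable_fun D h ->
  L2norm mu D (f \- h)%R <= L2norm mu D (f \- g)%R + L2norm mu D (g \- h)%R.
Proof.
move=> mD mf mg mh; have -> : (f \- h = (f \- g) \+ (g \- h))%R.
  by apply/funext => x /=; rewrite subrKA.
by apply: L2norm_triangle => //; exact: measurable_funB.
Qed.

(** Riesz-Fischer along a subsequence whose increments have norm at most [4 ^- k]. The squares are
    then at most [16 ^- k], so the weights [4 ^+ k] still leave a summable series, and each weight
    buys the pointwise rate [2 ^- k]. The function [W] also dominates the squared errors, which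
    gives convergence in norm. *)
Lemma L2_limit D (U : nat -> T -> R) : measurable D ->
  (forall k, L2 mu D (U k)) ->
  (forall e : R, (0 < e)%R -> exists K, forall j k, (K <= j)%N -> (K <= k)%N ->
     L2norm mu D (U j \- U k)%R <= e%:E) ->
  exists2 u0, L2 mu D u0 & forall e : R, (0 < e)%R ->
    exists K, forall k, (K <= k)%N -> L2norm mu D (U k \- u0)%R <= e%:E.
Proof.
move=> mD LU UC.
have mU k : measurable_fun D (U k) by have [] := LU k.
have /choice[K0 K0P] : forall k : nat, exists K, forall i j, (K <= i)%N -> (K <= j)%N ->
    L2norm mu D (U i \- U j)%R <= (4 ^- k)%:E.
  by move=> k; apply: UC; rewrite invr_gt0 exprn_gt0.
(* The sum makes [N] nondecreasing with [K0 k <= N k]; the summand [k] sends it to infinity. *)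
pose N k := (k + \sum_(i < k.+1) K0 i)%N.
have NK k : (K0 k <= N k)%N by rewrite /N big_ord_recr/= addnA leq_addl.
have NS k : (N k <= N k.+1)%N.
  by rewrite /N leq_add// [leqRHS]big_ord_recr/= leq_addr.
(* [W] is integrable, and where it is finite [V] converges geometrically. *)
pose V k := U (N k); pose df k x := (V k.+1 x - V k x)%R.
pose w k x := (4 ^+ k * df k x ^+ 2)%R; pose W x := \sum_(k <oo) (w k x)%:E.
have w0 k x : (0 <= w k x)%R by apply: mulr_ge0; [exact: exprn_ge0|exact: sqr_ge0].
have mdf k : measurable_fun D (fun x => (df k x ^+ 2)%R).
  apply: (@measurable_funX _ _ _ _ (df k) 2).
  exact: (measurable_funB (mU (N k.+1)) (mU (N k))).
have mw k : measurable_fun D (fun x => (w k x)%:E).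
  by apply/measurable_EFinP; apply: measurable_funM; [exact: measurable_cst|exact: mdf].
have mW : measurable_fun D W by apply: ge0_emeasurable_sum => // k x _ _; rewrite lee_fin.
have W0 x : 0 <= W x by apply: nneseries_ge0 => k _ _; rewrite lee_fin.
have iw k : \int[mu]_(x in D) (w k x)%:E <= (4 ^- k)%:E.
  have -> : \int[mu]_(x in D) (w k x)%:E =
      (4 ^+ k)%:E * \int[mu]_(x in D) (df k x ^+ 2)%:E.
    rewrite -ge0_integralZl//.
    - exact/measurable_EFinP.
    - by move=> x _; rewrite lee_fin sqr_ge0.
  have := K0P k (N k.+1) (N k) (leq_trans (NK k) (NS k)) (NK k).
  rewrite L2norm_le ?invr_ge0 ?exprn_ge0//.
  move=> /(@lee_wpmul2l _ (4 ^+ k)%:E) h; apply: le_trans (h _) _.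
    by rewrite lee_fin exprn_ge0.
  by rewrite -EFinM lee_fin [X in (_ * X)%R]expr2 mulrA mulfV ?mul1r// expf_neq0.
have iW : \int[mu]_(x in D) W x <= 2%:E.
  rewrite integral_nneseries//; last by move=> k x _; rewrite lee_fin.
  (* The series of the [4 ^- k] is compared with that of the [2 / 2 ^ (k + 1)], whose sum is 2. *)
  have := @cvg_geometric_eseries_half R 2 0; rewrite expr0 divr1 => /cvg_lim <-//.
  apply: lee_lim.
  - by apply: is_cvg_nneseries => k _ _; apply: integral_ge0 => x _; rewrite lee_fin.
  - apply/cvg_ex; eexists; exact: cvg_geometric_eseries_half.
  - apply: nearW => k; apply: lee_sum => i _; apply: le_trans (iw i) _.
    rewrite lee_fin addn1 natrX exprS invfM mulrA divff// mul1r.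
    rewrite lef_pV2 ?posrE ?exprn_gt0//.
    by rewrite lerXn2r// ?nnegrE// ler_nat.
have W_fin : {ae mu, forall x, D x -> W x \is a fin_num}.
  apply: integrable_ae => //; apply/integrableP; split => //.
  under eq_integral do rewrite gee0_abs//.
  by apply: le_lt_trans iW _; rewrite ltry.
pose G := D `&` [set x | W x < +oo].
have mG : measurable G by apply: emeasurable_fun_infty_o.
have VG x : W x < +oo -> exists2 l, V ^~ x @ \oo --> l &
    forall k, (`|V k x - l| <= 2 * Num.sqrt (fine (W x)) / 2 ^+ k)%R.
  move=> Wx; apply: geometric_limit; first exact: sqrtr_ge0.
  move=> k; have : (w k x <= fine (W x))%R.
    rewrite -lee_fin fineK ?ge0_fin_numE//.
    rewrite /W (nneseriesD1 (n := k))//; first by rewrite leeDl// nneseries_ge0// => i _ _; rewrite lee_fin.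
    by move=> i _; rewrite lee_fin.
  rewrite /w => h; rewrite ler_pdivlMr ?exprn_gt0// -[leLHS]ger0_norm; last first.
    by rewrite mulr_ge0 ?exprn_ge0.
  rewrite -sqrtr_sqr ler_sqrt ?fine_ge0// exprMn -exprM mulnC exprM.
  by rewrite real_normK ?num_real// mulrC -[(2 ^+ 2)%R]/(2 * 2)%R -natrM.
pose u0 x := if pselect (G x) is left _ then lim (V ^~ x @ \oo) else 0%R.
have u0E x : G x -> V ^~ x @ \oo --> u0 x.
  rewrite /u0; case: pselect => // Gx _; have [l Vl _] := VG _ Gx.2.
  by rewrite (cvg_lim _ Vl).
have u0V x k : G x -> (`|V k x - u0 x| <= 2 * Num.sqrt (fine (W x)) / 2 ^+ k)%R.
  move=> Gx; have [l Vl h] := VG _ Gx.2.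
  by rewrite /u0; case: pselect => // _; rewrite (cvg_lim _ Vl).
have mu0 : measurable_fun D u0.
  have mVG k : measurable_fun D (fun x => V k x * \1_G x)%R.
    by apply: measurable_funM; [exact: (mU (N k))|exact: measurable_indic].
  apply: (measurable_fun_cvg mVG) => x Dx.
  have [Gx|Gx] := pselect (G x).
    rewrite indicE mem_set//; apply: cvg_trans (u0E _ Gx).
    by under eq_fun do rewrite mulr1.
  rewrite /u0; case: pselect => // _; rewrite indicE memNset//.
  by under eq_fun do rewrite mulr0; exact: cvg_cst.
(* The squared error is at most [4 * W / 4 ^ k], of integral at most [8 / 4 ^ k], which is below
   [(4 / 2 ^ k) ^ 2]. *)
have Vu0 k : L2norm mu D (V k \- u0)%R <= (4 / 2 ^+ k)%:E.
  rewrite L2norm_le ?divr_ge0 ?exprn_ge0//.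
  apply: (@le_trans _ _ (\int[mu]_(x in D) ((4 / 4 ^+ k)%:E * W x))).
    apply: ae_le_integral; apply: filterS W_fin => x Wf Dx.
    have Gx : G x by split=> //=; rewrite -ge0_fin_numE//; exact: Wf.
    rewrite -(fineK (Wf Dx)) -EFinM lee_fin /= -[leLHS]real_normK ?num_real//.
    have h0 : (0 <= 2 * Num.sqrt (fine (W x)) / 2 ^+ k)%R.
      by apply: divr_ge0; rewrite ?mulr_ge0 ?exprn_ge0 ?sqrtr_ge0.
    have := lerXn2r 2 (normr_ge0 _) h0 (u0V _ k Gx).
    move=> /le_trans; apply; rewrite !exprMn sqr_sqrtr ?fine_ge0//.
    rewrite exprVn -exprM mulnC exprM -[(2 ^+ 2)%R]/(2 * 2)%R -!natrM.
    by rewrite mulrAC.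
  rewrite ge0_integralZl//.
  apply: le_trans (lee_wpmul2l _ iW) _; first by rewrite lee_fin divr_ge0 ?exprn_ge0.
  rewrite -EFinM lee_fin expr_div_n -exprM mulnC exprM -[(2 ^+ 2)%R]/(2 * 2)%R -!natrM.
  by rewrite mulrAC ler_wpM2r ?invr_ge0 ?exprn_ge0// expr2 ler_wpM2l// ler_nat.
have LVu : L2norm mu D u0 < +oo.
  apply: (@le_lt_trans _ _ (L2norm mu D (u0 \- V 0%N)%R + L2norm mu D (V 0%N))).
    rewrite [in leLHS](_ : u0 = (u0 \- V 0%N) \+ V 0%N)%R; last first.
      by apply/funext => x /=; rewrite subrK.
    apply: L2norm_triangle => //; last exact: (mU (N 0%N)).
    by apply: measurable_funB => //; exact: (mU (N 0%N)).
  rewrite lte_add_pinfty//; last by have [] := LU (N 0%N).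
  by rewrite L2normB_sym; apply: le_lt_trans (Vu0 0%N) (ltry _).
exists u0 => // e e0; have e20 : (0 < e / 2)%R by rewrite divr_gt0.
have [K KP] := UC _ e20.
have [j jP] : exists j, (4 / 2 ^+ j <= e / 2)%R.
  exists (Num.truncn (8 / e)).+1; rewrite ler_pdivrMr ?exprn_gt0//.
  rewrite mulrC mulrA ler_pdivlMr// -ler_pdivrMr//.
  rewrite (_ : 4 * 2 = 8)%R; last by rewrite -natrM.
  apply: le_trans (ltW (truncnS_gt _)) _; rewrite -natrX ler_nat.
  by rewrite (leq_trans _ (ltnW (ltn_expl _ _))).
exists K => k Kk; pose i := maxn j K.
apply: le_trans (L2norm_triangleB (g := V i) _ _ _ _) _ => //; first exact: (mU (N i)).
rewrite [in leRHS](splitr e) EFinD; apply: leeD.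
  by apply: KP => //; rewrite /N (leq_trans _ (leq_addr _ _))// leq_maxr.
apply: le_trans (Vu0 i) _; rewrite lee_fin; apply: le_trans _ jP.
rewrite ler_wpM2l// lef_pV2 ?posrE ?exprn_gt0// ler_weXn2l ?ler1n//.
exact: leq_maxl.
Qed.

End L2_limit.

(** * Measurability of the sphere *)

(* Caratheodory's criterion, with separation measured by a single function [f] (a
   coordinate, below): [Q] are the shells accumulating at the level [c], and every
   other shell is separated from the previous ones. *)
Section metric_outer_measure.
Context {R : realType} {T : Type}.
Variables (mu : {outer_measure set T -> \bar R}) (f : T -> R).
Local Open Scope ereal_scope.

Hypothesis mu_sep : forall (a b : R) (A B : set T), (a < b)%R ->
  A `<=` [set x | f x <= a]%R -> B `<=` [set x | b <= f x]%R ->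
  mu A + mu B <= mu (A `|` B).

Variables (c : R) (X : set T).
Let t k : R := (c + k.+1%:R^-1)%R.
Let B k := X `&` [set x | t k <= f x]%R.
Let Q k := X `&` [set x | t k.+1 <= f x < t k]%R.

Let t_lt k : (t k.+1 < t k)%R.
Proof. by rewrite ltrD2l ltf_pV2 ?posrE// ltr_nat. Qed.

Let BS k : B k `<=` B k.+1.
Proof. by move=> x [Xx /= h]; split=> //=; apply/ltW/(lt_le_trans (t_lt k)). Qed.

(** Keeping two consecutive sets on the right treats even and odd shells at once: [Q N.+1] is
    separated from [B N] by the shell [Q N], and both lie in [B N.+2], so adding the new shell turns
    [B N] into [B N.+2]. *)
Let sum_Q N : \sum_(k < N.+1) mu (Q k) <= mu (B N.+1) + mu (B N).
Proof.
elim: N => [|N IH].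
  rewrite big_ord1 -[leLHS]adde0 leeD ?outer_measure_ge0// le_outer_measure//.
  by move=> x [Xx /= /andP[h _]]; split.
rewrite big_ord_recr/=; apply: (le_trans (leeD2r _ IH)).
rewrite -addeA addeC leeD2r// addeC.
apply: (@le_trans _ _ (mu (B N `|` Q N.+1))); last first.
  apply: le_outer_measure => x [/BS/BS//|[Xx /= /andP[h _]]]; by split.
rewrite setUC.
apply: (@mu_sep (t N.+1) (t N)); first exact: t_lt.
- by move=> x [_ /= /andP[_ /ltW]].
- by move=> x [].
Qed.

Let mu_limit : mu X < +oo ->
  mu (X `&` [set x | f x <= c]%R) + mu (X `&` ~` [set x | f x <= c]%R) <= mu X.
Proof.
move=> Xoo; set A := X `&` _; set D := X `&` _.
have muX0 : mu X \is a fin_num by rewrite ge0_fin_numE// outer_measure_ge0.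
(* By [sum_Q] the shells have total mass at most twice [mu X], so the tails of their series tend to
   0. *)
have sQ : \sum_(0 <= k <oo) mu (Q k) < +oo.
  apply: (@le_lt_trans _ _ (mu X + mu X)); last by rewrite lte_add_pinfty.
  apply: lime_le; first by apply: is_cvg_nneseries => *; exact: outer_measure_ge0.
  near=> N; have N0 : (0 < N)%N by near: N; exists 1%N.
  rewrite -(prednK N0) big_mkord; apply: le_trans (sum_Q _) _.
  by apply: leeD; apply: le_outer_measure => x [].
have tail := nneseries_tail_cvg sQ (fun k _ => outer_measure_ge0 _ (Q k)).
have AB k : mu A + mu D <= mu X + \sum_(k <= j <oo) mu (Q j).
  apply: (@le_trans _ _ (mu A + (mu (B k) + \sum_(k <= j <oo) mu (Q j)))).
    apply: leeD2l; apply: (@le_trans _ _ (mu (B k `|` \bigcup_(j in ~` `I_k) Q j))).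
      apply: le_outer_measure => x [Xx /= /negP]; rewrite -ltNge => cf.
      have [kf|kf] := leP (t k) (f x); first by left.
      right.
      have [j] : exists j, (t j <= f x)%R.
        exists (Num.truncn (f x - c)^-1); rewrite /t -lerBrDl.
        rewrite -[leRHS]invrK lef_pV2 ?posrE// ?invr_gt0 ?subr_gt0//.
        exact/ltW/truncnS_gt.
      elim: j => [h|j IH h].
        suff : (t k <= t 0)%R by move=> /(lt_le_trans kf); rewrite ltNge h.
        by rewrite lerD2l lef_pV2 ?posrE// ler_nat.
      have [/IH//|jf] := leP (t j) (f x).
      exists j; last by split=> //=; rewrite h.
      apply/negP; rewrite -leqNgt leqNgt; apply/negP => jk.
      suff : (t k <= t j.+1)%R by move=> /(lt_le_trans kf); rewrite ltNge h.
      by rewrite lerD2l lef_pV2 ?posrE// ler_nat.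
    apply: le_trans (outer_measureU2 _ _ _) _; apply: leeD2l.
    exact: outer_measure_sigma_subadditive_tail.
  rewrite addeA; apply: leeD2r.
  apply: (@le_trans _ _ (mu (A `|` B k))); last first.
    by apply: le_outer_measure => x [] [].
  apply: (@mu_sep c (t k)); first by rewrite ltrDl.
  - by move=> x [].
  - by move=> x [].
have : (fun k => mu X + \sum_(k <= j <oo) mu (Q j)) @ \oo --> mu X + 0.
  by apply: cvgeD => //; [rewrite fin_num_adde_defr|exact: cvg_cst].
rewrite adde0 => h.
rewrite -(cvg_lim _ h)//; apply: lime_ge; first by apply/cvg_ex; eexists; exact: h.
by apply: nearW.
Unshelve. all: by end_near. Qed.

Lemma caratheodory_sublevel_le :
  mu (X `&` [set x | f x <= c]%R) + mu (X `&` ~` [set x | f x <= c]%R) <= mu X.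
Proof.
have [/mu_limit//|] := ltP (mu X) +oo.
by move=> h; apply: le_trans (leey _) h.
Qed.

End metric_outer_measure.

Section hausdorff_measurable.
Context {R : realType} (n k : nat).
Local Open Scope ereal_scope.
Implicit Types (A B : set 'rV[R]_n) (d a b : R).

Let C0 (j : option (set 'rV[R]_n)) : 0 <= oapp (hausdorff_weight k) 0 j.
Proof. by case: j => //= a; exact: hausdorff_weight_ge0. Qed.

(** A set of diameter at most [d < b - a] cannot meet both [A] and [B]. A cover of the union thus
    splits into the sets meeting [A], which cover [A], and the others, which cover [B], with no
    weight counted twice. *)
Lemma hausdorff_pre_sep d (i : 'I_n) a b A B : (0 < d)%R -> (d < b - a)%R ->
  A `<=` [set x | x 0 i <= a]%R -> B `<=` [set x | b <= x 0 i]%R ->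
  hausdorff_pre k d A + hausdorff_pre k d B <= hausdorff_pre k d (A `|` B).
Proof.
move=> d0 dab Aa Bb; apply: le_ereal_inf_tmp => _ [C [adm AC] <-].
pose CA j := if C j is Some Z then
  if pselect (Z `&` A !=set0) then Some Z else None else None.
pose CB j := if C j is Some Z then
  if pselect (Z `&` A !=set0) then None else Some Z else None.
have -> : \sum_(j <oo) oapp (hausdorff_weight k) 0 (C j) =
    \sum_(j <oo) oapp (hausdorff_weight k) 0 (CA j) +
    \sum_(j <oo) oapp (hausdorff_weight k) 0 (CB j).
  rewrite -nneseriesD; [|by move=> *; exact: C0|by move=> *; exact: C0].
  apply: eq_eseriesr => j _; rewrite /CA /CB.
  by case: (C j) => [Z|]/=; [case: pselect => _ /=|]; rewrite ?adde0 ?add0e.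
apply: leeD.
  apply: ereal_inf_lbound; exists CA => //; split.
    move=> j Z; rewrite /CA; case E : (C j) => [Z'|//].
    by case: pselect => // _ [<-]; apply: (adm j).
  move=> x Ax; have [j _ Cx] := AC x (or_introl Ax).
  exists j => //; move: Cx; rewrite /CA; case: (C j) => //= Z Zx.
  by case: pselect => // -[]; exists x.
apply: ereal_inf_lbound; exists CB => //; split.
  move=> j Z; rewrite /CB; case E : (C j) => [Z'|//].
  by case: pselect => // _ [<-]; apply: (adm j).
move=> x Bx; have [j _ Cx] := AC x (or_intror Bx).
exists j => //; move: Cx; rewrite /CB; case E : (C j) => [Z|//]/= Zx.
case: pselect => // -[y [Zy Ay]].
have := adm _ _ E; rewrite /= leNgt => /negP; case.
apply: lt_le_trans (ereal_sup_ubound _); last by exists x => //; exists y.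
rewrite lte_fin (lt_le_trans dab)//.
apply: (@le_trans _ _ `|(x - y) 0 i|)%R.
  apply: le_trans (ler_norm _); rewrite !mxE.
  by have := Aa _ Ay; have := Bb _ Bx; rewrite /=; lra.
rewrite -sqrtr_sqr ler_wsqrtr// (bigD1 i)//= lerDl sumr_ge0// => j' _.
exact: sqr_ge0.
Qed.

Lemma hausdorff_pre_homo A d d' : (d <= d')%R ->
  hausdorff_pre k d' A <= hausdorff_pre k d A.
Proof.
move=> dd'; apply: ereal_inf_le_tmp => _ [C [adm AC] <-].
exists C => //; split=> // j Z /adm/= h; apply: le_trans h _.
by rewrite lee_fin.
Qed.

(** The two pre-measures are first taken at independent scales [d1] and [d2], by passing to a common
    smaller scale; the suprema over [d1] and [d2] are then taken one after the other, subtracting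
    the other term, which is finite. *)
Lemma hausdorff_sep (i : 'I_n) a b A B : (a < b)%R ->
  A `<=` [set x | x 0 i <= a]%R -> B `<=` [set x | b <= x 0 i]%R ->
  hausdorff_outer k A + hausdorff_outer k B <= hausdorff_outer k (A `|` B).
Proof.
move=> ab Aa Bb.
have pre0 d D : 0 <= hausdorff_pre k d D.
  exact/cover_outer_ge0/hausdorff_weight_ge0.
have H d1 d2 : (0 < d1)%R -> (0 < d2)%R ->
    hausdorff_pre k d1 A + hausdorff_pre k d2 B <= hausdorff_outer k (A `|` B).
  move=> d10 d20; pose d := Num.min (Num.min d1 d2) ((b - a) / 2)%R.
  have d0 : (0 < d)%R by rewrite !lt_min d10 d20/=; lra.
  apply: le_trans (hausdorff_pre_le_outer _ _ d0).
  apply: (@le_trans _ _ (hausdorff_pre k d A + hausdorff_pre k d B)).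
    by apply: leeD; apply: hausdorff_pre_homo; rewrite !ge_min lexx ?orbT.
  apply: (@hausdorff_pre_sep _ i a b) => //.
  have : (d <= (b - a) / 2)%R by rewrite ge_min lexx orbT.
  lra.
have [Hoo|Hoo] := eqVneq (hausdorff_outer k (A `|` B)) +oo.
  by rewrite Hoo leey.
have fin d2 : (0 < d2)%R -> hausdorff_pre k d2 B \is a fin_num.
  move=> d20; rewrite ge0_fin_numE// (le_lt_trans _ (_ : hausdorff_outer k (A `|` B) < _)) ?ltey//.
  by apply: le_trans (H 1%R d2 ltr01 d20); rewrite leeDr.
have A_le d2 : (0 < d2)%R ->
    hausdorff_outer k A <= hausdorff_outer k (A `|` B) - hausdorff_pre k d2 B.
  move=> d20; apply: ge_ereal_sup => _ [d1 /= d10 <-].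
  by rewrite leeBrDr ?fin//; exact: H.
have Afin : hausdorff_outer k A \is a fin_num.
  rewrite ge0_fin_numE; last exact: hausdorff_outer_ge0.
  apply: (@le_lt_trans _ _ (hausdorff_outer k (A `|` B))); last by rewrite ltey.
  by apply: le_hausdorff_outer => x; left.
rewrite addeC -leeBrDr//; apply: ge_ereal_sup => _ [d2 /= d20 <-].
rewrite leeBrDr// addeC -leeBrDr ?fin//.
exact: A_le.
Qed.

End hausdorff_measurable.

Section coordinate_measurable.
Context {R : realType} (n : nat) (mu : {outer_measure set 'rV[R]_n -> \bar R}).
Hypothesis mu_coord : forall (i : 'I_n) (c : R),
  mu.-caratheodory [set x | x 0 i <= c].

Lemma measurable_coord (i : 'I_n) :
  measurable_fun [set: caratheodory_type mu] (fun x : 'rV[R]_n => x 0 i).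
Proof.
move=> mT; apply: (measurability _ (RGenOInfty.measurableE R)) => // _ [_ [c ->] <-].
rewrite setTI.
have -> : (fun x : 'rV[R]_n => x 0 i) @^-1` `]c, +oo[%classic =
    ~` [set x | x 0 i <= c].
  apply/seteqP; split=> x /=; first by rewrite in_itv/= andbT ltNge => /negP.
  by rewrite in_itv/= andbT ltNge => /negP.
exact/caratheodory_measurable_setC.
Qed.

Lemma measurable_enorm_sqr :
  measurable_fun [set: caratheodory_type mu] (fun x : 'rV[R]_n => \sum_i x 0 i ^+ 2).
Proof.
apply: measurable_sum => i; apply: measurable_funX; exact: measurable_coord.
Qed.

Lemma measurable_usphere : measurable (usphere n : set (caratheodory_type mu)).
Proof.
have := measurable_enorm_sqr measurableT (measurable_set1 1).
rewrite setTI; congr measurable; apply/seteqP; split=> x /=.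
  by rewrite /usphere /= /enorm => ->; rewrite sqrtr1.
rewrite /usphere /= /enorm => h; rewrite -[LHS]sqr_sqrtr ?h ?expr1n//.
by apply: sumr_ge0 => i _; exact: sqr_ge0.
Qed.

End coordinate_measurable.

(** The sphere is a level set of a polynomial in the coordinates, so separation along single
    coordinates suffices. *)
Lemma measurable_usphere_hausdorff (R : realType) (n k : nat) :
  measurable (usphere n : set (caratheodory_type (@hausdorff_outer R n k))).
Proof.
apply: measurable_usphere => i c.
apply: le_caratheodory_measurable => X.
by apply: caratheodory_sublevel_le => a b A B; exact: hausdorff_sep.
Qed.

(** * Estimates along rays *)

Section absolutely_continuous.
Context {R : realType}.
Notation mu := (@lebesgue_measure R).
Implicit Types (f v w : R -> R) (a b : R).

Lemma mem_itvcc a b x : (x \in `[a, b]%classic) = (a <= x <= b).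
Proof. by apply/idP/idP; rewrite inE/= in_itv. Qed.

Lemma derivable_continuous_on f a b : a < b ->
  (forall t, a <= t <= b -> derivable f t 1) ->
  {within `[a, b], continuous f}.
Proof.
move=> ab df; apply: derivable_within_continuous => t.
by rewrite in_itv/=; exact: df.
Qed.

Lemma derivable_LR f a b : a < b ->
  (forall t, a <= t <= b -> derivable f t 1) -> derivable_oo_LRcontinuous f a b.
Proof.
move=> ab df.
have cf t : a <= t <= b -> {for t, continuous f}.
  by move=> /df h; apply: differentiable_continuous; exact/derivable1_diffP.
split.
- by move=> t; rewrite in_itv/= => /andP[/ltW a1 /ltW b1]; apply: df; rewrite a1.
- by apply: cvg_at_right_filter; apply: cf; rewrite lexx ltW.
- by apply: cvg_at_left_filter; apply: cf; rewrite lexx ltW.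
Qed.

Lemma FTC2_derivable f a b : a <= b ->
  (forall t, a <= t <= b -> derivable f t 1) ->
  (forall t, a <= t <= b -> {for t, continuous (derive1 f)}) ->
  (\int[mu]_(x in `[a, b]) ((derive1 f) x)%:E = (f b - f a)%:E)%E.
Proof.
rewrite le_eqVlt => /predU1P[<- _ _|ab df cf].
  by rewrite set_itv1 integral_set1 subrr.
rewrite EFinB; apply: continuous_FTC2 => //.
- apply/continuous_in_subspaceT => t; rewrite inE/= in_itv/=; exact: cf.
- exact: derivable_LR.
Qed.

(** Both sides are the integral of [f' t * w s] over the triangle [a <= s <= t <= b]: the inner
    integral is [v t - v a] in one order and [f b - f s] in the other. *)
Lemma fubini_deriv_primitive f v w a b : a < b ->
  (forall t, a <= t <= b -> derivable f t 1) ->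
  (forall t, a <= t <= b -> {for t, continuous (derive1 f)}) ->
  mu.-integrable `[a, b] (EFin \o w) ->
  (forall x, a <= x <= b -> v x - v a = \int[mu]_(t in `[a, x]) w t) ->
  (\int[mu]_(t in `[a, b]) ((derive1 f) t * (v t - v a))%:E =
   \int[mu]_(s in `[a, b]) (w s * (f b - f s))%:E)%E.
Proof.
move=> ab df cf iw vw.
pose p : R -> R := (derive1 f) \_ `[a, b]; pose q : R -> R := w \_ `[a, b].
have cf' : {within `[a, b], continuous (derive1 f)}.
  by apply/continuous_in_subspaceT => t; rewrite inE/= in_itv/=; exact: cf.
have if' : mu.-integrable `[a, b] (EFin \o (derive1 f)).
  by apply: continuous_compact_integrable => //; exact: segment_compact.
have ip : mu.-integrable setT (EFin \o p).
  by rewrite -restrict_EFin; apply/integrable_restrict => //=; rewrite setTI.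
have iq : mu.-integrable setT (EFin \o q).
  by rewrite -restrict_EFin; apply/integrable_restrict => //=; rewrite setTI.
have mp : measurable_fun setT p by apply/measurable_EFinP; case/integrableP: ip.
have mq : measurable_fun setT q by apply/measurable_EFinP; case/integrableP: iq.
pose F (z : R * R) := (p z.1 * q z.2 * (z.2 <= z.1)%R%:R)%:E.
have mF : measurable_fun setT F.
  apply/measurable_EFinP; apply: measurable_funM.
    apply: measurable_funM.
      exact: (measurableT_comp mp measurable_fst).
    exact: (measurableT_comp mq measurable_snd).
  rewrite (_ : (fun x => _) = (fun x => if x.2 <= x.1 then 1 else 0)); last first.
    by apply/funext => x; case: (_ <= _).
  apply: measurable_fun_ifT => //; exact: measurable_fun_ler.
have iF : (mu \x mu)%E.-integrable setT F.
  apply/integrable12ltyP => //.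
  apply: (@le_lt_trans _ _ (\int[mu]_x (`|p x|%:E * \int[mu]_y `|q y|%:E))%E).
    apply: le_integral_nomeas => x _; rewrite -ge0_integralZl//; last first.
      by apply/measurable_EFinP; exact: measurableT_comp.
    apply: le_integral_nomeas => y _; rewrite /F /= !normrM lee_fin.
    by rewrite ler_piMr ?mulr_ge0//; case: (y <= x); rewrite ?normr1 ?normr0.
  have /integrableP[_ iq'] := iq; have /integrableP[_ ip'] := ip.
  rewrite ge0_integralZr//.
  - by rewrite lte_mul_pinfty// ?ge0_fin_numE//; apply: integral_ge0.
  - by apply/measurable_EFinP; exact: measurableT_comp.
  - exact: integral_ge0.
have FF t : fubini_F mu F t = ((fun t => ((derive1 f) t * (v t - v a))%:E) \_ `[a, b]) t.
  rewrite /fubini_F patchE; case: ifPn => [|tab]; last first.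
    by apply: integral0_eq => s _; rewrite /F /p /= patchE (negbTE tab) !mul0r.
  rewrite mem_itvcc => /andP[at_ tb].
  have -> : (fun s => F (t, s)) = (fun s => ((derive1 f) t)%:E * ((EFin \o w) \_ `[a, t]) s)%E.
    apply/funext => s; rewrite /F /p /q /= !patchE mem_set/= ?in_itv/= ?at_//.
    rewrite -!mulrA EFinM; congr (_ * _)%E.
    rewrite !mem_itvcc; have [as_|sa] /= := leP a s; last by rewrite mul0r.
    have [st|ts] /= := leP s t; last by rewrite mulr0.
    by rewrite (le_trans st tb) mulr1.
  have iwt : mu.-integrable `[a, t] (EFin \o w).
    apply: integrableS iw => //; apply: subset_itvl; by rewrite bnd_simp.
  rewrite integralZl//; last first.
    by apply/integrable_restrict => //=; rewrite setTI.
  rewrite -integral_mkcond vw ?at_// EFinM; congr (_ * _)%E.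
  by rewrite /Rintegral fineK//; apply: integrable_fin_num.
have GG s : fubini_G mu F s = ((fun s => (w s * (f b - f s))%:E) \_ `[a, b]) s.
  rewrite /fubini_G patchE; case: ifPn => [|sab]; last first.
    by apply: integral0_eq => t _; rewrite /F /q /= patchE (negbTE sab) mulr0 mul0r.
  rewrite mem_itvcc => /andP[as_ sb].
  have -> : (fun t => F (t, s)) = (fun t => (w s)%:E * ((EFin \o (derive1 f)) \_ `[s, b]) t)%E.
    apply/funext => t; rewrite /F /p /q /= !patchE [s \in _]mem_set/= ?in_itv/= ?as_//.
    rewrite -mulrA mulrCA EFinM; congr (_ * _)%E.
    rewrite !mem_itvcc; have [tb|bt] /= := leP t b; last by rewrite !andbF mul0r.
    have [st|ts] /= := leP s t; last by rewrite mulr0.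
    by rewrite (le_trans as_ st) mulr1.
  have ift : mu.-integrable `[s, b] (EFin \o (derive1 f)).
    apply: integrableS if' => //; apply: subset_itvr; by rewrite bnd_simp.
  rewrite integralZl//; last first.
    by apply/integrable_restrict => //=; rewrite setTI.
  rewrite -integral_mkcond /comp FTC2_derivable ?EFinM//.
  - by move=> t /andP[st tb]; apply: df; rewrite tb (le_trans as_).
  - by move=> t /andP[st tb]; apply: cf; rewrite tb (le_trans as_).
rewrite integral_mkcond [RHS]integral_mkcond.
transitivity (\int[mu]_t fubini_F mu F t)%E; first by apply: eq_integral => t _; rewrite FF.
transitivity (\int[mu]_s fubini_G mu F s)%E; first exact: (Fubini iF).
by apply: eq_integral => s _; rewrite GG.
Qed.

(** Expanding both sides of the Fubini identity and evaluating the integrals of [w] and [f'] leaves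
    the boundary terms. With [f] a power of [r] it shows that the rescaled ray is again an
    indefinite integral. *)
Lemma integral_product_rule f v w a b : a < b ->
  (forall t, a <= t <= b -> derivable f t 1) ->
  (forall t, a <= t <= b -> {for t, continuous (derive1 f)}) ->
  mu.-integrable `[a, b] (EFin \o w) ->
  (forall x, a <= x <= b -> v x - v a = \int[mu]_(t in `[a, x]) w t) ->
  mu.-integrable `[a, b] (fun t => (f t * w t + (derive1 f) t * v t)%:E) /\
  (\int[mu]_(t in `[a, b]) (f t * w t + (derive1 f) t * v t)%:E =
    (f b * v b - f a * v a)%:E)%E.
Proof.
move=> ab df cf iw vw.
have cf' : {within `[a, b], continuous (derive1 f)}.
  by apply/continuous_in_subspaceT => t; rewrite inE/= in_itv/=; exact: cf.
have cf0 := derivable_continuous_on ab df.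
have cv : {within `[a, b], continuous v}.
  have := parameterized_integral_continuous (ltW ab) iw.
  move=> /subspace_continuousP h; apply/subspace_continuousP => x xab.
  have hx := h x xab; rewrite /= in hx.
  have -> : v = (fun y => v a + (v y - v a)) by apply/funext => y; rewrite addrC subrK.
  apply: cvgD; first exact: cvg_cst.
  rewrite vw; last by move: xab; rewrite /= in_itv.
  apply: cvg_trans hx; apply: near_eq_cvg.
  rewrite near_withinE; apply: nearW => y yab.
  by rewrite /from_subspace /parameterized_integral /= vw//; move: yab; rewrite /= in_itv.
have mf : measurable_fun `[a, b] f.
  by apply: subspace_continuous_measurable_fun.
have bf : [bounded f x | x in `[a, b]].
  have [M [_ mrt]] := compact_bounded (continuous_compact cf0 (@segment_compact _ a b)).
  exists (`|M| + 1); split; first by rewrite num_real.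
  move=> t tM x xab; apply: le_trans (ltW tM).
  by apply: mrt; [rewrite (le_lt_trans (ler_norm _))// ltrDl|exists x].
have ifw : mu.-integrable `[a, b] (EFin \o (fun t => f t * w t)).
  rewrite (_ : _ \o _ = ((EFin \o f) \* (EFin \o w))%E).
    exact: integrableMr.
  by apply/funext => t /=; rewrite EFinM.
have cont_int g : {within `[a, b], continuous g} -> mu.-integrable `[a, b] (EFin \o g).
  by move=> cg; apply: continuous_compact_integrable => //; exact: segment_compact.
have ifv : mu.-integrable `[a, b] (EFin \o (fun t => (derive1 f) t * v t)).
  apply: cont_int; apply/subspace_continuousP => x xab; apply: cvgM.
  - by move/subspace_continuousP : cf'; exact.
  - by move/subspace_continuousP : cv; exact.
have if' : mu.-integrable `[a, b] (EFin \o derive1 f) by exact: cont_int.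
have aab : a <= a <= b by rewrite lexx ltW.
have key := fubini_deriv_primitive ab df cf iw vw.
pose A t := f t * w t; pose B t := (derive1 f) t * v t.
have -> : (fun t => (f t * w t + (derive1 f) t * v t)%:E) = ((EFin \o A) \+ (EFin \o B))%E.
  by apply/funext => t /=; rewrite EFinD.
split; first exact: integrableD.
rewrite integralD// -[X in (X + _)%E]fineK; last exact: integrable_fin_num.
rewrite -[X in (_ + X)%E]fineK; last exact: integrable_fin_num.
rewrite -EFinD -!/(Rintegral _ _ _); congr EFin.
have := congr1 fine key; rewrite -!/(Rintegral _ _ _).
under [X in X = _ -> _]eq_Rintegral do rewrite mulrBr.
under [X in _ = X -> _]eq_Rintegral do rewrite mulrBr.
have comm (g h : R -> R) : mu.-integrable `[a, b] (EFin \o (fun t => g t * h t)) ->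
    mu.-integrable `[a, b] (EFin \o (fun t => h t * g t)).
  by congr (mu.-integrable _ _); apply/funext => t /=; rewrite mulrC.
have scal (g : R -> R) c : mu.-integrable `[a, b] (EFin \o g) ->
    mu.-integrable `[a, b] (EFin \o (fun t => g t * c)).
  move=> ig; apply: (comm (cst c)).
  rewrite (_ : _ \o _ = (cst c%:E \* (EFin \o g))%E)//; exact: integrableZl.
have iwf := comm _ _ ifw.
have iwb := scal _ (f b) iw.
have if'a := scal _ (v a) if'.
rewrite !RintegralB// !RintegralZr//.
have -> : \int[mu]_(t in `[a, b]) derive1 f t = f b - f a.
  by rewrite /Rintegral FTC2_derivable ?ltW.
rewrite -vw ?lexx ?andbT ?(ltW ab)//.
under [X in _ = _ - X -> _]eq_Rintegral do rewrite mulrC.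
lra.
Qed.

End absolutely_continuous.

Section rays.
Context {R : realType}.
Notation mu := (@lebesgue_measure R).
Implicit Types (f v w : R -> R) (a b : R).

Definition primitive_of (rho : \bar R) v w := forall a b,
  0 < a -> a <= b -> (b%:E < rho)%E ->
  mu.-integrable `[a, b] (EFin \o w) /\
  v b - v a = \int[mu]_(t in `[a, b]) w t.

Lemma integral_inv a b : 0 < a -> a <= b ->
  (\int[mu]_(t in `[a, b]) (t^-1)%:E = (ln (b / a))%:E)%E.
Proof.
move=> a0 ab.
have pos t : a <= t <= b -> 0 < t by move=> /andP[at_ _]; exact: lt_le_trans at_.
have ln' (t : R) : 0 < t -> derive1 (@ln R) t = t^-1 :> R.
  by move=> t0; rewrite derive1E; have [_ ->] := is_derive1_ln t0.
rewrite ln_div ?posrE//; last exact: lt_le_trans ab.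
rewrite -FTC2_derivable//.
- by apply: eq_integral => t; rewrite inE/= in_itv/= => /pos t0; rewrite ln'.
- by move=> t /pos t0; have [] := is_derive1_ln t0.
- move=> t /pos t0; rewrite /prop_for/=.
  have h : {for t, continuous (fun x : R => x^-1)} by apply: inv_continuous; rewrite gt_eqF.
  rewrite /continuous_at ln'//; apply: cvg_trans h; apply: near_eq_cvg.
  by near=> s; rewrite ln'//; near: s; exact: lt_nbhsr.
Unshelve. all: by end_near. Qed.

Section primitive.
Variables (rho : \bar R) (v w : R -> R).
Hypothesis vw : primitive_of rho v w.

Lemma lt_ereal_mid (r : R) : (r%:E < rho)%E -> exists2 b, r < b & (b%:E < rho)%E.
Proof.
case: rho => [s| |]//=; last by exists (r + 1); rewrite ?ltrDl// ltry.
by rewrite lte_fin => rs; exists ((r + s) / 2); rewrite ?lte_fin; lra.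
Qed.

(** Lebesgue differentiation for [w] cut off to [[a, b]], which is globally integrable; near an
    interior point [v] differs from the primitive of the cut-off only by the constant [v a]. *)
Lemma primitive_derivable a b : 0 < a -> (b%:E < rho)%E ->
  {ae mu, forall r, a < r < b -> derivable v r 1 /\ derive1 v r = w r}.
Proof.
move=> a0 brho; have [ba|ab] := leP b a.
  by apply: aeW => r /andP[ar rb]; have := lt_trans ar rb; rewrite ltNge ba.
have [iw _] := vw a0 (ltW ab) brho.
pose f := w \_ `[a, b].
have if_ : mu.-integrable setT (EFin \o f).
  by rewrite -restrict_EFin; apply/integrable_restrict => //=; rewrite setTI.
have loc := integrable_locally_restrict (measurable_itv `[a, b]) iw.
have ify (y : R) : mu.-integrable [set` Interval (BLeft a) (BRight y)] (EFin \o f).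
  exact: integrableS if_.
have := FTC1 ify loc; apply: filterS => r Fr /andP[ar rb].
have [dF F'] := Fr (introT idP ar).
have vF : \forall y \near r, v a + \int[mu]_(t in `[a, y]) f t = v y.
  near=> y.
  have ay : a <= y by apply: ltW; near: y; exact: lt_nbhsr.
  have yb : y <= b by apply: ltW; near: y; exact: lt_nbhsl.
  have -> : \int[mu]_(t in `[a, y]) f t = \int[mu]_(t in `[a, y]) w t.
    apply: eq_Rintegral => t; rewrite inE/= in_itv/= => /andP[at_ ty].
    by rewrite /f patchE mem_set//= in_itv/= at_ (le_trans ty).
  have [_ <-] := vw a0 ay (le_lt_trans (introT idP yb : (y%:E <= b%:E)%E) brho).
  by rewrite addrC subrK.
have dvF : is_derive r 1 (fun y => v a + \int[mu]_(t in `[a, y]) f t) (w r).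
  rewrite -[w r]add0r; apply: is_deriveD => //.
  have -> : w r = f r by rewrite /f patchE mem_set//= in_itv/= !ltW.
  by rewrite -F' derive1E; exact/derivableP.
have := near_eq_is_derive vF dvF => -[d1 d2].
by rewrite derive1E d2.
Unshelve. all: by end_near. Qed.

Lemma primitive_continuous r : 0 < r -> (r%:E < rho)%E -> {for r, continuous v}.
Proof.
move=> r0 /lt_ereal_mid[b rb brho].
pose a := r / 2; have a0 : 0 < a by rewrite /a; lra.
have ar : a < r by rewrite /a; lra.
have ab : a < b by exact: lt_trans rb.
have [iw _] := vw a0 (ltW ab) brho.
have /(continuous_within_itvP _ ab)[+ _ _] := parameterized_integral_continuous (ltW ab) iw.
move=> /(_ r); rewrite in_itv/= ar rb => /(_ isT) h.
have h2 : (fun y => v a + \int[mu]_(t in `[a, y]) w t) y @[y --> r] -->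
    v a + \int[mu]_(t in `[a, r]) w t.
  by apply: cvgD; [exact: cvg_cst|exact: h].
have E y : a <= y <= b -> v a + \int[mu]_(t in `[a, y]) w t = v y.
  move=> /andP[ay yb].
  have [_ <-] := vw a0 ay (le_lt_trans (introT idP yb : (y%:E <= b%:E)%E) brho).
  by rewrite addrC subrK.
rewrite /prop_for/= /continuous_at -(E r) ?(ltW ar) ?(ltW rb)//.
apply: cvg_trans h2; apply: near_eq_cvg; near=> y.
apply/E/andP; split; apply: ltW; near: y; [exact: lt_nbhsr|exact: lt_nbhsl].
Unshelve. all: by end_near. Qed.

Variable m : R.
Let U s := s `^ (- m) * v s.

Let dpow (x t : R) : 0 < t -> derivable (fun s => s `^ x) t 1.
Proof. by move=> t0; apply: derivable_powR; rewrite in_itv/= t0. Qed.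

Lemma rescaled_continuous r : 0 < r -> (r%:E < rho)%E -> {for r, continuous U}.
Proof.
move=> r0 rrho; apply: continuousM; last exact: primitive_continuous.
by apply: differentiable_continuous; exact/derivable1_diffP/dpow.
Qed.

Lemma rescaled_derivable a b : 0 < a -> (b%:E < rho)%E ->
  {ae mu, forall r, a < r < b -> derivable U r 1 /\
    derive1 U r = r `^ (- m) * w r + derive1 (fun s => s `^ (- m)) r * v r}.
Proof.
move=> a0 brho; apply: filterS (primitive_derivable a0 brho) => r h arb.
have [dv v'] := h arb; have /andP[ar rb] := arb.
have r0 := lt_trans a0 ar.
have h1 : is_derive r 1 (fun s => s `^ (- m)) (derive1 (fun s => s `^ (- m)) r).
  by rewrite derive1E; apply/derivableP; exact: dpow.
have h2 : is_derive r 1 v (w r) by rewrite -v' derive1E; exact/derivableP.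
have [d1 d2] := is_deriveM h1 h2; split; first exact: d1.
by rewrite derive1E [LHS]d2 /GRing.scale/= [X in _ + X]mulrC.
Qed.

(** Cauchy-Schwarz with weights [1 / r] and [r]. The derivative enters through a measurable [g]
    equal to it almost everywhere, because [derive1 U] has default values where the derivative does
    not exist; [g] will be a section of a jointly measurable function. *)
Lemma ray_estimate a b (g : R -> R) : 0 < a -> a < b -> (b%:E < rho)%E ->
  measurable_fun `[a, b] g ->
  {ae mu, forall r, a < r < b -> g r = derive1 U r} ->
  (((U b - U a) ^+ 2)%:E <=
    (ln (b / a))%:E * \int[mu]_(r in `[a, b]) (r * g r ^+ 2)%:E)%E.
Proof.
move=> a0 ab brho mg gU.
pose G r := r `^ (- m) * w r + derive1 (fun s => s `^ (- m)) r * v r.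
have [iw _] := vw a0 (ltW ab) brho.
have pos t : a <= t <= b -> 0 < t by move=> /andP[at_ _]; exact: lt_le_trans at_.
have [iG IG] : mu.-integrable `[a, b] (fun t => (G t)%:E) /\
    (\int[mu]_(t in `[a, b]) (G t)%:E = (U b - U a)%:E)%E.
  apply: integral_product_rule => //.
  - by move=> t /pos; exact: dpow.
  - move=> t /pos t0; rewrite /prop_for/=.
    have d1 s : 0 < s -> derive1 (fun s => s `^ (- m)) s = (- m) * s `^ (- m - 1).
      by move=> s0; rewrite powR_derive1// in_itv/= s0.
    rewrite /continuous_at d1//.
    have h : {for t, continuous (fun s : R => - m * s `^ (- m - 1))}.
      apply: continuousM; first exact: cst_continuous.
      by apply: differentiable_continuous; exact/derivable1_diffP/dpow.
    apply: cvg_trans h; apply: near_eq_cvg.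
    by near=> s; rewrite d1//; near: s; exact: lt_nbhsr.
  - move=> x /andP[ax xb].
    by have [] := vw a0 ax (le_lt_trans (introT idP xb : (x%:E <= b%:E)%E) brho).
have [L LE] : exists L : R, L = ln (b / a) by eexists.
rewrite -LE; have L0 : 0 < L by rewrite LE ln_gt0// ltr_pdivlMr// mul1r.
set K := (\int[mu]_(r in `[a, b]) _)%E.
have K0 : (0 <= K)%E.
  apply: integral_ge0 => r; rewrite /= in_itv/= => /pos r0.
  by rewrite lee_fin mulr_ge0 ?sqr_ge0// ltW.
have [D0|D0] := eqVneq (U b - U a) 0.
  by rewrite D0 expr0n/=; apply: mule_ge0 => //; rewrite lee_fin ltW.
have [D DE] : exists D : R, D = `|U b - U a| by eexists.
have Dp : 0 < D by rewrite DE normr_gt0.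
have [l lE] : exists l : R, l = D / L by eexists.
have l0 : 0 < l by rewrite lE divr_gt0.
have mK : measurable_fun `[a, b] (fun r => (r * g r ^+ 2)%:E).
  by apply/measurable_EFinP; apply: measurable_funM => //; exact: measurable_funX.
have minv : measurable_fun `[a, b] (fun r : R => (r^-1)%:E).
  apply/measurable_EFinP; apply: subspace_continuous_measurable_fun => //.
  apply/continuous_in_subspaceT => t; rewrite inE/= in_itv/= => /pos t0.
  by apply: inv_continuous; rewrite gt_eqF.
have GU : {ae mu, forall r, `[a, b]%classic r -> G r = g r}.
  have ea : {ae mu, forall r, r <> a}.
    by exists [set a]; split; [exact: measurable_set1|exact: lebesgue_measure_set1|move=> x /= /contrapT].
  have eb : {ae mu, forall r, r <> b}.
    by exists [set b]; split; [exact: measurable_set1|exact: lebesgue_measure_set1|move=> x /= /contrapT].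
  have eab : {ae mu, forall r, r <> a /\ r <> b}.
    by move: ea eb; apply: filterS2 => r h1 h2.
  move: gU (rescaled_derivable a0 brho) eab.
  apply: filterS3 => r h1 h2 [/eqP ra /eqP rb].
  rewrite /= in_itv/= => /andP[ar rb'].
  have arb : a < r < b by rewrite !lt_neqAle ar rb' rb [a == r]eq_sym ra.
  by rewrite h1// (h2 arb).2.
have step : (D%:E <= (l / 2)%:E * L%:E + ((2 * l)^-1)%:E * K)%E.
  apply: (@le_trans _ _ (\int[mu]_(t in `[a, b])
      ((l / 2)%:E * (t^-1)%:E + ((2 * l)^-1)%:E * (t * g t ^+ 2)%:E))%E).
    rewrite DE -abse_EFin -IG; apply: le_trans (le_abse_integral _ _ _) _ => //.
      by case/integrableP: iG.
    apply: ae_le_integral; apply: filterS GU => t Gt tab.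
    have t0 : 0 < t by move: tab; rewrite /= in_itv/=; exact: pos.
    rewrite (Gt tab) /= -!EFinM -EFinD lee_fin.
    (* AM-GM instead of Cauchy-Schwarz: 2|g| <= l / t + t g^2 / l, with l = D / L
       chosen so that the first term integrates to D. *)
    rewrite -subr_ge0.
    have -> : l / 2 * t^-1 + (2 * l)^-1 * (t * g t ^+ 2) - `|g t| =
        (l - t * `|g t|) ^+ 2 / (2 * t * l).
      by rewrite -[g t ^+ 2]real_normK ?num_real//; field; rewrite !gt_eqF.
    apply: divr_ge0; first exact: sqr_ge0.
    by apply: ltW; apply: mulr_gt0 => //; exact: mulr_gt0.
  have inv0 t : `[a, b]%classic t -> (0 <= (t^-1)%:E)%E.
    by rewrite /= in_itv/= => /pos t0; rewrite lee_fin invr_ge0 ltW.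
  have g0 t : `[a, b]%classic t -> (0 <= (t * g t ^+ 2)%:E)%E.
    by rewrite /= in_itv/= => /pos t0; rewrite lee_fin mulr_ge0 ?sqr_ge0// ltW.
  have l20 : (0 <= (l / 2)%:E)%E by rewrite lee_fin divr_ge0 ?(ltW l0).
  have li0 : (0 <= ((2 * l)^-1)%:E)%E by rewrite lee_fin invr_ge0 mulr_ge0 ?(ltW l0).
  rewrite ge0_integralD//.
  - by rewrite !ge0_integralZl// integral_inv ?(ltW ab)// LE.
  - by move=> t /inv0 h; rewrite mule_ge0.
  - exact: measurable_funeM.
  - by move=> t /g0 h; rewrite mule_ge0.
  - exact: measurable_funeM.
move: K K0 {mK} step => [k| |] //= K0 step.
  move: step; rewrite -!EFinM -EFinD !lee_fin -[(U b - U a) ^+ 2]real_normK ?num_real// -DE => step.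
  have : l / 2 * L = D / 2 by rewrite lE; field; rewrite gt_eqF.
  move=> hl; rewrite hl in step.
  have : D / 2 <= (2 * l)^-1 * k by lra.
  have -> : (2 * l)^-1 * k = L * k / (2 * D) by rewrite lE; field; rewrite !gt_eqF.
  rewrite ler_pdivlMr ?mulr_gt0// expr2; nra.
by rewrite gt0_muley ?leey// lte_fin.
Unshelve. all: by end_near. Qed.

End primitive.
End rays.

(** * Rescaling Sobolev functions *)

Section lebesgue_scaling.
Context {R : realType} (n : nat).
Local Open Scope ereal_scope.
Implicit Types (A : set 'rV[R]_n) (r : R).

(** Covering boxes are dilated by [r^-1], which multiplies each of the [n] side lengths by that
    factor. The same inequality for [r^-1] yields equality. *)
Lemma lebesgue_outer_scale_le r A : (0 < r)%R ->
  lebesgue_outer (( *:%R r) @^-1` A) <= (r ^- n)%:E * lebesgue_outer A.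
Proof.
move=> r0; have rn0 : (0 < r ^- n)%R by rewrite invr_gt0 exprn_gt0.
rewrite -lee_pdivrMl//; apply: le_ereal_inf_tmp => _ [C [_ AC] <-].
rewrite lee_pdivrMl//.
pose s (ab : 'rV[R]_n * 'rV[R]_n) := (r^-1 *: ab.1, r^-1 *: ab.2)%R.
pose C' j := omap s (C j).
rewrite -nneseriesZl; last by move=> j _; case: (C j) => //= ab; exact: box_volume_ge0.
apply: ereal_inf_lbound; exists C'.
  split => // x Ax; have [j _ Cx] := AC _ Ax; exists j => //.
  move: Cx; rewrite /C'; case: (C j) => //= ab h i.
  have := h i; rewrite !mxE => /andP[h1 h2].
  by rewrite ler_pdivrMl// ler_pdivlMl// h1 h2.
apply: eq_eseriesr => j _; rewrite /C'; case: (C j) => [ab|] /=; last by rewrite mule0.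
rewrite /box_volume -EFinM; congr EFin.
rewrite -exprVn -[X in (_ ^+ X * _)%R]card_ord -prodr_const -big_split/=.
apply: eq_bigr => i _; rewrite !mxE -mulrBr.
by rewrite maxr_pMr ?mulr0// invr_ge0 ltW.
Qed.

Lemma lebesgue_outer_scale r A : (0 < r)%R ->
  lebesgue_outer (( *:%R r) @^-1` A) = (r ^- n)%:E * lebesgue_outer A.
Proof.
move=> r0; apply/eqP; rewrite eq_le lebesgue_outer_scale_le//=.
have r'0 : (0 < r^-1)%R by rewrite invr_gt0.
have := lebesgue_outer_scale_le (( *:%R r) @^-1` A) r'0.
have -> : *:%R r^-1 @^-1` ( *:%R r @^-1` A) = A.
  by apply/seteqP; split=> x /=; rewrite scalerA mulfV ?gt_eqF// scale1r.
by rewrite exprVn invrK -lee_pdivrMl ?exprn_gt0.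
Qed.

(** The Caratheodory condition for the preimage, tested on [X], is the one for [A] tested on the
    dilate [Y] of [X], multiplied by [r ^- n]. *)
Lemma measurable_scale r : (0 < r)%R ->
  measurable_fun [set: caratheodory_type (@lebesgue_outer R n)]
    (( *:%R r) : 'rV[R]_n -> caratheodory_type (@lebesgue_outer R n)).
Proof.
move=> r0 _ A mA; rewrite setTI; apply: le_caratheodory_measurable => X.
pose Y := ( *:%R r^-1) @^-1` X.
have r'0 : (0 < r^-1)%R by rewrite invr_gt0.
have H B : X `&` ( *:%R r @^-1` B) = *:%R r @^-1` (Y `&` B).
  by apply/seteqP; split=> x /=; rewrite /Y/= scalerA mulVf ?gt_eqF// scale1r.
have e : lebesgue_outer (X `&` ( *:%R r @^-1` A)) +
    lebesgue_outer (X `&` ( *:%R r @^-1` (~` A))) <= lebesgue_outer (X `&` ( *:%R r @^-1` setT)).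
  rewrite !H !lebesgue_outer_scale// setIT -ge0_muleDr.
  - by rewrite (mA Y).
  - exact: (outer_measure_ge0 (@lebesgue_outer R n)).
  - exact: (outer_measure_ge0 (@lebesgue_outer R n)).
by rewrite preimage_setT setIT in e.
Qed.

Lemma integral_scale r (D : set 'rV[R]_n) (f : 'rV[R]_n -> \bar R) : (0 < r)%R ->
  \int[lebn n]_(x in ( *:%R r) @^-1` D) f (r *: x)%R =
  (r ^- n)%:E * \int[lebn n]_(x in D) f x.
Proof.
move=> r0; have r'0 : (0 < r^-1)%R by rewrite invr_gt0.
apply: (@integral_comp_scaling _ (caratheodory_type (@lebesgue_outer R n)) R (lebn n)
  ( *:%R r) ( *:%R r^-1) (r ^- n) D f).
- by move=> x; rewrite scalerA mulVf ?gt_eqF// scale1r.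
- by move=> x; rewrite scalerA mulfV ?gt_eqF// scale1r.
- exact: measurable_scale.
- exact: measurable_scale.
- by rewrite invr_gt0 exprn_gt0.
- by move=> A _; exact: lebesgue_outer_scale.
Qed.

End lebesgue_scaling.

Section rescale_H1.
Context {R : realType} (n : nat).
Implicit Types (u w phi : 'rV[R]_n -> R) (r s : R).

Lemma enormZ r (x : 'rV[R]_n) : 0 <= r -> enorm (r *: x) = r * enorm x.
Proof.
move=> r0; rewrite /enorm; under eq_bigr do rewrite mxE exprMn.
by rewrite -mulr_sumr sqrtrM ?sqr_ge0// sqrtr_sqr ger0_norm.
Qed.

Lemma eball_scale r s : 0 < r -> ( *:%R r) @^-1` eball n (r * s) = eball n s :> set 'rV[R]_n.
Proof.
by move=> r0; apply/seteqP; split=> x; rewrite /eball /= enormZ ?ltW// ltr_pM2l.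
Qed.

Lemma eball1_scale r : 0 < r -> ( *:%R r) @^-1` eball n r = eball n 1 :> set 'rV[R]_n.
Proof. by move=> r0; rewrite -{2}[r]mulr1 eball_scale. Qed.

Lemma partial_scale (i : 'I_n) phi (r c : R) (x : 'rV[R]_n) :
  (forall y, differentiable phi y) ->
  partial i (fun y => c * phi (r *: y)) x = c * r * partial i phi (r *: x).
Proof.
move=> dphi; rewrite /partial.
have dr (y : 'rV[R]_n) : differentiable ( *:%R r : 'rV[R]_n -> 'rV[R]_n) y.
  exact/linear_differentiable/scaler_continuous.
have dcomp y : differentiable (fun y => phi (r *: y)) y.
  by apply: (@differentiable_comp _ _ _ _ ( *:%R r) phi) => //; exact: dphi.
rewrite deriveM//=; last exact: diff_derivable.
rewrite derive_cst scaler0 addr0 /GRing.scale/= -mulrA; congr (_ * _).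
have -> : 'D_(delta_mx 0 i) (fun y => phi (r *: y)) x =
    'D_(r *: delta_mx 0 i) phi (r *: x).
  rewrite /derive.
  have -> // : (fun h : R => h^-1 *: (((fun y => phi (r *: y)) \o shift x)
        (h *: delta_mx 0 i) - phi (r *: x))) =
      (fun h : R => h^-1 *: ((phi \o shift (r *: x)) (h *: (r *: delta_mx 0 i))
        - phi (r *: x))).
  apply/funext => h /=; rewrite [r *: (_ + _)]scalerDr.
  congr (_ *: (phi (_ + _) - _)).
  by rewrite [LHS]scalerA [RHS]scalerA mulrC.
by rewrite !deriveE// linearZ.
Qed.

Lemma test_function_scale r phi : 0 < r ->
  test_function (eball n 1) phi ->
  test_function (eball n r) (fun x => phi (r^-1 *: x)).
Proof.
move=> r0 [sphi [K [cK K1 phi0]]]; split.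
  (* Each partial derivative of the dilated function produces one more factor [r^-1]. *)
  have H (s : seq 'I_n) : exists c : R,
      foldr (@partial R n) (fun x : 'rV[R]_n => phi (r^-1 *: x)) s =
      (fun x : 'rV[R]_n => c * foldr (@partial R n) phi s (r^-1 *: x)).
    elim: s => [|i s [c IH]]; first by exists 1; apply/funext => x; rewrite mul1r.
    exists (c * r^-1); apply/funext => x /=; rewrite IH partial_scale//.
  move=> s x; have [c ->] := H s.
  apply: differentiableM => //.
  apply: (@differentiable_comp _ _ _ _ ( *:%R r^-1) (foldr (@partial R n) phi s)) => //.
exists (( *:%R r) @` K); split.
- apply: continuous_compact => //; apply: continuous_subspaceT.
  exact: scaler_continuous.
- move=> _ [x Kx <-]; rewrite /eball/= enormZ ?(ltW r0)//.
  by have := K1 _ Kx; rewrite /eball/= -(ltr_pM2l r0) mulr1.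
- move=> x Kx; apply: phi0 => Kx'; apply: Kx; exists (r^-1 *: x) => //.
  by rewrite scalerA mulfV ?gt_eqF// scale1r.
Qed.

(** Both [phi] and its partial derivatives vanish off [K]; for the derivatives this holds because
    the complement of a compact set is open, so [phi] vanishes near each of its points. This
    transfers the weak derivative from the large ball to the ball of radius [r]. *)
Lemma test_function_support r s phi i : r <= s ->
  test_function (eball n r) phi -> forall u,
  (\int[lebn n]_(x in eball n s) (u x * phi x) =
   \int[lebn n]_(x in eball n r) (u x * phi x)) /\
  (\int[lebn n]_(x in eball n s) (u x * partial i phi x) =
   \int[lebn n]_(x in eball n r) (u x * partial i phi x)).
Proof.
move=> rs [sphi [K [cK Kr phi0]]] u.
have H (psi : 'rV[R]_n -> R) : (forall x, ~ K x -> psi x = 0) ->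
    \int[lebn n]_(x in eball n s) (u x * psi x) =
    \int[lebn n]_(x in eball n r) (u x * psi x).
  move=> psi0; rewrite [LHS]Rintegral_mkcond [RHS]Rintegral_mkcond.
  congr Rintegral; apply/funext => x; rewrite !patchE.
  have [Kx|Kx] := pselect (K x).
    have rx := Kr _ Kx; have sx : eball n s x by exact: lt_le_trans rs.
    by rewrite !mem_set.
  by rewrite psi0// mulr0; do 2 case: ifPn => _ //.
split; first exact: H.
apply: H => x Kx; rewrite /partial.
have oK : open (~` K) by apply: closed_openC; exact: compact_closed.
rewrite (@near_eq_derive _ _ _ phi (cst 0)); first by rewrite derive_cst.
by apply: filterS (open_nbhs_nbhs (conj oK Kx)) => y; exact: phi0.
Qed.

(** Needed because the functional is bounded by 1 only on [H1]. The weak derivative of the rescaled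
    function is [r ^ (1 - m) * w (r x)], by the change of variables with dilated test functions. *)
Lemma rescale_H1 (m r s : R) u : 0 < r -> r <= s ->
  H1 (eball n s) u -> H1 (eball n 1) (rescale m r u).
Proof.
move=> r0 rs [Lu dwu].
set M := caratheodory_type (@lebesgue_outer R n).
have L2s (g : 'rV[R]_n -> R) c : L2 (lebn n) (eball n s) g ->
    L2 (lebn n) (eball n 1) (fun x => c * g (r *: x)).
  move=> [mg Lg].
  split.
    (* [measurable_fun] on a domain takes the measurability of the domain as a premise. The premise
       for the unit ball yields every other ball by dilation. *)
    suff h : measurable (eball n 1 : set M) ->
        measurable_fun (eball n 1 : set M) (fun x : 'rV[R]_n => g (r *: x)).
      by move=> m1; apply: (measurable_funM (measurable_cst c) (h m1)).
    move=> m1; have meb t : 0 < t -> measurable (eball n t : set M).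
      move=> t0; have ti : 0 < t^-1 by rewrite invr_gt0.
      have := measurable_scale ti measurableT m1; rewrite setTI.
      by rewrite -[X in eball n X](@mulVf _ t) ?gt_eqF// eball_scale.
    have ms : measurable (eball n s : set M) by apply: meb; exact: lt_le_trans rs.
    apply: (@measurable_comp _ _ _ M M _ (eball n s) g (eball n 1) ( *:%R r)) => //.
    - move=> _ [x + <-]; rewrite /eball/= enormZ ?(ltW r0)// => x1.
      by apply: lt_le_trans rs; rewrite -[ltRHS]mulr1 ltr_pM2l.
    - exact: measurable_funTS (measurable_scale r0).
  rewrite L2norm_lty -(eball1_scale r0).
  rewrite (integral_scale (eball n r) (fun y => ((c * g y) ^+ 2)%:E) r0).
  have [->|c0] := eqVneq c 0.
    rewrite integral0_eq ?mule0// => x _; by rewrite mul0r expr0n.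
  rewrite lte_mul_pinfty// ?lee_fin ?invr_ge0 ?exprn_ge0 ?(ltW r0)//.
  under eq_integral do rewrite exprMn EFinM.
  have c20 : 0 < c ^+ 2 by rewrite exprn_even_gt0.
  rewrite integralZl_pos// lte_mul_pinfty// ?lee_fin ?(ltW c20)//.
  move: Lg; rewrite L2norm_lty; apply: le_lt_trans.
  rewrite integral_mkcond [leRHS]integral_mkcond; apply: le_integral_nomeas => x _.
  rewrite !patchE; case: ifPn => [|_].
    rewrite inE => xr; rewrite mem_set//; exact: lt_le_trans rs.
  by case: ifPn => // _; rewrite lee_fin sqr_ge0.
split; first exact: L2s.
move=> i; have [w Lw uw] := dwu i.
exists (fun x => (r `^ (- m) * r) * w (r *: x)); first exact: L2s.
have Rscale (f : 'rV[R]_n -> R) (c : R) : 0 < c ->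
    \int[lebn n]_(x in eball n 1) (c * f (r *: x)) =
    c * (r ^- n * \int[lebn n]_(x in eball n r) f x).
  move=> c0; rewrite /Rintegral -(eball1_scale r0).
  under eq_integral do rewrite EFinM.
  rewrite integralZl_pos// (integral_scale (eball n r) (EFin \o f) r0) /comp.
  have fineZ (a : R) (X : \bar R) : 0 < a -> fine (a%:E * X)%E = a * fine X.
    move=> a0; case: X => [x| |]//=.
    - by rewrite gt0_muley ?lte_fin// mulr0.
    - by rewrite gt0_muleNy ?lte_fin// mulr0.
  by rewrite !fineZ// invr_gt0 exprn_gt0.
move=> phi tphi.
have tpsi := test_function_scale r0 tphi.
have dphi y : differentiable phi y by exact: (tphi.1 [::] y).
pose psi (x : 'rV[R]_n) := phi (r^-1 *: x).
have phiE x : phi x = psi (r *: x).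
  by rewrite /psi scalerA mulVf ?gt_eqF// scale1r.
have dphiE x : partial i phi x = r * partial i psi (r *: x).
  have -> : psi = (fun y => 1 * phi (r^-1 *: y)) by apply/funext => y; rewrite mul1r.
  rewrite partial_scale// scalerA mulVf ?gt_eqF// scale1r mul1r mulrA.
  by rewrite mulfV ?gt_eqF// mul1r.
have c0 : 0 < r `^ (- m) * r by rewrite mulr_gt0// powR_gt0.
transitivity (\int[lebn n]_(x in eball n 1)
    (r `^ (- m) * r * ((u \* partial i psi) (r *: x)))).
  by apply: eq_Rintegral => x _; rewrite dphiE /rescale /=; ring.
transitivity (- \int[lebn n]_(x in eball n 1)
    (r `^ (- m) * r * ((w \* psi) (r *: x)))); last first.
  by congr (- _); apply: eq_Rintegral => x _; rewrite phiE /=; ring.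
rewrite !Rscale// -2!mulrN; congr (_ * (_ * _)) => /=.
have [_ <-] := test_function_support i rs tpsi u.
have [<- _] := test_function_support i rs tpsi w.
apply: uw; split; first exact: tpsi.1.
have [K [cK Kr K0]] := tpsi.2.
by exists K; split => // x /Kr h; exact: lt_le_trans h rs.
Qed.

End rescale_H1.

(** * From rays to the sphere *)

Section caratheodory_function.
Context d (T : measurableType d) (R : realType).

(** Rounding [r] down to a multiple of [1 / (k + 1)] gives functions whose preimages are countable
    unions of rectangles; they converge pointwise by continuity in [r]. *)
Lemma measurable_caratheodory_function (V : R -> T -> R) :
  (forall r, measurable_fun setT (V r)) -> (forall x, continuous (V^~ x)) ->
  measurable_fun setT (fun z : R * T => V z.1 z.2).
Proof.
move=> mV cV.
pose V_ (k : nat) (z : R * T) := V ((Num.floor (z.1 * k.+1%:R))%:~R / k.+1%:R) z.2.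
apply: (@measurable_fun_cvg _ _ _ _ V_) => [k _ Y mY|[r x] _].
  rewrite setTI.
  have -> : V_ k @^-1` Y = \bigcup_(j : int)
      (`[j%:~R / k.+1%:R, (j + 1)%:~R / k.+1%:R[%classic `*`
       (V (j%:~R / k.+1%:R) @^-1` Y)).
    apply/seteqP; split => [[r x] /= Yrx|[r x] [j _] [/= + Yx]].
      exists (Num.floor (r * k.+1%:R)) => //; split => //=.
      by rewrite in_itv/= ler_pdivrMr// ltr_pdivlMr// floor_le_tmp floorD1_gt.
    rewrite in_itv/= ler_pdivrMr// ltr_pdivlMr// => /floor_def fj.
    by rewrite /V_ /= fj.
  apply: countable_bigcupT_measurable => [|j]; first exact: countableP.
  apply: measurableX => //.
  by rewrite -[X in measurable X]setTI; exact: mV.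
have H : (fun k => (Num.floor (r * k.+1%:R))%:~R / k.+1%:R : R) @ \oo --> r.
  apply/cvgrPdist_le => e e0; near=> k.
  have k0 : 0 < k.+1%:R :> R by [].
  have := floor_le_tmp (r * k.+1%:R); have := floorD1_gt (r * k.+1%:R).
  rewrite intrD1 => h1 h2.
  have -> : r - (Num.floor (r * k.+1%:R))%:~R / k.+1%:R =
      (r * k.+1%:R - (Num.floor (r * k.+1%:R))%:~R) / k.+1%:R.
    by rewrite mulrBl mulfK// gt_eqF.
  rewrite ger0_norm ?divr_ge0 ?subr_ge0// ler_pdivrMr//.
  apply: (@le_trans _ _ 1); first by rewrite lerBlDl ltW// addrC.
  rewrite -ler_pdivrMl// mulr1.
  near: k; exists (Num.truncn e^-1) => // k /= hk.
  apply: ltW; apply: lt_le_trans (truncnS_gt _) _.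
  by rewrite ler_nat.
exact: (cvg_comp _ _ H (cV x r)).
Unshelve. all: by end_near. Qed.

End caratheodory_function.

(** * Joint measurability of the radial derivative *)

Section measurable_derivative.
Context {R : realType}.

Definition slope (f : R -> R) (r h : R) := h^-1 * (f (h + r) - f r).

(* Cauchy criterion for the difference quotients: only rational increments occur, so
   that for continuous [f] derivability is a measurable condition. *)
Definition slope_cauchy (f : R -> R) (r : R) := forall p : nat, exists q : nat,
  forall h : rat, 0 < `|ratr h : R| < q.+1%:R^-1 ->
  `|slope f r (ratr h) - slope f r q.+2%:R^-1| <= p.+1%:R^-1.

Lemma slopeE (f : R -> R) (r : R) :
  (fun h : R => h^-1 *: ((f \o shift r) (h *: 1) - f r)) = slope f r.
Proof. by apply/funext => h; rewrite /slope /= /GRing.scale /= mulr1. Qed.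

Lemma derivable_slope_cauchy (f : R -> R) (r : R) :
  derivable f r 1 -> slope_cauchy f r.
Proof.
rewrite /derivable slopeE => /cvg_ex[l fl] p.
have e0 : 0 < p.+1%:R^-1 / 2 :> R by [].
have /cvgrPdist_le/(_ _ e0) := fl.
move=> [d /= d0 dP].
have H h : 0 < `|h| < d -> `|l - slope f r h| <= p.+1%:R^-1 / 2.
  move=> /andP[h0 hd]; apply: dP; first by rewrite /= sub0r normrN.
  by rewrite -normr_gt0.
exists (Num.truncn d^-1) => h /andP[h0 hq].
have qd : (Num.truncn d^-1).+1%:R^-1 <= d.
  rewrite -[leRHS]invrK lef_pV2 ?posrE ?invr_gt0//; exact/ltW/truncnS_gt.
rewrite (_ : slope f r (ratr h) - _ = (l - slope f r (Num.truncn d^-1).+2%:R^-1) - (l - slope f r (ratr h))); last by ring.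
(* The reference increment [1 / (q + 2)] is strictly below [1 / (q + 1) <= d], so the estimate [H]
   applies to it as well. *)
apply: le_trans (ler_normB _ _) _; rewrite [leRHS]splitr; apply: lerD; apply: H.
  rewrite normr_gt0 invr_eq0 pnatr_eq0/= gtr0_norm ?invr_gt0//.
  by apply: lt_le_trans qd; rewrite ltf_pV2 ?posrE// ltr_nat.
by rewrite h0 (lt_le_trans hq).
Qed.

(** For nonzero increments the slope is continuous in the increment, so a strict violation of the
    Cauchy bound at a real [h] would persist at a nearby rational one. *)
Lemma slope_cauchy_derivable (f : R -> R) (r : R) : continuous f ->
  slope_cauchy f r -> derivable f r 1.
Proof.
move=> cf fr; rewrite /derivable slopeE; apply/cauchy_cvgP/cauchy_exP => e e0.
have [p pe] : exists p : nat, p.+1%:R^-1 < e.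
  exists (Num.truncn e^-1); rewrite -[ltRHS]invrK ltf_pV2 ?posrE ?invr_gt0//.
  exact: truncnS_gt.
have [q qP] := fr p; exists (slope f r q.+2%:R^-1).
exists q.+1%:R^-1 => /=; first by rewrite invr_gt0.
move=> h /=; rewrite sub0r normrN => hq h0; rewrite /ball/= distrC.
apply: le_lt_trans pe; rewrite leNgt; apply/negP => hp.
have cs : {for h, continuous (slope f r)}.
  apply: continuousM; first exact: inv_continuous.
  apply: continuousB; last exact: cst_continuous.
  apply: continuous_comp; last exact: cf.
  by apply: cvgD; [exact: cvg_id|exact: cvg_cst].
have cs' : {for h, continuous (fun x => `|slope f r x - slope f r q.+2%:R^-1|)}.
  apply: continuous_comp; last exact: norm_continuous.
  by apply: continuousB => //; exact: cst_continuous.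
have n1 : \forall x \near h, p.+1%:R^-1 < `|slope f r x - slope f r q.+2%:R^-1|.
  exact: (cvgr_gt _ cs' _ hp).
have n2 : \forall x \near h, 0 < `|x|.
  by apply: (cvgr_gt _ (@norm_continuous _ _ h)); rewrite normr_gt0.
have n3 : \forall x \near h, `|x| < q.+1%:R^-1.
  exact: (cvgr_lt _ (@norm_continuous _ _ h) _ hq).
have : \forall x \near h, [/\ p.+1%:R^-1 < `|slope f r x - slope f r q.+2%:R^-1|, 0 < `|x| & `|x| < q.+1%:R^-1].
  by near=> x; split; near: x.
move=> [d /= d0 dP].
have /rat_in_itvoo[j] : h < h + d by rewrite ltrDl.
rewrite in_itv/= => /andP[hj jh].
have [|k1 k2 k3] := dP (ratr j); first by rewrite /= distrC gtr0_norm ?subr_gt0// ltrBlDl.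
by have := qP j; rewrite k2 k3 leNgt k1 => /(_ isT).
Unshelve. all: by end_near. Qed.

Context d (T : measurableType d) (V : R -> T -> R).
Hypothesis mV : forall r, measurable_fun setT (V r).
Hypothesis cV : forall x, continuous (V^~ x).

Let mslope (h : R) : measurable_fun setT (fun z : R * T => slope (V^~ z.2) z.1 h).
Proof.
rewrite /slope; apply: measurable_funM; first exact: measurable_cst.
apply: measurable_funB; last exact: measurable_caratheodory_function.
apply: (measurable_caratheodory_function (V := fun r x => V (h + r) x)) => //.
move=> x r; apply: (@continuous_comp _ _ _ (fun s => h + s) (V^~ x)); last exact: cV.
by apply: cvgD; [exact: cvg_cst|exact: cvg_id].
Qed.

Definition derivable_points : set (R * T) :=
  [set z | slope_cauchy (V^~ z.2) z.1].

Lemma measurable_derivable_points : measurable derivable_points.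
Proof.
have -> : derivable_points = \bigcap_(p : nat) \bigcup_(q : nat)
    ~` (\bigcup_(h : rat) [set z : R * T | 0 < `|ratr h : R| < q.+1%:R^-1 /\
       p.+1%:R^-1 < `|slope (V^~ z.2) z.1 (ratr h) - slope (V^~ z.2) z.1 q.+2%:R^-1|]).
  apply/seteqP; split => [z zA p _|z zA p].
    have [q qP] := zA p; exists q => // -[h _ [/qP h1]].
    by rewrite ltNge h1.
  have [q _ qP] := zA p I; exists q => h h0; rewrite leNgt; apply/negP => h1.
  by apply: qP; exists h.
apply: bigcapT_measurable => p; apply: bigcupT_measurable => q.
apply: measurableC; apply: bigcupT_measurable_rat => h.
have [hq|hq] := pselect (0 < `|ratr h : R| < q.+1%:R^-1); last first.
  rewrite (_ : [set z | _] = set0)//; apply/seteqP; split => // z [].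
  by move=> /hq.
have mD : measurable_fun setT (fun z : R * T =>
    `|slope (V^~ z.2) z.1 (ratr h) - slope (V^~ z.2) z.1 q.+2%:R^-1|).
  by apply: measurableT_comp => //; exact: measurable_funB.
have := mD measurableT _ (measurable_itv `]p.+1%:R^-1, +oo[).
rewrite setTI; congr measurable; apply/seteqP; split => z /=.
  by rewrite in_itv/= andbT.
by rewrite in_itv/= andbT => -[].
Qed.

(** The value 0 off the derivable points makes this a pointwise limit of measurable difference
    quotients, and makes its square at most that of [derive1], whose default value there is
    unknown. *)
Definition deriv_part (z : R * T) : R :=
  if pselect (derivable_points z) is left _ then derive1 (V^~ z.2) z.1 else 0.

Lemma measurable_deriv_part : measurable_fun setT deriv_part.
Proof.
have mA := measurable_derivable_points.
have mh k : measurable_fun setT (fun z : R * T =>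
    slope (V^~ z.2) z.1 k.+1%:R^-1 * \1_derivable_points z).
  by apply: measurable_funM => //; exact: measurable_indic.
apply: (measurable_fun_cvg mh) => -[r x] _ /=; rewrite /deriv_part.
case: pselect => [Az|Az]; last first.
  by rewrite indicE memNset//; under eq_fun do rewrite mulr0; exact: cvg_cst.
rewrite indicE mem_set//; under eq_fun do rewrite mulr1.
have dV : derivable (V^~ x) r 1 by exact: slope_cauchy_derivable.
have : (fun h : R => h^-1 *: (((V^~ x) \o shift r) (h *: 1) - V r x)) @ 0^' -->
    derive1 (V^~ x) r by rewrite derive1E; exact: dV.
rewrite (slopeE (V^~ x)) => h.
have h0 : (fun k : nat => k.+1%:R^-1 : R) @ \oo --> 0^'.
  move=> Y [e /= e0 eY]; exists (Num.truncn e^-1) => // k /= hk; apply: eY.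
    rewrite /= sub0r normrN gtr0_norm ?invr_gt0// -[ltRHS]invrK ltf_pV2 ?posrE ?invr_gt0//.
    by apply: lt_le_trans (truncnS_gt _) _; rewrite ler_nat.
  by rewrite invr_eq0.
exact: (cvg_comp _ _ h0 h).
Qed.

End measurable_derivative.

(* The measure [mu] (H^{n-1} in the application) is not assumed sigma-finite: Tonelli
   is applied to its restriction to a countable union of sets of finite measure
   that carries the integrand. *)
Section tonelli_support.
Local Open Scope ereal_scope.
Context d (T : measurableType d) (R : realType) (mu : {measure set T -> \bar R}).
Variables (P : set T) (P_ : nat -> set T).
Hypotheses (mP_ : forall i, measurable (P_ i)) (P_oo : forall i, mu (P_ i) < +oo)
  (PE : P = \bigcup_i P_ i).
Import HBNNSimple.

Let mP : measurable P. Proof. by rewrite PE; exact: bigcupT_measurable. Qed.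

Let nu := mrestr mu mP.

Let nu_sigma_finite : sigma_finite setT nu.
Proof.
exists (fun i => if i is j.+1 then P_ j else ~` P).
  apply/esym/seteqP; split => // x _; have [|Px] := pselect (P x).
    by rewrite PE => -[j _ Px]; exists j.+1.
  by exists 0%N.
move=> [|i]; split => //=.
- exact: measurableC.
- by rewrite /nu /mrestr setICl measure0.
- apply: le_lt_trans (P_oo i); apply: le_measure; rewrite ?inE//.
  exact: measurableI.
Qed.

HB.instance Definition _ := Measure.on nu.
HB.instance Definition _ := Measure_isSigmaFinite.Build _ _ _ nu nu_sigma_finite.

(** The nonzero level sets of a simple function below [f] lie in [P], where [nu] and [mu] agree. *)
Let integral_nu (f : T -> \bar R) : (forall x, ~ P x -> f x = 0) ->
  (forall x, 0 <= f x) -> \int[nu]_x f x = \int[mu]_x f x.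
Proof.
move=> fP f0.
have E (h : {nnsfun T >-> R}) : (forall x, (h x)%:E <= f x) ->
    sintegral nu h = sintegral mu h.
  move=> hf; rewrite !sintegralET; apply: eq_fsbigr => y _.
  have [->|y0] := eqVneq y 0%R; first by rewrite !mul0e.
  congr (_ * _); rewrite -[LHS]/(mu ((h @^-1` [set y]) `&` P)); congr (mu _).
  apply/setIidPl => x /= hx; apply: contrapT => Px; have := hf x.
  by rewrite fP// lee_fin leNgt lt0r fun_ge0 hx y0.
rewrite !ge0_integralTE//; congr ereal_sup; apply/seteqP.
by split => _ [h /= hf <-]; exists h => //; rewrite E.
Qed.

Lemma measurable_integral_support (f : R * T -> \bar R) :
  measurable_fun setT f -> (forall z, 0 <= f z) ->
  (forall r x, ~ P x -> f (r, x) = 0) ->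
  measurable_fun setT (fun r => \int[mu]_x f (r, x)).
Proof.
move=> mf f0 fP.
have := @measurable_fun_fubini_tonelli_F _ _ _ _ _ nu f mf f0.
congr measurable_fun; apply/funext => r; rewrite /fubini_F integral_nu// => x; exact: fP.
Qed.

Lemma tonelli_support (f : R * T -> \bar R) :
  measurable_fun setT f -> (forall z, 0 <= f z) ->
  (forall r x, ~ P x -> f (r, x) = 0) ->
  \int[lebesgue_measure]_r \int[mu]_x f (r, x) =
  \int[mu]_x \int[lebesgue_measure]_r f (r, x).
Proof.
move=> mf f0 fP; have := @fubini_tonelli _ _ _ _ _ (@lebesgue_measure R) nu f mf f0.
rewrite [RHS]integral_nu.
- by move=> <-; apply: eq_integral => r _; rewrite integral_nu// => x; exact: fP.
- by move=> x Px; rewrite integral0_eq// => r _; exact: fP.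
- by move=> x; exact: integral_ge0.
Qed.

End tonelli_support.

Section sphere_estimate.
Local Open Scope ereal_scope.
Context d (T : measurableType d) (R : realType) (mu : {measure set T -> \bar R}).
Variables (S : set T) (mS : measurable S) (U : R -> T -> R) (a' a b b' : R).
Hypotheses (a'0 : (0 < a')%R) (a'a : (a' < a)%R) (ab : (a < b)%R) (bb' : (b < b')%R).
Hypothesis LU : forall r, (a' <= r <= b')%R -> L2 mu S (U r).
Hypothesis cU : {ae mu, forall x, S x -> forall r, (a' <= r <= b')%R ->
  {for r, continuous (U^~ x)}}.
Hypothesis dU : {ae mu, forall x, S x ->
  {ae lebesgue_measure, forall r : R, (a' < r < b')%R -> derivable (U^~ x) r 1}}.
Hypothesis estU : {ae mu, forall x, S x -> forall g : R -> R,
  measurable_fun `[a, b] g ->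
  {ae lebesgue_measure, forall r, (a < r < b)%R -> g r = derive1 (U^~ x) r} ->
  ((U b x - U a x) ^+ 2)%:E <=
    (ln (b / a))%:E * \int[lebesgue_measure]_(r in `[a, b]) (r * g r ^+ 2)%:E}.

(** [F r] is the integral of [r * g (r, x) ^+ 2], with [g] the measurable part of the derivative. It
    is small enough to lie below the dissipation, and equals the true integral along almost every
    ray, so the ray estimate integrated over [S] gives the last bound by Tonelli. *)
Lemma sphere_estimate : exists F : R -> \bar R,
  [/\ measurable_fun setT F, forall r, 0 <= F r,
    forall r, (a <= r <= b)%R ->
      F r <= r^-1%:E * \int[mu]_(x in S) (r ^+ 2 * `|derive1 (U^~ x) r| ^+ 2)%:E &
    \int[mu]_(x in S) ((U b x - U a x) ^+ 2)%:E <=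
      (ln (b / a))%:E * \int[lebesgue_measure]_(r in `[a, b]) F r].
Proof.
have [N [mN N0 NP]] : mu.-negligible (~` [set x | [/\ S x -> forall r, (a' <= r <= b')%R ->
  {for r, continuous (U^~ x)}, S x -> {ae lebesgue_measure, forall r : R,
    (a' < r < b')%R -> derivable (U^~ x) r 1} &
    S x -> forall g : R -> R,
  measurable_fun `[a, b] g ->
  {ae lebesgue_measure, forall r, (a < r < b)%R -> g r = derive1 (U^~ x) r} ->
  ((U b x - U a x) ^+ 2)%:E <=
    (ln (b / a))%:E * \int[lebesgue_measure]_(r in `[a, b]) (r * g r ^+ 2)%:E]]).
  by move: cU dU estU; apply: filterS3 => x h1 h2 h3; split.
pose S0 := S `&` ~` N.
have mS0 : measurable S0 by apply: measurableI => //; exact: measurableC.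
have S0P x : S0 x -> [/\ forall r, (a' <= r <= b')%R -> {for r, continuous (U^~ x)},
    {ae lebesgue_measure, forall r : R, (a' < r < b')%R -> derivable (U^~ x) r 1} &
    forall g : R -> R, measurable_fun `[a, b] g ->
  {ae lebesgue_measure, forall r, (a < r < b)%R -> g r = derive1 (U^~ x) r} ->
  ((U b x - U a x) ^+ 2)%:E <=
    (ln (b / a))%:E * \int[lebesgue_measure]_(r in `[a, b]) (r * g r ^+ 2)%:E].
  move=> [Sx Nx]; have : [set x | [/\ S x -> forall r, (a' <= r <= b')%R ->
  {for r, continuous (U^~ x)}, S x -> {ae lebesgue_measure, forall r : R,
    (a' < r < b')%R -> derivable (U^~ x) r 1} &
    S x -> forall g : R -> R,
  measurable_fun `[a, b] g ->
  {ae lebesgue_measure, forall r, (a < r < b)%R -> g r = derive1 (U^~ x) r} ->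
  ((U b x - U a x) ^+ 2)%:E <=
    (ln (b / a))%:E * \int[lebesgue_measure]_(r in `[a, b]) (r * g r ^+ 2)%:E]] x.
    by apply: contrapT => h; apply: Nx; exact: NP.
  by move=> [h1 h2 h3]; split; [exact: h1|exact: h2|exact: h3].
have a'b' : (a' < b')%R by rewrite (lt_trans a'a)// (lt_trans ab).
pose cl r := Num.max a' (Num.min b' r).
have clI r : (a' <= cl r <= b')%R.
  by rewrite /cl le_max lexx/= ge_max (ltW a'b') ge_min lexx.
have clE r : (a' <= r <= b')%R -> cl r = r.
  by move=> /andP[h1 h2]; rewrite /cl min_r// max_r.
have ccl : continuous cl.
  move=> r; rewrite /cl; apply: continuous_max; first exact: cvg_cst.
  by apply: continuous_min; [exact: cvg_cst|exact: cvg_id].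
(* Freezing [r] outside [a', b'] and discarding a null set makes [U] continuous in [r]
   everywhere. *)
pose V r x := (U (cl r) x * \1_S0 x)%R.
have VE r x : (a' <= r <= b')%R -> S0 x -> V r x = U r x.
  by move=> rI Sx; rewrite /V clE// indicE mem_set// mulr1.
have V0 r x : ~ S0 x -> V r x = 0%R.
  by move=> Sx; rewrite /V indicE memNset// mulr0.
have mV r : measurable_fun setT (V r).
  rewrite (_ : V r = (U (cl r)) \_ S0); last first.
    apply/funext => x; rewrite patchE; case: ifPn => [|]; rewrite ?inE ?notin_setE => Sx.
      by rewrite /V indicE mem_set// mulr1.
    exact: V0.
  apply/(measurable_restrictT _ _).1 => //.
  have [mU _] := LU (clI r).
  by apply: measurable_funS mU => // x [].
have cV x : continuous (V^~ x).
  have [Sx|Sx] := pselect (S0 x); last first.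
    by rewrite (_ : V^~ x = cst 0%R); [move=> r; exact: cvg_cst|apply/funext => r; exact: V0].
  have [h _ _] := S0P _ Sx.
  rewrite (_ : V^~ x = (U^~ x) \o cl).
    by move=> r; apply: continuous_comp; [exact: ccl|exact: h].
  by apply/funext => r; rewrite /V indicE mem_set// mulr1.
pose g := deriv_part V.
have mg : measurable_fun setT g by exact: measurable_deriv_part.
(* Each [V] at a rational radius is square integrable, so these superlevel sets have finite measure
   by Chebyshev. Off their union [V] vanishes at rational radii, hence at all radii by continuity,
   and [g] vanishes too. *)
pose P_ (i : nat) : set T := if unpickle i is Some (q, k) then
   [set x | S0 x /\ (k.+1%:R^-1 < `|V (ratr (q : rat)) x|)%R] else set0.
have P_E q k : P_ (pickle (q, k)) = [set x | S0 x /\ (k.+1%:R^-1 < `|V (ratr (q : rat)) x|)%R].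
  by rewrite /P_ pickleK.
pose P := \bigcup_i P_ i.
have VP r x : ~ P x -> V r x = 0%R.
  move=> Px; have [Sx|/V0//] := pselect (S0 x).
  apply/eqP; rewrite -normr_eq0 eq_le normr_ge0 andbT leNgt; apply/negP => Vr.
  have [k hk] : exists k : nat, (k.+1%:R^-1 < `|V r x|)%R.
    exists (Num.truncn `|V r x|^-1); rewrite -[ltRHS]invrK ltf_pV2 ?posrE ?invr_gt0//.
    exact: truncnS_gt.
  have cn : {for r, continuous (fun s => `|V s x|)%R}.
    by apply: (@continuous_comp _ _ _ (V^~ x)); [exact: cV|exact: norm_continuous].
  have [e /= e0 eP] : \forall s \near r, (k.+1%:R^-1 < `|V s x|)%R.
    exact: (cvgr_gt _ cn _ hk).
  have /rat_in_itvoo[q] : (r < r + e)%R by rewrite ltrDl.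
  rewrite in_itv/= => /andP[rq qr].
  have Vq : (k.+1%:R^-1 < `|V (ratr q) x|)%R.
    by apply: eP; rewrite /= distrC gtr0_norm ?subr_gt0// ltrBlDl.
  have PP : P_ (pickle (q, k)) x by rewrite P_E.
  by apply: Px; exact: (ex_intro2 _ _ (pickle (q, k)) I PP).
have mP_ i : measurable (P_ i).
  rewrite /P_; case: unpickle => [[q k]|//]; apply: measurableI => //.
  have mn : measurable_fun setT (fun x => `|V (ratr q) x|)%R by exact: measurableT_comp.
  have := mn measurableT _ (measurable_itv `]k.+1%:R^-1, +oo[%R).
  by rewrite setTI; congr measurable; apply/seteqP; split => x /=; rewrite in_itv/= andbT.
have P_oo i : mu (P_ i) < +oo.
  rewrite /P_; case E : (unpickle i) => [[q k]|]; last by rewrite measure0.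
  have [mU Ufin] := LU (clI (ratr q)).
  have k0 : (0 < k.+1%:R ^- 2 :> R)%R by rewrite invr_gt0 exprn_gt0.
  have mPi : measurable [set x | S0 x /\ (k.+1%:R^-1 < `|V (ratr q) x|)%R].
    by have := mP_ i; rewrite /P_ E.
  suff : (k.+1%:R ^- 2)%:E * mu [set x | S0 x /\ (k.+1%:R^-1 < `|V (ratr q) x|)%R] < +oo.
    case: (mu _) => [x _| |_]; [exact: ltry| |by []].
    by rewrite gt0_muley ?lte_fin.
  move: Ufin; rewrite L2norm_lty; apply: le_lt_trans.
  rewrite -integral_cst// integral_mkcond [leRHS]integral_mkcond.
  apply: le_integral_nomeas => x _; rewrite !patchE.
  case: ifPn; rewrite ?inE/=; last first.
    by move=> _; case: ifPn => // _; rewrite lee_fin sqr_ge0.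
  move=> [Sx kV]; rewrite mem_set; last by case: Sx.
  move: kV; rewrite /V indicE mem_set// mulr1 => kU.
  rewrite lee_fin -[leRHS]real_normK ?num_real// -exprVn lerXn2r// ?nnegrE ?invr_ge0//.
  exact: ltW.
have g0P r x : ~ P x -> g (r, x) = 0%R.
  move=> Px; rewrite /g /deriv_part; case: pselect => //= _.
  rewrite (_ : V^~ x = cst 0%R); first by rewrite derive1_cst.
  by apply/funext => s; exact: VP.
pose f (z : R * T) := ((z.1 * g z ^+ 2) * \1_(`[a, b]%classic) z.1)%:E.
have pos r : (a <= r <= b)%R -> (0 < r)%R.
  by move=> /andP[ar _]; rewrite (lt_le_trans _ ar)// (lt_trans a'0).
have fE r x : (a <= r <= b)%R -> f (r, x) = (r * g (r, x) ^+ 2)%:E.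
  by move=> rab; rewrite /f indicE mem_set ?mulr1//= in_itv.
have fout r x : ~~ (a <= r <= b)%R -> f (r, x) = 0.
  by move=> rab; rewrite /f indicE memNset ?mulr0//= in_itv/=; exact/negP.
have f0 z : 0 <= f z.
  case: z => r x; have [rab|rab] := boolP (a <= r <= b)%R; last by rewrite fout.
  by rewrite fE// lee_fin mulr_ge0 ?sqr_ge0// ltW// pos.
have fP r x : ~ P x -> f (r, x) = 0.
  by move=> Px; rewrite /f g0P// expr0n mulr0 mul0r.
have mf : measurable_fun setT f.
  apply/measurable_EFinP; apply: measurable_funM; last first.
    have mi : measurable_fun setT (\1_(`[a, b]%classic) : R -> R).
      by apply: measurable_indic; exact: measurable_itv.
    exact: (measurableT_comp mi measurable_fst).
  apply: measurable_funM; first exact: measurable_fst.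
  exact: measurable_funX.
(* The margin between [[a, b]] and [[a', b']] makes [U] and [V] agree near every [r] of [[a, b]], so
   they have the same derivative there. *)
have UV r x : (a' < r < b')%R -> S0 x -> \forall s \near r, U s x = V s x.
  move=> /andP[r1 r2] Sx; near=> s; rewrite VE//; apply/andP; split; apply: ltW; near: s.
    exact: lt_nbhsr.
  exact: lt_nbhsl.
have I' r : (a <= r <= b)%R -> (a' < r < b')%R.
  by move=> /andP[h1 h2]; rewrite (lt_le_trans a'a)// (le_lt_trans h2).
exists (fun r => \int[mu]_x f (r, x)); split.
- exact: (measurable_integral_support mP_ P_oo (erefl P)).
- by move=> r; exact: integral_ge0.
- move=> r rab; rewrite -integralZl_pos ?invr_gt0 ?pos//.
  rewrite [leRHS]integral_mkcond; apply: le_integral_nomeas => x _.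
  rewrite fE// patchE; have [Sx|Sx] := pselect (S0 x).
    rewrite mem_set; last by case: Sx.
    rewrite /g /deriv_part; case: pselect => /= _; last first.
      by rewrite expr0n/= mulr0 mule_ge0// lee_fin ?invr_ge0 ?mulr_ge0 ?sqr_ge0// ltW// pos.
    rewrite !derive1E -(near_eq_derive _ (UV _ _ (I' _ rab) Sx)) -EFinM lee_fin.
    rewrite real_normK ?num_real// [leRHS]mulrA [(r ^+ 2)%R]expr2.
    by rewrite [(r^-1 * _)%R]mulrA mulVf ?mul1r// gt_eqF// pos.
  rewrite (_ : g (r, x) = 0%R).
    rewrite expr0n/= mulr0; case: ifPn => // _.
    by rewrite mule_ge0// lee_fin ?invr_ge0 ?mulr_ge0 ?sqr_ge0// ltW// pos.
  rewrite /g /deriv_part; case: pselect => //= _.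
  rewrite (_ : V^~ x = cst 0%R); first by rewrite derive1_cst.
  by apply/funext => s; exact: V0.
have L0 : (0 < ln (b / a))%R.
  by rewrite ln_gt0// ltr_pdivlMr ?mul1r// (lt_trans a'0).
rewrite [X in _ <= _ * X](_ : _ = \int[lebesgue_measure]_r \int[mu]_x f (r, x)); last first.
  rewrite integral_mkcond; apply: eq_integral => r _; rewrite patchE.
  case: ifPn => //; rewrite notin_setE/= in_itv/= => /negP rab.
  by rewrite integral0_eq// => x _; exact: fout.
rewrite (tonelli_support mP_ P_oo (erefl P))//.
rewrite -integralZl_pos// integral_mkcond; apply: ae_le_integral.
exists N; split => // x /= /not_implyP[_]; apply: contra_notP => Nx.
rewrite patchE; case: ifPn => [|_]; last first.
  rewrite mule_ge0// ?lee_fin ?(ltW L0)//; exact: integral_ge0.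
rewrite inE => Sx; have S0x : S0 x by [].
have [_ dx ex] := S0P _ S0x.
have mgx : measurable_fun setT (fun r => g (r, x)).
  exact: (measurableT_comp mg (pair2_measurable x)).
apply: le_trans (ex (fun r => g (r, x)) _ _) _.
- exact: measurable_funTS.
- apply: filterS dx => r + /andP[ar rb].
  have rab : (a <= r <= b)%R by rewrite !ltW.
  move=> /(_ (I' _ rab)) /(near_eq_derivable (UV _ _ (I' _ rab) S0x)) dV.
  rewrite /g /deriv_part; case: pselect => /=; last first.
    by case; exact: derivable_slope_cauchy.
  by move=> _; rewrite !derive1E -(near_eq_derive _ (UV _ _ (I' _ rab) S0x)).
- rewrite lee_pmul2l ?lte_fin//.
  rewrite integral_mkcond; apply: le_integral_nomeas => r _; rewrite patchE.
  case: ifPn => // rab; rewrite fE//; by move: rab; rewrite inE/= in_itv.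
Unshelve. all: by end_near. Qed.

End sphere_estimate.

(** * The energy *)

Section energy_reals.
Context {R : realType}.
Implicit Types (e z L a b : R).

Lemma powR1D_le (gamma x : R) : 0 <= gamma -> 0 <= x <= 1 -> x `^ (1 + gamma) <= x.
Proof.
move=> g0 /andP[]; rewrite le_eqVlt => /predU1P[<- _|x0 x1].
  by rewrite powR0// gt_eqF//; lra.
by apply: ge1r_powR; [rewrite x0|lra].
Qed.

Lemma powRD_le (gamma x y : R) : 0 <= gamma <= 1 -> 0 <= x -> 0 <= y ->
  (x + y) `^ (1 + gamma) <= 4 * (x `^ (1 + gamma) + y `^ (1 + gamma)).
Proof.
move=> /andP[g0 g1] x0 y0.
have p0 : 0 <= 1 + gamma by lra.
have two : 2 `^ (1 + gamma) <= 4 :> R.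
  apply: (@le_trans _ _ (2 `^ 2)); first by apply: ler_powR; lra.
  by rewrite (_ : 4 = 2 ^+ 2); [rewrite -powR_mulrn|rewrite -natrX].
wlog xy : x y x0 y0 / x <= y.
  move=> H; have [|/ltW] := leP x y; first exact: H.
  by move=> yx; rewrite (addrC x) (addrC (x `^ _)); exact: H.
apply: (@le_trans _ _ ((2 * y) `^ (1 + gamma))); first by apply: le_powR => //; lra.
rewrite powRM//; have := powR_ge0 y (1 + gamma); have := powR_ge0 x (1 + gamma).
nra.
Qed.

(** Transfers the gap from [z] to [e]. If [|e| <= 2|z|], the powers compare with factor 4.
    Otherwise, for [e < 0] the gap is at least [|e| / 2], and for [e >= 0] the hypothesis forces
    [e <= 2 * L], which the error [3 * L] absorbs. *)
Lemma energy_gap (eps gamma e z L : R) : 0 < eps <= 1 -> 0 <= gamma < 1 ->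
  `|e| <= 1 -> 0 <= L -> e <= z - eps * `|z| `^ (1 + gamma) + L ->
  eps / 4 * `|e| `^ (1 + gamma) - 3 * L <= z - e.
Proof.
move=> /andP[eps0 eps1] /andP[g0 g1] e1 L0 ez.
have p0 : 0 <= 1 + gamma by lra.
have pe : `|e| `^ (1 + gamma) <= `|e| by apply: powR1D_le; rewrite // normr_ge0.
have pe0 := powR_ge0 `|e| (1 + gamma); have pz0 := powR_ge0 `|z| (1 + gamma).
have [ze|ze] := leP `|e| (2 * `|z|).
  have : `|e| `^ (1 + gamma) <= 4 * `|z| `^ (1 + gamma).
    apply: le_trans (le_powR p0 _ ze) _; first exact: normr_ge0.
    rewrite powRM// ler_wpM2r//.
    apply: (@le_trans _ _ (2 `^ 2)); first by apply: ler_powR; lra.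
    by rewrite (_ : 4 = 2 ^+ 2); [rewrite -powR_mulrn|rewrite -natrX].
  nra.
have zn := ler_norm z; have zn' := ler_norm (- z); rewrite normrN in zn'.
have [e0|e0] := leP 0 e.
  rewrite (ger0_norm e0) in pe ze e1 *; nra.
rewrite (ltr0_norm e0) in pe ze e1 *; nra.
Qed.

(** The constant 16 is the 4 of [energy_gap] times the 4 of [powRD_le]. The division by [A ^+ 2]
    compensates the power of the shift, which is at most [A ^+ 2 * (a + b)]. *)
Lemma energy_ineq (cE eps gamma alpha A e z a b : R) :
  0 < cE <= 1 -> 0 < eps <= 1 -> 0 <= gamma < 1 -> 0 < alpha <= 1 ->
  `|e| <= 1 -> 0 <= a <= 1 -> 0 <= b <= 1 ->
  e <= z - eps * `|z| `^ (1 + gamma) + a + b ->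
  A * alpha = 5 ->
  cE * eps / (16 * A ^+ 2) * `|e + A * (a - b)| `^ (1 + gamma)
    - A * alpha * (a + b) <= cE * (z - e) - a - b.
Proof.
move=> cE01 eps01 g01 /andP[al0 al1] e1 /andP[a0 a1] /andP[b0 b1] ez Aal.
have A5 : 5 <= A by rewrite -Aal; nra.
rewrite Aal.
have /andP[cE0 cE1] := cE01; have /andP[eps0 eps1] := eps01.
have /andP[g0 g1] := g01.
have gap : eps / 4 * `|e| `^ (1 + gamma) - 3 * (a + b) <= z - e.
  by apply: energy_gap => //; lra.
have ph : `|A * (a - b)| `^ (1 + gamma) <= A ^+ 2 * (a + b).
  rewrite normrM powRM// ger0_norm; last lra.
  have ab1 : `|a - b| <= 1 by rewrite ler_norml; lra.
  have ab2 : `|a - b| <= a + b by rewrite ler_norml; lra.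
  have h1 : `|a - b| `^ (1 + gamma) <= a + b.
    by apply: le_trans ab2; apply: powR1D_le => //; rewrite normr_ge0.
  have h2 : A `^ (1 + gamma) <= A ^+ 2.
    by rewrite -powR_mulrn; [apply: ler_powR|]; lra.
  by apply: ler_pM => //; exact: powR_ge0.
have GG : `|e + A * (a - b)| `^ (1 + gamma) <=
    4 * (`|e| `^ (1 + gamma) + A ^+ 2 * (a + b)).
  apply: (@le_trans _ _ ((`|e| + `|A * (a - b)|) `^ (1 + gamma))).
    by apply: le_powR; [lra|exact: normr_ge0|exact: ler_normD].
  apply: le_trans (powRD_le _ _ _) _; [lra|exact: normr_ge0|exact: normr_ge0|].
  by rewrite ler_pM2l// lerD2l.
have A20 : 0 < A ^+ 2 by rewrite exprn_gt0//; lra.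
have c0 : 0 < cE * eps / (16 * A ^+ 2) 
  by apply: divr_gt0; apply: mulr_gt0.
apply: (@le_trans _ _ (cE * eps / (16 * A ^+ 2) *
    (4 * (`|e| `^ (1 + gamma) + A ^+ 2 * (a + b))) - 5 * (a + b))).
  by rewrite lerD2r ler_pM2l.
have -> : cE * eps / (16 * A ^+ 2) * (4 * (`|e| `^ (1 + gamma) + A ^+ 2 * (a + b))) =
    cE * eps / 4 * (`|e| `^ (1 + gamma) / A ^+ 2) + cE * eps / 4 * (a + b).
  by field; rewrite gt_eqF//; lra.
have h3 : `|e| `^ (1 + gamma) / A ^+ 2 <= `|e| `^ (1 + gamma).
  rewrite ler_pdivrMr// ler_peMr ?powR_ge0// expr2; nra.
have p0 := powR_ge0 `|e| (1 + gamma).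
have ce : 0 < cE * eps <= 1 by rewrite mulr_gt0//=; nra.
have k1 : cE * (eps / 4 * `|e| `^ (1 + gamma) - 3 * (a + b)) <= cE * (z - e).
  by rewrite ler_pM2l.
have k2 : cE * eps / 4 * (`|e| `^ (1 + gamma) / A ^+ 2) <=
    cE * eps / 4 * `|e| `^ (1 + gamma) by rewrite ler_wpM2l//; lra.
have k3 : cE * (a + b) <= a + b by rewrite ler_piMl//; lra.
have k4 : cE * eps * (a + b) <= a + b by rewrite ler_piMl//; lra.
lra.
Qed.

End energy_reals.

Lemma bounded_gap (R : realDomainType) (M x y : R) :
  `|x| <= M -> `|y| <= M -> ~~ (2 * M + 1 <= x - y).
Proof. by rewrite !ler_norml => /andP[? ?] /andP[? ?]; lra. Qed.

Section energy_growth.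
Context {R : realType}.
Notation mu := (@lebesgue_measure R).
Variables (cE eps gamma alpha A Lp Lm r1 : R) (r3 : \bar R).
Variables (g eu ez : R -> R) (D : R -> \bar R).
Let I := [set r : R | r1 < r /\ (r%:E < r3)%E].
Hypotheses (cE01 : 0 < cE <= 1) (eps01 : 0 < eps <= 1)
  (gamma01 : 0 <= gamma < 1) (alpha01 : 0 < alpha <= 1) (Aal : A * alpha = 5)
  (r1_ge0 : 0 <= r1) (Lp0 : 0 <= Lp) (Lm0 : 0 <= Lm).
Hypothesis LpI : forall r, I r -> Lp * r `^ alpha <= 1.
Hypothesis LmI : forall r, I r -> Lm * r `^ (- alpha) <= 1.
Hypothesis euI : forall r, I r -> `|eu r| <= 1.
Hypothesis D0 : forall r, (0 <= D r)%E.
Hypothesis g_eu : {ae mu, forall r, I r -> g r = eu r}.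
Hypothesis g_deriv : {ae mu, forall r, I r -> derivable g r 1 /\
  ((cE / r * (ez r - eu r) - Lp * r `^ (alpha - 1) - Lm * r `^ (- alpha - 1))%:E
    + (cE / r)%:E * D r <= (derive1 g r)%:E)%E}.
Hypothesis g_int : forall a b, a <= b -> `[a, b] `<=` I ->
  (\int[mu]_(r in `[a, b]) (derive1 g r)%:E <= (g b - g a)%:E)%E.
Hypothesis eu_ez : {ae mu, forall r, I r ->
  eu r <= ez r - eps * `|ez r| `^ (1 + gamma)
            + Lp * r `^ alpha + Lm * r `^ (- alpha)}.

(* Adding it to the energy absorbs the error terms: its derivative is
   [5 / r * (Lp * r `^ alpha + Lm * r `^ (- alpha))], and 5 exceeds the total cost
   of the errors in [energy_ineq] (3 for the gap, 1 for the derivative, and at most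
   1/4 for the shift itself inside the power). *)
Definition energy_shift (r : R) := A * (Lp * r `^ alpha - Lm * r `^ (- alpha)).
Let dphi (r : R) := A * alpha * (Lp * r `^ (alpha - 1) + Lm * r `^ (- alpha - 1)).
(** Built on the representative [g], for which the integral inequality holds between all pairs of
    radii. *)
Definition energy (r : R) := g r + energy_shift r.
Definition growth_constant := cE * eps / (16 * A ^+ 2).

Let c2 := growth_constant.

Let A0 : 0 < A. Proof. by have /andP[a0 _] := alpha01; rewrite -(pmulr_lgt0 _ a0) Aal. Qed.

Lemma growth_constant_gt0 : 0 < growth_constant.
Proof.
have /andP[? _] := cE01; have /andP[? _] := eps01.
by apply: divr_gt0; apply: mulr_gt0 => //; exact: exprn_gt0.
Qed.

Let Ipos r : I r -> 0 < r. Proof. by move=> [? _]; exact: le_lt_trans r1_ge0 _. Qed.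

Let I_itv a b : I a -> I b -> `[a, b] `<=` I.
Proof.
move=> [ra _] [_ br] r /=; rewrite in_itv/= => /andP[ar rb]; split.
  exact: lt_le_trans ar.
by apply: le_lt_trans br; rewrite lee_fin.
Qed.

Let shift_le r : I r -> `|energy_shift r| <= A.
Proof.
move=> Ir; have h1 := LpI Ir; have h2 := LmI Ir.
have h3 : 0 <= Lp * r `^ alpha by rewrite mulr_ge0// powR_ge0.
have h4 : 0 <= Lm * r `^ (- alpha) by rewrite mulr_ge0// powR_ge0.
rewrite /energy_shift normrM gtr0_norm// ler_piMr ?(ltW A0)//.
by rewrite ler_norml; lra.
Qed.

Let pow1 (r x : R) : 0 < r -> r `^ (x - 1) = r `^ x / r.
Proof.
by move=> r0; rewrite powRB ?powRr1 ?(ltW r0)//; apply/implyP => _; rewrite gt_eqF.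
Qed.

Let dphiE r : 0 < r -> r * dphi r = A * alpha * (Lp * r `^ alpha + Lm * r `^ (- alpha)).
Proof. by move=> r0; rewrite /dphi !pow1//; field; rewrite gt_eqF. Qed.

Let energy_deriv_ge : {ae mu, forall r, I r ->
  ((c2 * `|energy r| `^ (1 + gamma) / r - dphi r)%:E + (cE / r)%:E * D r
    <= (derive1 g r)%:E)%E}.
Proof.
move: g_eu g_deriv eu_ez; apply: filterS3 => r h1 h2 h3 Ir.
have [_] := h2 Ir; apply: le_trans; apply: leeD2r; rewrite lee_fin.
have r0 := Ipos Ir.
have := energy_ineq (cE := cE) (eps := eps) (gamma := gamma) (alpha := alpha)
  (A := A) (e := eu r) (z := ez r) (a := Lp * r `^ alpha) (b := Lm * r `^ (- alpha)).
rewrite mulr_ge0 ?powR_ge0//= mulr_ge0 ?powR_ge0//= LpI// LmI//.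
move=> /(_ cE01 eps01 gamma01 alpha01 (euI Ir) isT isT (h3 Ir) Aal) ineq.
rewrite /energy h1// -(ler_pM2l r0) mulrBr dphiE// !pow1//.
have -> : r * (c2 * `|eu r + energy_shift r| `^ (1 + gamma) / r) =
    c2 * `|eu r + energy_shift r| `^ (1 + gamma) by field; rewrite gt_eqF.
apply: le_trans ineq _; rewrite le_eqVlt; apply/orP; left; apply/eqP.
by field; rewrite gt_eqF.
Qed.

(** A primitive of [k / r - dphi r], the lower bound for the derivative of [g] once the power of the
    energy is replaced by a constant. *)
Let prim (k : R) (r : R) := k * ln r - energy_shift r.

Let is_derive_prim (k r : R) : 0 < r -> is_derive r 1 (prim k) (k / r - dphi r).
Proof.
move=> r0; have h1 := is_derive1_ln r0; have h2 := is_derive1_powR alpha r0.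
have h3 := is_derive1_powR (- alpha) r0.
rewrite /prim /energy_shift; apply: is_derive_eq.
rewrite /dphi /GRing.scale/=; ring.
Qed.

Let derivable_prim (k a b t : R) : I a -> a <= t <= b -> derivable (prim k) t 1.
Proof.
move=> Ia /andP[at_ _]; have t0 : 0 < t by exact: lt_le_trans (Ipos Ia) at_.
by have [] := is_derive_prim k t0.
Qed.

Let derive_prim (k r : R) : 0 < r -> derive1 (prim k) r = k / r - dphi r.
Proof. by move=> r0; rewrite derive1E; have [_ ->] := is_derive_prim k r0. Qed.

Let continuous_deriv_prim (k t : R) : 0 < t -> {for t, continuous (derive1 (prim k))}.
Proof.
move=> t0.
have h : {for t, continuous (fun r : R => k / r - dphi r)}.
  have dp (x : R) : {for t, continuous (fun s : R => s `^ x)}.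
    apply: differentiable_continuous; apply/derivable1_diffP.
    by apply: derivable_powR; rewrite in_itv/= t0.
  apply: continuousB.
    by apply: continuousM; [exact: cst_continuous|apply: inv_continuous; rewrite gt_eqF].
  apply: continuousM; first exact: cst_continuous.
  by apply: continuousD; (apply: continuousM; [exact: cst_continuous|exact: dp]).
rewrite /prop_for/= /continuous_at derive_prim//; apply: cvg_trans h; apply: near_eq_cvg.
by near=> s; rewrite derive_prim//; near: s; exact: lt_nbhsr.
Unshelve. all: by end_near. Qed.

Let integral_prim (k a b : R) : I a -> a <= b ->
  (\int[mu]_(r in `[a, b]) (k / r - dphi r)%:E = (prim k b - prim k a)%:E)%E.
Proof.
move=> Ia ab; rewrite -FTC2_derivable//.
- apply: eq_integral => r; rewrite inE/= in_itv/= => /andP[ar _].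
  by rewrite derive_prim// (lt_le_trans (Ipos Ia)).
- by move=> t; exact: derivable_prim.
- move=> t /andP[at_ _]; apply: continuous_deriv_prim.
  exact: lt_le_trans (Ipos Ia) at_.
Qed.

(** With the constant [k] the lower bound integrates explicitly, and [energy_shift] cancels exactly
    the error terms of the primitive. Upward jumps of [g] are allowed by the direction of
    [g_int]. *)
Lemma energy_growth (k : R) a b : I a -> I b -> a <= b ->
  (forall r, a <= r <= b -> k <= c2 * `|energy r| `^ (1 + gamma)) ->
  k * ln (b / a) <= energy b - energy a.
Proof.
move=> Ia Ib ab kG; have Iab := I_itv Ia Ib.
have := g_int ab Iab.
have : (\int[mu]_(r in `[a, b]) (k / r - dphi r)%:E <=
    \int[mu]_(r in `[a, b]) (derive1 g r)%:E)%E.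
  apply: ae_le_integral; move: energy_deriv_ge; apply: filterS => r h rab.
  apply: le_trans (h (Iab _ rab)); have r0 := Ipos (Iab _ rab).
  apply: (@le_trans _ _ (c2 * `|energy r| `^ (1 + gamma) / r - dphi r)%:E)%E.
    by rewrite lee_fin lerD2r ler_pM2r ?invr_gt0// kG//; move: rab; rewrite /= in_itv.
  by rewrite leeDl// mule_ge0// lee_fin divr_ge0 ?(ltW r0)//; case/andP: cE01 => /ltW.
rewrite integral_prim// => /le_trans h /h; rewrite lee_fin /prim /energy.
have a0 := Ipos Ia; have b0 := Ipos Ib.
rewrite ln_div ?posrE//; lra.
Qed.

Lemma energy_nondecreasing a b : I a -> I b -> a <= b -> energy a <= energy b.
Proof.
move=> Ia Ib ab; rewrite -subr_ge0 -(mul0r (ln (b / a))); apply: energy_growth => //.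
by move=> r _; rewrite mulr_ge0 ?powR_ge0// ltW// growth_constant_gt0.
Qed.

Lemma ae_itv_ex (P : R -> Prop) a b : a < b -> `]a, b[ `<=` I ->
  {ae mu, forall r, I r -> P r} -> exists2 r, a < r < b & P r.
Proof.
move=> ab abI [N [mN N0 NP]]; apply: contrapT => h.
have : (mu `]a, b[%classic <= mu N)%E.
  apply: le_measure; rewrite ?inE//.
  move=> r rab; apply: NP => /= Pr; apply: h; exists r; last exact/Pr/abI.
  by move: rab; rewrite /= in_itv.
rewrite N0 lebesgue_measure_itv/= lte_fin ab -EFinD lee_fin; lra.
Qed.

Let I_open r : I r -> exists2 d, 0 < d & I (r - d) /\ I (r + d).
Proof.
move=> [r1r /lt_ereal_mid[b rb br3]].
exists (Num.min ((r - r1) / 2) (b - r)); first by rewrite lt_min; lra.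
set d := Num.min _ _.
have d1 : d <= (r - r1) / 2 by rewrite /d ge_min lexx.
have d2 : d <= b - r by rewrite /d ge_min lexx orbT.
have d0 : 0 < d by rewrite /d lt_min; lra.
clearbody d; split; split.
- by lra.
- by apply: lt_trans br3; rewrite lte_fin; lra.
- by lra.
- by apply: le_lt_trans br3; rewrite lee_fin; lra.
Qed.

(** The bound holds almost everywhere, hence at points on either side of [r]; monotonicity squeezes
    the value at [r] between them. *)
Lemma energy_bounded r : I r -> `|energy r| <= 1 + A.
Proof.
move=> Ir; have [d d0 [I1 I2]] := I_open Ir.
have H a b : I a -> I b -> a < b -> exists2 s, a < s < b & `|energy s| <= 1 + A.
  move=> Ia Ib ab; have abI : `]a, b[ `<=` I.
    by move=> s sab; apply: (I_itv Ia Ib); exact: subset_itv_oo_cc sab.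
  apply: (ae_itv_ex ab abI); apply: filterS g_eu => s gs Is.
  rewrite /energy gs//; apply: le_trans (ler_normD _ _) _.
  by apply: lerD; [exact: euI|exact: shift_le].
have rd1 : r - d < r by rewrite ltrBlDr ltrDl.
have rd2 : r < r + d by rewrite ltrDl.
have [s1 /andP[h1 h2] e1] := H _ _ I1 Ir rd1.
have [s2 /andP[h3 h4] e2] := H _ _ Ir I2 rd2.
have Is1 : I s1 by apply: (I_itv I1 Ir); rewrite /= in_itv/= !ltW.
have Is2 : I s2 by apply: (I_itv Ir I2); rewrite /= in_itv/= !ltW.
have m1 := energy_nondecreasing Is1 Ir (ltW h2).
have m2 := energy_nondecreasing Ir Is2 (ltW h3).
move: e1 e2; rewrite !ler_norml => /andP[? ?] /andP[? ?]; apply/andP; split; lra.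
Qed.

(* Integrating [d/dlog r |energy| >= c |energy|^(1+gamma)] against a logarithmically
   divergent end of [I] contradicts boundedness unless [energy] has the right sign. *)
Lemma energy_ge0 r : r1 = 0 -> I r -> 0 <= energy r.
Proof.
move=> r10 Ir; rewrite leNgt; apply/negP => Gr.
have r0 := Ipos Ir.
have [k kE] : exists k, k = c2 * `|energy r| `^ (1 + gamma) by eexists.
have k0 : 0 < k.
  by rewrite kE mulr_gt0 ?growth_constant_gt0// powR_gt0// normr_gt0 lt_eqF.
(* Over a logarithmic length [T] the energy would grow by [2 * (1 + A) + 1], more than
   [energy_bounded] permits. *)
pose T := (2 * (1 + A) + 1) / k; have T0 : 0 < T.
  by rewrite divr_gt0//; have := A0; lra.
have Is : I (r * expR (- T)).
  split; first by rewrite r10 mulr_gt0// expR_gt0.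
  apply: le_lt_trans Ir.2; rewrite lee_fin ler_piMr ?(ltW r0)//.
  by rewrite -[leRHS]expR0 ler_expR; lra.
have sr : r * expR (- T) <= r.
  by rewrite ler_piMr ?(ltW r0)// -[leRHS]expR0 ler_expR; lra.
have p0 : 0 <= 1 + gamma by case/andP: gamma01; lra.
have := @energy_growth k _ _ Is Ir sr.
rewrite invfM mulrA divff ?gt_eqF// mul1r -expRN opprK expRK.
have -> : k * T = 2 * (1 + A) + 1 by rewrite /T; field; rewrite gt_eqF.
have B1 := energy_bounded Is; have B2 := energy_bounded Ir.
suff h : forall s, r * expR (- T) <= s <= r -> k <= c2 * `|energy s| `^ (1 + gamma).
  by move=> /(_ h); exact/negP/bounded_gap.
move=> s /andP[s1 s2]; rewrite kE (ler_pM2l growth_constant_gt0).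
apply: le_powR => //.
(* Left of [r] the energy stays below its negative value at [r], so its absolute value, and with it
   the growth rate, is at least that at [r]. *)
have Gs : energy s <= energy r.
  by apply: energy_nondecreasing => //; apply: (I_itv Is Ir); rewrite /= in_itv/= s1.
by rewrite !ltr0_norm ?lerN2//; exact: le_lt_trans Gr.
Qed.

Lemma energy_le0 r : r3 = +oo%E -> I r -> energy r <= 0.
Proof.
move=> r3oo Ir; rewrite leNgt; apply/negP => Gr.
have r0 := Ipos Ir.
have [k kE] : exists k, k = c2 * `|energy r| `^ (1 + gamma) by eexists.
have k0 : 0 < k.
  by rewrite kE mulr_gt0 ?growth_constant_gt0// powR_gt0// normr_gt0 gt_eqF.
pose T := (2 * (1 + A) + 1) / k; have T0 : 0 < T.
  by rewrite divr_gt0//; have := A0; lra.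
have sr : r <= r * expR T.
  by rewrite ler_peMr ?(ltW r0)// -[leLHS]expR0 ler_expR; lra.
have Is : I (r * expR T).
  split; last by rewrite r3oo ltry.
  by case: Ir => h _; exact: lt_le_trans sr.
have p0 : 0 <= 1 + gamma by case/andP: gamma01; lra.
have := @energy_growth k _ _ Ir Is sr.
rewrite mulrAC divff ?gt_eqF// mul1r expRK.
have -> : k * T = 2 * (1 + A) + 1 by rewrite /T; field; rewrite gt_eqF.
have B1 := energy_bounded Is; have B2 := energy_bounded Ir.
suff h : forall s, r <= s <= r * expR T -> k <= c2 * `|energy s| `^ (1 + gamma).
  by move=> /(_ h); exact/negP/bounded_gap.
move=> s /andP[s1 s2]; rewrite kE (ler_pM2l growth_constant_gt0).
apply: le_powR => //.
have Gs : energy r <= energy s.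
  by apply: energy_nondecreasing => //; apply: (I_itv Ir Is); rewrite /= in_itv/= s1.
by rewrite !gtr0_norm//; exact: lt_le_trans Gs.
Qed.

(** Here the power of the energy is discarded and the dissipation kept. [F] replaces [D] because the
    integral of a sum can be split only for a measurable integrand. *)
Lemma energy_dissipation (F : R -> \bar R) a b : I a -> I b -> a <= b ->
  measurable_fun setT F -> (forall r, (0 <= F r)%E) ->
  (forall r, a <= r <= b -> (F r <= (r^-1)%:E * D r)%E) ->
  (cE%:E * \int[mu]_(r in `[a, b]) F r <= (energy b - energy a)%:E)%E.
Proof.
move=> Ia Ib ab mF F0 FD; have Iab := I_itv Ia Ib.
have cE0 : 0 < cE by case/andP: cE01.
pose k1 (r : R) := 0 / r - dphi r.
have ik0 : mu.-integrable `[a, b] (EFin \o derive1 (prim 0)).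
  apply: continuous_compact_integrable; first exact: segment_compact.
  apply/continuous_in_subspaceT => t; rewrite inE/= in_itv/= => /andP[at_ _].
  by apply: continuous_deriv_prim; exact: lt_le_trans (Ipos Ia) at_.
have ik1 : mu.-integrable `[a, b] (EFin \o k1).
  apply: eq_integrable ik0 => //.
  move=> r; rewrite inE/= in_itv/= => /andP[ar _].
  by rewrite /= derive_prim// (lt_le_trans (Ipos Ia)).
have mk1 : measurable_fun `[a, b] (EFin \o k1) by case/integrableP: ik1.
pose k2 (r : R) := (cE%:E * F r)%E.
have mk2 : measurable_fun `[a, b] k2.
  by apply: measurable_funeM; exact: measurable_funTS.
have k20 r : (0 <= k2 r)%E by rewrite mule_ge0// lee_fin ltW.
have le12 : (\int[mu]_(r in `[a, b]) ((k1 r)%:E + k2 r) <= (g b - g a)%:E)%E.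
  apply: le_trans (g_int ab Iab); apply: ae_le_integral; move: energy_deriv_ge.
  apply: filterS => r h rab; apply: le_trans (h (Iab _ rab)); have r0 := Ipos (Iab _ rab).
  apply: leeD.
    rewrite lee_fin /k1 mul0r lerD2r divr_ge0 ?(ltW r0)// mulr_ge0 ?powR_ge0//.
    by rewrite ltW// growth_constant_gt0.
  rewrite /k2 EFinM -muleA; apply: lee_wpmul2l; first by rewrite lee_fin ltW.
  by apply: FD; move: rab; rewrite /= in_itv.
rewrite -integralZl_pos//.
have k1E : (\int[mu]_(r in `[a, b]) (k1 r)%:E = (prim 0 b - prim 0 a)%:E)%E.
  exact: integral_prim.
have [ik2|nik2] := pselect (mu.-integrable `[a, b] k2).
  move: le12; rewrite integralD// k1E.
  rewrite -(fineK (integrable_fin_num _ ik2))// -EFinD !lee_fin /prim /energy; lra.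
(* If [k2] is not integrable, its integral is infinite. Adding the integrable [k1] leaves a finite
   negative part and an infinite positive part, against the finite bound [le12]. *)
exfalso; have k2oo : (\int[mu]_(r in `[a, b]) k2 r = +oo)%E.
  apply/eqP; rewrite -leye_eq leNgt; apply/negP => h; apply: nik2.
  by apply/integrableP; split => //; under eq_integral do rewrite gee0_abs//.
have /integrableP[_ k1fin] := ik1.
have mk12 : measurable_fun `[a, b] (fun r => (k1 r)%:E + k2 r)%E by exact: emeasurable_funD.
pose s r := ((k1 r)%:E + k2 r)%E.
have kNy r : (-oo < s r)%E.
  by apply: (@lt_le_trans _ _ (k1 r)%:E); rewrite ?ltNyr// leeDl.
have negfin : (\int[mu]_(r in `[a, b]) s^\- r < +oo)%E.
  apply: le_lt_trans k1fin; apply: le_integral_nomeas => r _.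
  rewrite funenegE ge_max abse_ge0 andbT /s /=.
  case: (k2 r) (k20 r) => [x| |]//=; last by rewrite leNye.
  rewrite !lee_fin => x0; have := ler_norm (- k1 r); rewrite normrN; lra.
have posoo : (\int[mu]_(r in `[a, b]) s^\+ r = +oo)%E.
  apply/eqP; rewrite -leye_eq leNgt; apply/negP => h.
  have : (\int[mu]_(r in `[a, b]) k2 r <=
      \int[mu]_(r in `[a, b]) (s^\+ r + `|(k1 r)%:E|))%E.
    apply: le_integral_nomeas => r _; rewrite funeposE /s /=.
    apply: (@le_trans _ _ ((k1 r)%:E + k2 r + `|k1 r|%:E)%E); last first.
      by apply: leeD2r; rewrite le_max lexx.
    case: (k2 r) (k20 r) => [x| |]//= x0; rewrite !lee_fin.
    by have := ler_norm (- k1 r); rewrite normrN; lra.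
  rewrite k2oo ge0_integralD//; last 2 first.
    exact: measurable_funepos.
    exact: measurableT_comp.
  by rewrite leye_eq => /eqP h'; have := lte_add_pinfty h k1fin; rewrite h'.
have : (\int[mu]_(r in `[a, b]) s r <= (g b - g a)%:E)%E by exact: le12.
rewrite integralE posoo addye ?leye_eq//.
by apply/eqP => /(congr1 oppe); rewrite oppeK => h; move: negfin; rewrite h.
Qed.

End energy_growth.

Lemma sqr_fine_L2norm d (T : measurableType d) (R : realType)
    (mu : {measure set T -> \bar R}) (D : set T) (f : T -> R) :
  L2norm mu D f \is a fin_num ->
  ((fine (L2norm mu D f) ^+ 2)%:E = \int[mu]_(x in D) (f x ^+ 2)%:E)%E.
Proof.
rewrite L2normE; have := integral_sqr_ge0 mu D f.
move: (\int[mu]_(x in D) _)%E => -[r| |]//=; last by rewrite invr_eq0 pnatr_eq0.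
by rewrite lee_fin => r0 _; rewrite powR12_sqrt// sqr_sqrtr.
Qed.

(** * Convergence of the traces *)

(* Here [t] is logarithmic time, [- ln r] as r goes to 0 and [ln r] as r goes to
   infinity, and [rateP] is the conclusion of [log_rate_bound]. *)
Section log_time.
Local Open Scope ereal_scope.
Context d (T : measurableType d) (R : realType) (mu : {measure set T -> \bar R}).
Variables (S : set T) (mS : measurable S) (V : R -> T -> R) (P : R -> R) (J : set R).
Variables (C c M gamma K delta : R).
Hypotheses (gamma01 : (0 <= gamma < 1)%R) (K0 : (0 < K)%R) (delta0 : (0 < delta)%R).
Hypothesis rateP : forall (Q : R -> R) (N : R -> R -> R),
  (forall t : R, 0 < t -> 0 <= Q t <= M)%R ->
  (forall t t' : R, 0 < t -> t < t' ->
    c * (t' - t) * Q t' `^ (1 + gamma) <= Q t - Q t')%R ->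
  (forall t t' : R, 0 <= N t t')%R ->
  (forall a b c : R, 0 < a -> a < b -> b < c -> N a c <= N a b + N b c)%R ->
  (forall t t' : R, 0 < t -> t < t' ->
    N t t' ^+ 2 <= C * (t' - t) * (Q t - Q t'))%R ->
  forall t t' : R, (0 < t -> t < t' -> N t t' <= K * log_rate gamma delta t)%R.
Variable t0 : R.
Hypotheses (Jt0 : J t0) (J_up : forall t t' : R, J t -> (t <= t')%R -> J t').
Hypothesis L2V : forall t, J t -> L2 mu S (V t).
Hypothesis P_bounded : forall t, J t -> (0 <= P t <= M)%R.
Hypothesis P_decay : forall t t' : R, J t -> (t < t')%R ->
  (c * (t' - t) * P t' `^ (1 + gamma) <= P t - P t')%R.
Hypothesis V_diff : forall t t' : R, J t -> (t < t')%R ->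
  \int[mu]_(x in S) ((V t x - V t' x) ^+ 2)%:E <= (C * (t' - t) * (P t - P t'))%:E.

(** The strict inequality admits the end point of [J] that is excluded from it, such as [- ln r3];
    time measured from there is the logarithm of the ratio of radii. *)
Let base s := forall t : R, (s < t)%R -> J t.

Let L2norm_fin t t' : J t -> (t < t')%R -> L2norm mu S (V t \- V t')%R \is a fin_num.
Proof.
move=> Jt tt'; rewrite ge0_fin_numE ?L2norm_ge0// L2norm_lty.
exact: le_lt_trans (V_diff Jt tt') (ltry _).
Qed.

Let V_rate s t t' : base s -> (s < t)%R -> (t < t')%R ->
  L2norm mu S (V t \- V t')%R <= (K * log_rate gamma delta (t - s))%:E.
Proof.
move=> bs st tt'.
have Js (r : R) : (0 < r)%R -> J (s + r)%R by move=> r0; apply: bs; rewrite ltrDl.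
have fin (a b : R) : (0 < a)%R -> (a < b)%R ->
    L2norm mu S (V (s + a)%R \- V (s + b)%R)%R \is a fin_num.
  by move=> a0 ab; apply: L2norm_fin; [exact: Js|rewrite ltrD2l].
have tE : t = (s + (t - s))%R by rewrite addrC subrK.
have t'E : t' = (s + (t' - s))%R by rewrite addrC subrK.
rewrite [in leLHS]tE [in leLHS]t'E -(fineK (fin _ _ _ _)) ?subr_gt0 ?ltrD2r//.
rewrite lee_fin.
apply: (rateP (Q := fun t => P (s + t)%R)
  (N := fun t t' => fine (L2norm mu S (V (s + t)%R \- V (s + t')%R)%R)))
  ; rewrite ?subr_gt0 ?ltrD2r//.
- by move=> r r0; exact/P_bounded/Js.
- move=> r r' r0 rr'; rewrite [in leLHS](_ : r' - r = (s + r') - (s + r))%R; last by ring.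
  by apply: P_decay; [exact: Js|rewrite ltrD2l].
- by move=> r r'; rewrite fine_ge0// L2norm_ge0.
- move=> a b e a0 ab be; have b0 := lt_trans a0 ab; have e0 := lt_trans b0 be.
  rewrite -fineD ?fin// fine_le ?fin_numD ?fin//; first exact: lt_trans be.
  by apply: L2norm_triangleB => //; [case: (L2V (Js _ a0))|case: (L2V (Js _ b0))|
    case: (L2V (Js _ e0))].
- move=> r r' r0 rr'; have rr : (s + r < s + r')%R by rewrite ltrD2l.
  rewrite -lee_fin sqr_fine_L2norm ?fin//.
  apply: le_trans (V_diff (Js _ r0) rr) _; rewrite lee_fin.
  by rewrite (_ : s + r' - (s + r) = r' - r)%R//; ring.
Qed.

Let V_cauchy (e : R) : (0 < e)%R -> exists2 s, J s & forall t t' : R,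
  (s <= t)%R -> (s <= t')%R -> L2norm mu S (V t \- V t')%R <= e%:E.
Proof.
move=> e0; have bt0 : base t0 by move=> t /ltW; exact: J_up.
have [s0 s00 h] := log_rate_cvg0 gamma01 delta0 (divr_gt0 e0 K0).
have lt_case t t' : (t0 + s0 <= t)%R -> (t < t')%R -> L2norm mu S (V t \- V t')%R <= e%:E.
  move=> st tt'; apply: le_trans (V_rate bt0 _ tt') _.
    by apply: lt_le_trans st; rewrite ltrDl.
  by rewrite lee_fin mulrC -ler_pdivlMr//; apply: h; rewrite lerBrDl.
exists (t0 + s0)%R; first by apply: J_up Jt0 _; rewrite lerDl ltW.
move=> t t' st st'; case: (ltgtP t t') => [tt'|tt'|->].
- exact: lt_case.
- by rewrite L2normB_sym; exact: lt_case.
- rewrite L2norm_le ?(ltW e0)//; under eq_integral do rewrite /= subrr expr0n.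
  by rewrite integral0 lee_fin sqr_ge0.
Qed.

(** The limit is found along integer steps from [t0], before [s] is chosen: one [V0] serves all base
    times. For arbitrarily early [s] this makes the bound vanish. *)
Lemma log_time_limit : exists2 V0, L2 mu S V0 &
  forall s t, base s -> (s < t)%R ->
    L2norm mu S (V t \- V0)%R <= (K * log_rate gamma delta (t - s))%:E.
Proof.
have JV (k : nat) : J (t0 + k%:R)%R by apply: J_up Jt0 _; rewrite lerDl.
have mV t : J t -> measurable_fun S (V t) by move=> /L2V[].
have ge_nat (a : R) : exists k : nat, forall j : nat, (k <= j)%N -> (a < t0 + j%:R)%R.
  exists (Num.truncn (`|a - t0|)%R).+1 => j kj; rewrite -ltrBlDl.
  apply: le_lt_trans (ler_norm _) _; apply: lt_le_trans (truncnS_gt _) _.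
  by rewrite ler_nat.
have [V0 L2V0 cV0] : exists2 u0, L2 mu S u0 & forall e : R, (0 < e)%R ->
    exists N, forall k, (N <= k)%N -> L2norm mu S (V (t0 + k%:R)%R \- u0)%R <= e%:E.
  apply: L2_limit => // [k|e e0]; first exact/L2V/JV.
  have [s _ h] := V_cauchy e0; have [k hk] := ge_nat s.
  by exists k => i j ki kj; apply: h; apply/ltW/hk.
exists V0 => // s t bs st.
apply/lee_addgt0Pr => e e0; have [k hk] := cV0 _ e0; have [k' hk'] := ge_nat t.
pose j := maxn k k'.
have tri := L2norm_triangleB mu mS (mV _ (bs _ st)) (mV _ (JV j)) L2V0.1.
apply: le_trans tri _.
apply: leeD; last by apply: hk; exact: leq_maxl.
by apply: V_rate => //; apply: hk'; exact: leq_maxr.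
Qed.

End log_time.

#[global] Instance ae_hausdorff_filter (R : realType) (n k : nat) :
  Filter (almost_everywhere (@hausdorff R n k)) :=
  ae_filter_ringOfSetsType (@hausdorff R n k).

Section traces.
Context {R : realType} (n : nat).
Variables (m : R) (rho : \bar R) (u v : 'rV[R]_n -> R).
Hypothesis uv : ray_representative rho u v.
Notation H := (@hausdorff R n n.-1).

Lemma L2_rescale (r : R) : 0 < r -> (r%:E < rho)%E -> L2 H (usphere n) (rescale m r v).
Proof.
move=> r0 rrho; have [_ /(_ r r0 rrho)[mv vfin] _] := uv.
split; first by apply: measurable_funM => //; exact: measurable_cst.
move: vfin; rewrite !L2norm_lty => vfin.
have -> : (\int[H]_(x in usphere n) (rescale m r v x ^+ 2)%:E =
    ((r `^ (- m)) ^+ 2)%:E * \int[H]_(x in usphere n) (v (r *: x) ^+ 2)%:E)%E.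
  rewrite -integralZl_pos ?exprn_gt0 ?powR_gt0//.
  by apply: eq_integral => x _; rewrite -EFinM /rescale exprMn.
by rewrite lte_mul_pinfty// lee_fin sqr_ge0.
Qed.

Lemma ray_primitive : {ae H, forall theta, usphere n theta ->
  exists w, primitive_of rho (fun s => v (s *: theta)) w}.
Proof. by have [_ _] := uv; apply: filterS => x h /h[w hw]; exists w. Qed.

Lemma trace_estimate (a b : R) : 0 < a -> a < b -> (b%:E < rho)%E ->
  exists F : R -> \bar R, [/\ measurable_fun setT F, forall r, (0 <= F r)%E,
    forall r, a <= r <= b -> (F r <= r^-1%:E *
      \int[H]_(x in usphere n) (r ^+ 2 * `|radial_deriv m v r x| ^+ 2)%:E)%E &
    (\int[H]_(x in usphere n) ((rescale m b v x - rescale m a v x) ^+ 2)%:E <=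
      (ln (b / a))%:E * \int[lebesgue_measure]_(r in `[a, b]) F r)%E].
Proof.
(* The interval is enlarged to [[a / 2, b']], still inside the admissible radii, to provide the
   margin that [sphere_estimate] requires. *)
move=> a0 ab brho; have [b' bb' b'rho] := lt_ereal_mid brho.
have a20 : 0 < a / 2 by rewrite divr_gt0.
have a2a : a / 2 < a by lra.
have in_rho r : a / 2 <= r <= b' -> 0 < r /\ (r%:E < rho)%E.
  move=> /andP[ar rb]; split; first exact: lt_le_trans ar.
  by apply: le_lt_trans b'rho; rewrite lee_fin.
pose U r : 'rV[R]_n -> R := rescale m r v.
have LU r : a / 2 <= r <= b' -> L2 H (usphere n) (U r).
  by move=> /in_rho[r0 rrho]; exact: L2_rescale.
have [|||F [mF F0 FD FU]] := @sphere_estimate _ _ R H _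
  (@measurable_usphere_hausdorff R n n.-1) U _ _ _ _ a20 a2a ab bb' LU.
- apply: filterS ray_primitive => x h /h[w vw] r /in_rho[r0 rrho].
  exact: rescaled_continuous vw _ _ r0 rrho.
- apply: filterS ray_primitive => x h /h[w vw].
  by apply: filterS (rescaled_derivable vw m a20 b'rho) => r hr /hr[].
- apply: filterS ray_primitive => x h /h[w vw] g mg gE.
  exact: (ray_estimate vw a0 ab brho mg gE).
by exists F; split => // r /FD.
Qed.

End traces.

(** * Limits of the traces at the two ends *)

Section corollary.
Context {R : realType}.
Variables (cE eps gamma alpha : R).
Hypotheses (cE01 : 0 < cE <= 1) (eps01 : 0 < eps <= 1) (alpha01 : 0 < alpha <= 1)
  (gamma01 : 0 <= gamma < 1).
Variables (n : nat) (m r1 : R) (r3 : \bar R) (Lp Lm : R)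
  (u v : 'rV[R]_n -> R) (E : ('rV[R]_n -> R) -> R).
Hypotheses (r1_ge0 : 0 <= r1) (r13 : (r1%:E < r3)%E)
  (Lp0 : 0 <= Lp) (Lm0 : 0 <= Lm) (r1Lm : r1 = 0 -> Lm = 0) (r3Lp : r3 = +oo%E -> Lp = 0)
  (Hu : H1_eball r3 u) (uv : ray_representative r3 u v)
  (HE : H1_functional (eball n 1) E).
Let eu r := E (rescale m r u).
Let ez r := E (homogeneous_ext m (rescale m r v)).
Let I := [set r : R | r1 < r /\ (r%:E < r3)%E].
Hypothesis monotonicity : BVloc_deriv_ge I eu (fun r =>
    (cE / r * (ez r - eu r) - Lp * r `^ (alpha - 1) - Lm * r `^ (- alpha - 1))%:E
    + (cE / r)%:E * \int[hausdorff n n.-1]_(theta in usphere n)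
        (r ^+ 2 * `|radial_deriv m v r theta| ^+ 2)%:E)%E.
Hypothesis epiperimetric : {ae lebesgue_measure, forall r, I r ->
    eu r <= ez r - eps * `|ez r| `^ (1 + gamma)
            + Lp * r `^ alpha + Lm * r `^ (- alpha)}.
Hypothesis Lambda_le1 : (maxe (Lp%:E * r3 `^ alpha) (Lm * r1 `^ (- alpha))%:E <= 1)%E.
Let A := 5 / alpha.
Let c2 := growth_constant cE eps A.
Notation H := (@hausdorff R n n.-1).

Let Ipos r : I r -> 0 < r. Proof. by move=> [? _]; exact: le_lt_trans r1_ge0 _. Qed.

Let LpI r : I r -> Lp * r `^ alpha <= 1.
Proof.
move=> Ir; have r0 := Ipos Ir; have /andP[alpha0 _] := alpha01.
move: Lambda_le1; rewrite ge_max => /andP[+ _].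
case: r3 Ir.2 r3Lp => [s| |]//= rs Lpoo; last by rewrite Lpoo// mul0r.
rewrite lee_fin; apply: le_trans.
by rewrite ler_wpM2l// le_powR// ltW.
Qed.

Let LmI r : I r -> Lm * r `^ (- alpha) <= 1.
Proof.
move=> Ir; have /andP[alpha0 _] := alpha01.
have [/r1Lm ->|r1N0] := eqVneq r1 0; first by rewrite mul0r.
have r10 : 0 < r1 by rewrite lt_neqAle eq_sym r1N0.
move: Lambda_le1; rewrite ge_max => /andP[_]; rewrite lee_fin; apply: le_trans.
have r0 := Ipos Ir; rewrite ler_wpM2l// !powRN lef_pV2 ?posrE ?powR_gt0//.
by rewrite le_powR// ltW// Ir.1.
Qed.

Let euI r : I r -> `|eu r| <= 1.
Proof.
move=> Ir; rewrite ler_norml; have [+ _] := HE; apply; have r0 := Ipos Ir.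
case: r3 Ir.2 Hu => [s| |]//= rs hu; first exact: rescale_H1 (ltW rs) hu.
exact: rescale_H1 (lexx r) (hu _ r0).
Qed.

Let Aal : A * alpha = 5.
Proof. by rewrite /A; case/andP: alpha01 => a0 _; rewrite divfK// gt_eqF. Qed.

(** The convergence argument sees the energy only through these five properties, which hide the
    representative and the shift. *)
Lemma monotone_energy : exists e : R -> R,
  [/\ forall r, I r -> `|e r| <= 1 + A,
      forall k a b, I a -> I b -> a <= b ->
        (forall r, a <= r <= b -> k <= c2 * `|e r| `^ (1 + gamma)) ->
        k * ln (b / a) <= e b - e a,
      r1 = 0 -> forall r, I r -> 0 <= e r,
      r3 = +oo%E -> forall r, I r -> e r <= 0 &
      forall a b, I a -> I b -> a < b ->
        (\int[H]_(x in usphere n) ((rescale m b v x - rescale m a v x) ^+ 2)%:E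
          <= (cE^-1 * ln (b / a) * (e b - e a))%:E)%E].
Proof.
have [g [g_eu _ g_deriv g_int]] := monotonicity.
pose D r := (\int[H]_(x in usphere n) (r ^+ 2 * `|radial_deriv m v r x| ^+ 2)%:E)%E.
have D0 r : (0 <= D r)%E.
  by apply: integral_ge0 => x _; rewrite lee_fin mulr_ge0// sqr_ge0.
exists (energy alpha A Lp Lm g); split.
- exact: (energy_bounded cE01 eps01 gamma01 alpha01 Aal r1_ge0 Lp0 Lm0 LpI LmI
    euI D0 g_eu g_deriv g_int epiperimetric).
- move=> k a b; exact: (energy_growth cE01 eps01 gamma01 alpha01 Aal r1_ge0 Lp0 Lm0
    LpI LmI euI D0 g_eu g_deriv g_int epiperimetric).
- move=> r10 r Ir; exact: (energy_ge0 cE01 eps01 gamma01 alpha01 Aal r1_ge0 Lp0 Lm0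
    LpI LmI euI D0 g_eu g_deriv g_int epiperimetric r10 Ir).
- move=> r3oo r Ir; exact: (energy_le0 cE01 eps01 gamma01 alpha01 Aal r1_ge0 Lp0 Lm0
    LpI LmI euI D0 g_eu g_deriv g_int epiperimetric r3oo Ir).
move=> a b Ia Ib ab; have cE0 : 0 < cE by case/andP: cE01.
have [F [mF F0 FD FU]] := trace_estimate m uv (Ipos Ia) ab Ib.2.
have := energy_dissipation cE01 eps01 gamma01 alpha01 Aal r1_ge0 Lp0 Lm0
    LpI LmI euI g_eu g_deriv g_int epiperimetric Ia Ib (ltW ab) mF F0 FD.
rewrite -lee_pdivlMl// => dis; apply: le_trans FU _.
have ln0 : 0 <= ln (b / a).
  by rewrite ln_ge0// ler_pdivlMr ?mul1r ?(ltW ab)// Ipos.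
apply: le_trans (lee_wpmul2l _ dis) _; first by rewrite lee_fin.
by rewrite -!EFinM lee_fin mulrCA mulrA.
Qed.

Variables (K delta : R).
Hypotheses (K0 : 0 < K) (delta0 : 0 < delta).
Hypothesis rateP : forall (Q : R -> R) (N : R -> R -> R),
  (forall t : R, 0 < t -> 0 <= Q t <= 1 + A) ->
  (forall t t' : R, 0 < t -> t < t' ->
    c2 * (t' - t) * Q t' `^ (1 + gamma) <= Q t - Q t') ->
  (forall t t' : R, 0 <= N t t') ->
  (forall a b c : R, 0 < a -> a < b -> b < c -> N a c <= N a b + N b c) ->
  (forall t t' : R, 0 < t -> t < t' ->
    N t t' ^+ 2 <= cE^-1 * (t' - t) * (Q t - Q t')) ->
  forall t t' : R, 0 < t -> t < t' -> N t t' <= K * log_rate gamma delta t.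

Let I_itv a b r : I a -> I b -> a <= r <= b -> I r.
Proof.
move=> [ra _] [_ br] /andP[ar rb]; split; first exact: lt_le_trans ar.
by apply: le_lt_trans br; rewrite lee_fin.
Qed.

Let c2_gt0 : 0 < c2.
Proof.
exact: growth_constant_gt0 cE01 eps01 alpha01 Aal.
Qed.

Let e_le a b (e : R -> R) :
  (forall k a b, I a -> I b -> a <= b ->
        (forall r, a <= r <= b -> k <= c2 * `|e r| `^ (1 + gamma)) ->
        k * ln (b / a) <= e b - e a) -> I a -> I b -> a <= b -> e a <= e b.
Proof.
move=> eG Ia Ib ab; rewrite -subr_ge0 -(mul0r (ln (b / a))); apply: eG => // r _.
by rewrite mulr_ge0 ?powR_ge0// ltW.
Qed.

(** Letting the base time [s] tend to minus infinity. This is the case of an infinite ratio of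
    radii, where [decay_rate] is 0. *)
Let log_rate_le0 (x : \bar R) (t : R) :
  (forall s, s < t -> (x <= (K * log_rate gamma delta (t - s))%:E)%E) -> (x <= 0)%E.
Proof.
move=> h; apply/lee_addgt0Pr => d d0; rewrite add0e.
have [T T0 hT] := log_rate_cvg0 gamma01 delta0 (divr_gt0 d0 K0).
have tT : t - T < t by rewrite ltrBlDr ltrDl.
apply: le_trans (h _ tT) _; rewrite lee_fin mulrC -ler_pdivlMr//; apply: hT.
by rewrite opprB addrC subrK.
Qed.

Lemma limit_at_0 : r1 = 0 -> exists2 u0 : 'rV[R]_n -> R, L2 H (usphere n) u0 &
  forall r : R, 0 < r -> (r%:E < r3)%E ->
    (L2norm H (usphere n) (rescale m r v \- u0)%R
      <= (K * decay_rate gamma delta (r3 / r%:E))%:E)%E.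
Proof.
move=> r10; have [e [eM eG e0 _ eD]] := monotone_energy.
have {}e0 := e0 r10.
pose J := [set t : R | I (expR (- t))].
have J_up t t' : J t -> t <= t' -> J t'.
  move=> [_ h] tt'; split; first by rewrite r10 expR_gt0.
  by apply: le_lt_trans h; rewrite lee_fin ler_expR lerN2.
have lnexp (t t' : R) : ln (expR (- t) / expR (- t')) = t' - t.
  by rewrite -expRN -expRD expRK opprK addrC.
have [s s0 ss3] : exists2 s, r1 < s & (s%:E < r3)%E by exact: lt_ereal_mid.
have s_gt0 : 0 < s by rewrite -r10.
have Jt0 : J (- ln s) by rewrite /J/= opprK lnK ?posrE.
have p0 : 0 <= 1 + gamma by case/andP: gamma01; lra.
have [u0 L2u0 hu0] : exists2 u0, L2 H (usphere n) u0 &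
    forall s t, (forall t, s < t -> J t) -> s < t ->
    (L2norm H (usphere n) (rescale m (expR (- t)) v \- u0)%R
      <= (K * log_rate gamma delta (t - s))%:E)%E.
  apply: (log_time_limit (@measurable_usphere_hausdorff R n n.-1)
    (V := fun t => rescale m (expR (- t)) v) (P := fun t => e (expR (- t))) gamma01 K0
    delta0 rateP Jt0 J_up).
  - by move=> t [_ ?]; apply: (L2_rescale m uv); rewrite ?expR_gt0.
  - by move=> t Jt; rewrite e0//=; apply: le_trans (eM _ Jt); exact: ler_norm.
  - move=> t t' Jt tt'; have Jt' := J_up _ _ Jt (ltW tt').
    have eG' := eG; rewrite mulrAC -lnexp; apply: eG => //; first by rewrite ler_expR lerN2 ltW.
    (* The energy is nonnegative and nondecreasing, hence smallest at the left end [expR (- t')],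
       the later time. *)
    move=> r rI; rewrite ler_pM2l// le_powR ?e0//.
    have Ir := I_itv Jt' Jt rI; rewrite ger0_norm ?e0//.
    by apply: (e_le eG' Jt' Ir); case/andP: rI.
  - move=> t t' Jt tt'; have Jt' := J_up _ _ Jt (ltW tt').
    by rewrite -lnexp; apply: eD => //; rewrite ltr_expR ltrN2.
exists u0 => // r r0 rr3.
have {}hu0 s' : (forall t, s' < t -> ((expR (- t))%:E < r3)%E) -> s' < - ln r ->
    (L2norm H (usphere n) (rescale m r v \- u0)%R
      <= (K * log_rate gamma delta (- ln r - s'))%:E)%E.
  move=> Js' s'r; rewrite -{1}[r]lnK ?posrE// -[ln r in leLHS]opprK; apply: hu0 => // t ht.
  by split; [rewrite r10 expR_gt0|exact: Js'].
case: r3 rr3 hu0 => [s3| |] //= rs3 hu0.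
  rewrite lte_fin in rs3; have s30 := lt_trans r0 rs3.
  rewrite inver gt_eqF// -EFinM decay_rateE ?divr_gt0//.
  (* The base time is [- ln s3], so the elapsed time at radius [r] is [ln (s3 / r)]. *)
  rewrite ln_div ?posrE// addrC -[ln s3]opprK; apply: hu0; last first.
    by rewrite ltrN2 ltr_ln ?posrE.
  move=> t ht; by rewrite lte_fin -[ltRHS]lnK ?posrE// ltr_expR ltrNl.
rewrite inver gt_eqF// gt0_mulye ?lte_fin ?invr_gt0//= mulr0; apply: log_rate_le0 => s' s'r.
by apply: hu0 => // t _; rewrite ltry.
Qed.

Lemma limit_at_infinity : r3 = +oo%E ->
  exists2 uoo : 'rV[R]_n -> R, L2 H (usphere n) uoo &
  forall r : R, r1 < r ->
    (L2norm H (usphere n) (rescale m r v \- uoo)%R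
      <= (K * decay_rate gamma delta (r%:E / r1%:E))%:E)%E.
Proof.
move=> r3oo; have [e [eM eG _ e0 eD]] := monotone_energy.
have {}e0 := e0 r3oo.
have IE r : I r <-> r1 < r by split=> [[]//|?]; split=> //; rewrite r3oo ltry.
pose J := [set t : R | I (expR t)].
have J_up t t' : J t -> t <= t' -> J t'.
  by move=> [h _] tt'; apply/IE; apply: lt_le_trans h _; rewrite ler_expR.
have lnexp (t t' : R) : ln (expR t' / expR t) = t' - t.
  by rewrite -expRN -expRD expRK.
have Jt0 : J (ln (r1 + 1)) by apply/IE; rewrite lnK ?posrE ?ltrDl//; have := r1_ge0; lra.
have p0 : 0 <= 1 + gamma by case/andP: gamma01; lra.
have [uoo L2u hu] : exists2 u0, L2 H (usphere n) u0 &
    forall s t, (forall t, s < t -> J t) -> s < t ->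
    (L2norm H (usphere n) (rescale m (expR t) v \- u0)%R
      <= (K * log_rate gamma delta (t - s))%:E)%E.
  apply: (log_time_limit (@measurable_usphere_hausdorff R n n.-1)
    (V := fun t => rescale m (expR t) v) (P := fun t => - e (expR t)) gamma01 K0
    delta0 rateP Jt0 J_up).
  - by move=> t [_ ?]; apply: (L2_rescale m uv); rewrite ?expR_gt0.
  - move=> t Jt; rewrite oppr_ge0 e0//=; apply: le_trans (eM _ Jt).
    by rewrite -normrN; exact: ler_norm.
  - move=> t t' Jt tt'; have Jt' := J_up _ _ Jt (ltW tt').
    have eG' := eG; rewrite opprK [leRHS]addrC mulrAC -lnexp; apply: eG => //.
      by rewrite ler_expR ltW.
    (* The energy is nonpositive and nondecreasing, so its absolute value is smallest at the right
       end [expR t'], again the later time. *)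
    move=> r rI; have Ir := I_itv Jt Jt' rI.
    rewrite ler_pM2l// le_powR ?oppr_ge0 ?e0// ler0_norm ?e0// lerN2.
    by apply: (e_le eG' Ir Jt'); case/andP: rI.
  - move=> t t' Jt tt'; have Jt' := J_up _ _ Jt (ltW tt').
    rewrite opprK [X in _ * X]addrC -lnexp.
    under eq_integral do rewrite -sqrrN opprB.
    by apply: eD => //; rewrite ltr_expR.
exists uoo => // r r1r; have r0 : 0 < r by exact: le_lt_trans r1_ge0 _.
have {}hu s' : (forall t, s' < t -> J t) -> s' < ln r ->
    (L2norm H (usphere n) (rescale m r v \- uoo)%R
      <= (K * log_rate gamma delta (ln r - s'))%:E)%E.
  by move=> Js' s'r; have := hu _ _ Js' s'r; rewrite lnK.
have [r10|r1N0] := eqVneq r1 0.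
  (* The extended inverse of 0 is [+oo], so the ratio is infinite and every base time is allowed. *)
  rewrite r10 inve0 gt0_muley ?lte_fin//= mulr0; apply: log_rate_le0 => s' s'r.
  by apply: hu => // t _; apply/IE; rewrite r10 expR_gt0.
have r1_gt0 : 0 < r1 by rewrite lt_neqAle eq_sym r1N0.
rewrite inver gt_eqF// -EFinM decay_rateE ?divr_gt0//.
rewrite ln_div ?posrE//; apply: hu; last by rewrite ltr_ln ?posrE.
by move=> t ht; apply/IE; rewrite -[ltLHS]lnK ?posrE// ltr_expR.
Qed.

End corollary.

(** * Constancy along rays when both ends are infinite *)

Section sphere_constant.
Context {R : realType} (n : nat).
Notation H := (@hausdorff R n n.-1).
Variables (m : R) (u v u0 : 'rV[R]_n -> R).
Hypothesis uv : ray_representative +oo u v.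

Lemma L2norm_le0_ae d (T : measurableType d) (mu : {measure set T -> \bar R})
    (D : set T) (f : T -> R) : measurable D -> measurable_fun D f ->
  (L2norm mu D f <= 0)%E -> {ae mu, forall x, D x -> f x = 0}.
Proof.
move=> mD mf; rewrite L2norm_le// expr0n/= => f0.
have mf2 : measurable_fun D (fun x => (f x ^+ 2)%:E).
  by apply/measurable_EFinP; exact: measurable_funX.
have : (\int[mu]_(x in D) `|(f x ^+ 2)%:E|)%E = 0.
  under eq_integral do rewrite gee0_abs ?lee_fin ?sqr_ge0//.
  by apply/eqP; rewrite eq_le f0 integral_sqr_ge0.
move=> /(ae_eq_integral_abs _ mD mf2); apply: filterS => x h /h [] /eqP.
by rewrite sqrf_eq0 => /eqP.
Qed.

(** Equality with [u0] in L2 leaves a null set depending on [r]. Rational radii share one null set,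
    and continuity along rays extends the equality to all radii, so the rescaled ray is constant. *)
Lemma is_derive_rescale0 : L2 H (usphere n) u0 ->
  (forall r, 0 < r -> (L2norm H (usphere n) (rescale m r v \- u0)%R <= 0)%E) ->
  {ae H, forall theta, usphere n theta -> forall r : R, 0 < r ->
    is_derive r 1 (fun s => rescale m s v theta) 0}.
Proof.
move=> [mu0 _] h.
have eq_rat : {ae H, forall theta, forall q : rat, usphere n theta ->
    (0 : R) < ratr q ->
    rescale m (ratr q) v theta = u0 theta}.
  (* The rationals are indexed by [nat] through [unpickle], the form in which [ae_foralln] merges
     countably many null sets. *)
  suff : {ae H, forall theta, forall k, usphere n theta -> forall q : rat,
      unpickle k = Some q -> (0 : R) < ratr q -> rescale m (ratr q) v theta = u0 theta}.
    by apply: filterS => x hx q Sx q0; apply: hx (pickleK q) q0.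
  apply/ae_foralln => k; case: (unpickle k) => [q|]; last exact: aeW.
  have [q0|q0] := ltP 0 (ratr q : R); last first.
    by apply: aeW => x _ q' [<-] /lt_le_trans /(_ q0); rewrite ltxx.
  have mS := @measurable_usphere_hausdorff R n n.-1.
  have [mr _] := L2_rescale m uv q0 (ltry _).
  have := L2norm_le0_ae mS (measurable_funB mr mu0) (h _ q0).
  by apply: filterS => x hx Sx q' [<-] _; apply/eqP; rewrite -subr_eq0; apply/eqP/hx.
move: eq_rat (ray_primitive uv); apply: filterS2 => x eqx hx Sx r r0.
have [w vw] := hx Sx.
have cU (s : R) : 0 < s -> {for s, continuous (fun s : R => rescale m s v x)}.
  by move=> s0; exact: rescaled_continuous vw _ _ s0 (ltry _).
have const (s : R) : 0 < s -> rescale m s v x = u0 x.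
  move=> s0; apply: contrapT => /eqP neq.
  have : \forall t \near (s : R), rescale m t v x != u0 x.
    have := cU s s0 [set y | y != u0 x]; apply.
    by apply: open_nbhs_nbhs; split=> //; exact: open_neq.
  move=> /nbhs_ballP[e /= e0 be].
  have [|q] := @rat_in_itvoo R (Num.max 0 (s - e)) s.
    by rewrite gt_max s0/= ltrBlDr ltrDl.
  rewrite in_itv/= gt_max => /andP[/andP[q0 sq] qs].
  have : ball s e (ratr q).
    by rewrite /ball/= ger0_norm ?subr_ge0 ?(ltW qs)// ltrBlDr -ltrBlDl.
  by move=> /be; rewrite eqx// eqxx.
apply: near_eq_is_derive (is_derive_cst (u0 x) r 1).
by near=> s; rewrite const//; near: s; exact: lt_nbhsr.
Unshelve. all: by end_near. Qed.

End sphere_constant.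

Theorem corollary2p6 (R : realType) (cE eps gamma alpha : R)
    (hcE : 0 < cE <= 1) (heps : 0 < eps <= 1) (halpha : 0 < alpha <= 1)
    (hgamma : 0 <= gamma < 1) :
  exists c delta : R, [/\ 0 < c, 0 < delta &
  forall (n : nat) (m r1 : R) (r3 : \bar R) (Lp Lm : R)
    (u v : 'rV[R]_n -> R) (E : ('rV[R]_n -> R) -> R),
  (0 < n)%N -> 2 - n%:R < m ->
  0 <= r1 -> (r1%:E < r3)%E ->
  0 <= Lp -> 0 <= Lm -> (r1 = 0 -> Lm = 0) -> (r3 = +oo%E -> Lp = 0) ->
  H1_eball r3 u -> ray_representative r3 u v ->
  H1_functional (eball n 1) E ->
  let eu r := E (rescale m r u) in
  let ez r := E (homogeneous_ext m (rescale m r v)) in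
  let I := [set r : R | r1 < r /\ (r%:E < r3)%E] in
  BVloc_deriv_ge I eu (fun r =>
    (cE / r * (ez r - eu r) - Lp * r `^ (alpha - 1) - Lm * r `^ (- alpha - 1))%:E
    + (cE / r)%:E * \int[hausdorff n n.-1]_(theta in usphere n)
        (r ^+ 2 * `|radial_deriv m v r theta| ^+ 2)%:E)%E ->
  {ae lebesgue_measure, forall r, I r ->
    eu r <= ez r - eps * `|ez r| `^ (1 + gamma)
            + Lp * r `^ alpha + Lm * r `^ (- alpha)} ->
  (maxe (Lp%:E * r3 `^ alpha) (Lm * r1 `^ (- alpha))%:E <= 1)%E ->
  [/\ r1 = 0 ->
        exists2 u0 : 'rV[R]_n -> R, L2 (hausdorff n n.-1) (usphere n) u0 &
        forall r : R, 0 < r -> (r%:E < r3)%E ->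
          (L2norm (hausdorff n n.-1) (usphere n) (rescale m r v \- u0)%R
           <= (c * decay_rate gamma delta (r3 / r%:E))%:E)%E,
      r3 = +oo%E ->
        exists2 uoo : 'rV[R]_n -> R, L2 (hausdorff n n.-1) (usphere n) uoo &
        forall r : R, r1 < r ->
          (L2norm (hausdorff n n.-1) (usphere n) (rescale m r v \- uoo)%R
           <= (c * decay_rate gamma delta (r%:E / r1%:E))%:E)%E &
      r1 = 0 -> r3 = +oo%E ->
        {ae hausdorff n n.-1, forall theta, usphere n theta ->
          forall r : R, 0 < r ->
            is_derive r 1 (fun s => rescale m s v theta) 0}]].
Proof.
have A0 : 0 < 1 + 5 / alpha by case/andP: halpha => a0 _; rewrite addr_gt0// divr_gt0.
have c20 : 0 < growth_constant cE eps (5 / alpha).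
  have al5 : 5 / alpha * alpha = 5.
    by case/andP: halpha => a0 _; rewrite divfK// gt_eqF.
  exact: growth_constant_gt0 hcE heps halpha al5.
have C0 : 0 < cE^-1 by rewrite invr_gt0; case/andP: hcE.
have [K [delta [K0 delta0 rateP]]] := log_rate_bound C0 c20 (ltW A0) hgamma.
exists K, delta; split=> // n m r1 r3 Lp Lm u v E _ _ r1_ge0 r13 Lp0 Lm0 r1Lm r3Lp Hu uv HE.
move=> eu ez I mono epi Lambda.
have lim0 := limit_at_0 hcE heps halpha hgamma r1_ge0 r13 Lp0 Lm0 r1Lm r3Lp Hu uv HE mono
  epi Lambda K0 delta0 rateP.
have limoo := limit_at_infinity hcE heps halpha hgamma r1_ge0 Lp0 Lm0 r1Lm r3Lp Hu uv HE
  mono epi Lambda K0 delta0 rateP.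
split=> // r10 r3oo; have [u0 L2u0 hu0] := lim0 r10.
move: uv hu0; rewrite r3oo => uvoo hu0; apply: (is_derive_rescale0 uvoo L2u0) => r r0.
(* The ratio of radii is [+oo], where the rate is 0: every rescaled trace is at distance 0 from
   [u0]. *)
have := hu0 r r0 (ltry r).
by rewrite inver gt_eqF// gt0_mulye ?lte_fin ?invr_gt0//= mulr0.
Qed.
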